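(* Let $\Bbbk$ be a field, let $n\geq1$, and let $A=\Bbbk A_n$ be the path algebra of the linearly oriented quiver $1\to2\to\cdots\to n$. Let $$X_{a,b}=Z([a,b])\ (1\le a\le b<n),\quad R_r=Z(P_r)\ (2\le r\le n),\quad L_s=L(P_s)\ (1\le s\le n),\quad \Omega_{a,b}=\Omega Z([a,b])\ (1\le a<b<n)$$ be the indecomposable $\tau$-rigid $T(\Bbbk A_n)$-modules. Every basic $\tau$-rigid $T(\Bbbk A_n)$-module with exactly two indecomposable direct summands belongs, up to isomorphism, to one of the following ten types. For each type, with all indices in the ranges above, the module displayed is $\tau$-rigid if and only if the stated condition holds, and the number of isomorphism classes of $\tau$-rigid modules of that type is as stated: 1. $X_{a,b}\oplus X_{c,d}$ (ordered so that $a<c$, or $a=c$ and $b>d$): $[c,d]\subsetneq[a,b]$ or $c\ge b+2$; number $\frac{n(n-1)(n-2)(n+1)}{12}$. 2. $X_{a,b}\oplus R_r$: $a\ge2$ and ($r\ge b+2$ or $r\le a$); number $\frac{(n-1)(n-2)(2n-3)}{6}$. 3. $X_{a,b}\oplus L_s$: $s\le a$ or $s\ge b+2$; number $\frac{n(n-1)(2n-1)}{6}$. 4. $X_{a,b}\oplus\Omega_{c,d}$: $b\le c$, or $a\ge d+1$, or $c+2\le a\le b\le d-1$; number $\frac{(n-1)(n-2)(n^2-3n+4)}{8}$. 5. $R_r\oplus R_s$: $r\ne s$; number $\binom{n-1}{2}$. 6. $R_r\oplus L_s$: $2\le s\le r\le n$; number $\frac{n(n-1)}{2}$. 7. $R_r\oplus\Omega_{c,d}$: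 $r\ge d+1$; number $\frac{n(n-1)(n-2)}{6}$. 8. $L_r\oplus L_s$: $r\neq s$; number $\binom n2$. 9. $L_s\oplus\Omega_{c,d}$: $c+2\le s\le d+1$; number $\frac{n(n-1)(n-2)}{6}$. 10. $\Omega_{a,b}\oplus\Omega_{c,d}$ (ordered so that $a<c$, or $a=c$ and $b>d$): $[c,d]\subsetneq[a,b]$; number $\frac{(n-1)(n-2)(n-3)(n+4)}{24}$. Consequently, the number of isomorphism classes of basic rank-two $\tau$-rigid $T(\Bbbk A_n)$-modules is $$\binom n2\binom{n+1}2=\frac{n^2(n^2-1)}{4}.$$
   Context: All modules are finite-dimensional left modules, with $\Bbbk A_n$-modules identified with representations of the quiver $1\to2\to\cdots\to n$. For $1\le a\le b\le n$, $[a,b]$ denotes the indecomposable interval module supported on the vertices $a,\dots,b$ (one-dimensional at each of these, identity maps between them); inclusions between intervals are inclusions of the corresponding sets of vertices. $P_a=[a,n]$ is the indecomposable projective and $I_b=[1,b]$ the indecomposable injective module at the given vertex. For $b<n$ the minimal projective resolution of $[a,b]$ is $0\to P_{b+1}\xrightarrow{\partial}P_a\to[a,b]\to0$. For a finite-dimensional algebra $A$, $D=\mathrm{Hom}_\Bbbk(-,\Bbbk)$ and $T(A)=A\ltimes D(A)$ is the trivial extension: the $\Bbbk$-algebra on $A\oplus D(A)$ with multiplication $(a,f)(b,g)=(ab,ag+fb)$, where $(af)(x)=f(xa)$, $(fa)(x)=f(ax)$. Let $\nu=DA\otimes_A-$ (so $\nu(P_a)=I_a$ for $A=\Bbbk A_n$).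 A $T(A)$-module is identified with a pair $(X,\alpha)$, where $X$ is an $A$-module and $\alpha:\nu(X)\to X$ satisfies $\alpha\circ\nu(\alpha)=0$; morphisms $(X,\alpha)\to(Y,\beta)$ are $A$-homomorphisms $f$ with $f\alpha=\beta\,\nu(f)$. Then $Z(X)=(X,0)$, $L(X)=\left(X\oplus\nu(X),\begin{pmatrix}0&0\\1&0\end{pmatrix}\right)$, and for $b<n$, $\Omega Z([a,b])=\left(P_{b+1}\oplus I_a,\begin{pmatrix}0&0\\ \nu(\partial)&0\end{pmatrix}\right)$, the syzygy of $Z([a,b])$. A module $M$ over a finite-dimensional algebra $B$ is $\tau$-rigid if $\mathrm{Hom}_B(M,\tau M)=0$, where $\tau$ is the Auslander–Reiten translation of $B$; it is basic if it is a direct sum of pairwise non-isomorphic indecomposables; a basic module has rank two if it has exactly two indecomposable direct summands.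
   Formalization: In types 5 and 8 the condition r ≠ s and the number are stated for basic rank-two τ-rigid modules, since R_r⊕R_r and L_r⊕L_r (for example L_1⊕L_1 with n = 1) are τ-rigid although r = s. *)

(* Defs.v *)
From HB Require Import structures.
From mathcomp Require Import all_boot all_order all_algebra all_field.

Set Implicit Arguments.
Unset Strict Implicit.
Unset Printing Implicit Defensive.

Import GRing.Theory.
Local Open Scope ring_scope.

(* The converse ring [B^c] of [ssralg] as a finite-dimensional algebra, so that
   right [B]-modules are left [B^c]-modules. *)
Section ConverseAlgebra.
Variables (k : fieldType) (B : falgType k).
HB.instance Definition _ := Vector.copy B^c B.
HB.instance Definition _ := GRing.Lmodule_isLalgebra.Build k B^c
  (fun a u v => @scalerAr k B a v u).
HB.instance Definition _ := GRing.Lalgebra_isAlgebra.Build k B^c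
  (fun a u v => @scalerAl k B a v u).
End ConverseAlgebra.

Lemma linfunE (k : fieldType) (U V : vectType k) (f : U -> V) :
  linear f -> linfun f =1 f.
Proof.
move=> lf u; pose g : {linear U -> V} := HB.pack f (GRing.isLinear.Build k U V _ f lf).
exact: (lfunE g u).
Qed.

Record fdmod (k : fieldType) (B : falgType k) := FdMod {
  fdcar :> vectType k;
  act : B -> fdcar -> fdcar;
  act_linearl : forall v, linear (act^~ v);
  act_linearr : forall b, linear (act b);
  act1 : forall v, act 1 v = v;
  actM : forall a b v, act (a * b) v = act a (act b v) }.

Arguments act {k B f} b v : rename.

Section ModuleTheory.
Variables (k : fieldType) (B : falgType k).
Implicit Types M N : fdmod B.

HB.instance Definition _ M (b : B) :=
  GRing.isLinear.Build k M M _ (act b) (act_linearr b).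

Definition actf M (b : B) : 'End(M) := linfun (act b).

Lemma actfE M b v : actf M b v = act b v.
Proof. exact: lfunE. Qed.

Lemma actDl M a b (v : M) : act (a + b) v = act a v + act b v.
Proof. by have := act_linearl v 1 a b; rewrite !scale1r. Qed.

Lemma act0l M (v : M) : act 0 v = 0.
Proof. by apply: (addrI (act 0 v)); rewrite -actDl !addr0. Qed.

Lemma actZl M c a (v : M) : act (c *: a) v = c *: act a v.
Proof. by have := act_linearl v c a 0; rewrite addr0 act0l addr0. Qed.

Lemma act_suml M I r (P : pred I) (c : I -> k) (b : I -> B) (v : M) :
  act (\sum_(i <- r | P i) c i *: b i) v =
  \sum_(i <- r | P i) c i *: act (b i) v.
Proof.
rewrite (big_morph (act^~ v) (fun a b => actDl a b v) (act0l v)).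
by apply: eq_bigr => i _; rewrite actZl.
Qed.

Definition is_hom M N (f : 'Hom(M, N)) := forall b v, f (act b v) = act b (f v).

Definition mod_iso M N := exists2 f : 'Hom(M, N), is_hom f & bijective f.

Definition stable M (U : {vspace M}) := forall b v, v \in U -> act b v \in U.

End ModuleTheory.

Section DirectSum.
Variables (k : fieldType) (B : falgType k) (M N : fdmod B).

Let sact (b : B) (v : M * N) : M * N := (act b v.1, act b v.2).
Fact dsum_linearl v : linear (sact^~ v).
Proof. by move=> c a b; rewrite /sact !actDl !actZl. Qed.
Fact dsum_linearr b : linear (sact b).
Proof. by move=> c u v; rewrite /sact /= !linearP. Qed.
Fact dsum_act1 v : sact 1 v = v.
Proof. by case: v => x y; rewrite /sact !act1. Qed.
Fact dsum_actM a b v : sact (a * b) v = sact a (sact b v).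
Proof. by rewrite /sact !actM. Qed.

Definition dsum : fdmod B :=
  FdMod dsum_linearl dsum_linearr dsum_act1 dsum_actM.

Definition dfst : 'Hom(dsum, M) := linfun (fun v : dsum => v.1).
Definition dinr : 'Hom(N, dsum) := linfun (fun y : N => (0, y) : dsum).

Lemma dfstE v : dfst v = v.1.
Proof. by rewrite linfunE. Qed.
Lemma dinrE y : dinr y = (0, y).
Proof.
rewrite linfunE // => c u v.
by congr pair; rewrite -[RHS]/(c *: (0 : M) + 0) scaler0 addr0.
Qed.

Lemma dfst_hom : is_hom dfst.
Proof. by move=> b v; rewrite !dfstE. Qed.
Lemma dinr_hom : is_hom dinr.
Proof. by move=> b v; rewrite !dinrE /= /sact /= linear0. Qed.
End DirectSum.

Section Quotient.
Variables (k : fieldType) (V : vectType k) (U : {vspace V}).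

(* The quotient V / U is carried by the chosen complement of U. *)
Definition quotv := subvs_of (U^C)%VS.
Definition qproj : 'Hom(V, quotv) :=
  linfun (fun v => vsproj (U^C)%VS (daddv_pi (U^C)%VS U v)).

Let capCU : (U^C :&: U = 0)%VS. Proof. by rewrite capvC capv_compl. Qed.

Lemma qprojE v : vsval (qproj v) = daddv_pi (U^C)%VS U v.
Proof.
rewrite linfunE ?vsprojK ?memv_pi // => c u w.
by rewrite !linearP.
Qed.

Lemma qproj_repr (w : quotv) : qproj (vsval w) = w.
Proof. by apply: val_inj; rewrite /= qprojE daddv_pi_id // subvsP. Qed.

Lemma qproj_eq0 v : (qproj v == 0) = (v \in U).
Proof.
have tot : daddv_pi (U^C)%VS U v + daddv_pi U (U^C)%VS v = v.
  by apply: daddv_pi_add; rewrite ?capCU // addvC addv_complf memvf.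
apply/eqP/idP => [q0 | Uv].
  by rewrite -tot -qprojE q0 linear0 add0r memv_pi.
apply: val_inj; rewrite /= qprojE; apply: (addIr v).
by rewrite -{2}(daddv_pi_id (capv_compl U) Uv) tot add0r.
Qed.

Lemma qproj_eq v w : (qproj v == qproj w) = (v - w \in U).
Proof. by rewrite -subr_eq0 -linearB qproj_eq0. Qed.

Lemma repr_qproj v : vsval (qproj v) - v \in U.
Proof. by rewrite -qproj_eq qproj_repr. Qed.
End Quotient.

Section QuotientModule.
Variables (k : fieldType) (B : falgType k) (M : fdmod B).
Variables (U : {vspace M}) (stU : stable U).

Let qact (b : B) (v : quotv U) : quotv U := qproj U (act b (vsval v)).
Fact qact_proj b v : qact b (qproj U v) = qproj U (act b v).
Proof.
by apply/eqP; rewrite /qact qproj_eq -linearB; apply/stU/repr_qproj.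
Qed.
Fact quot_linearl v : linear (qact^~ v).
Proof. by move=> c a b; rewrite /qact actDl actZl linearP. Qed.
Fact quot_linearr b : linear (qact b).
Proof. by move=> c u v; rewrite /qact !linearP. Qed.
Fact quot_act1 v : qact 1 v = v.
Proof. by rewrite /qact act1 qproj_repr. Qed.
Fact quot_actM a b v : qact (a * b) v = qact a (qact b v).
Proof. by rewrite {3}/qact qact_proj -actM. Qed.

Definition quotmod : fdmod B :=
  FdMod quot_linearl quot_linearr quot_act1 quot_actM.
End QuotientModule.

Section Dual.
Variables (k : fieldType) (B : falgType k) (N : fdmod B^c).

Let dact (b : B) (f : 'Hom(N, k^o)) : 'Hom(N, k^o) := (f \o actf N b)%VF.
Fact dualE b f v : dact b f v = f (act (b : B^c) v).
Proof. by rewrite comp_lfunE actfE. Qed.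
Fact dual_linearl f : linear (dact^~ f).
Proof.
move=> c a b; apply/lfunP => v.
by rewrite add_lfunE scale_lfunE !dualE (actDl (c *: a : B^c)) actZl linearP.
Qed.
Fact dual_linearr b : linear (dact b).
Proof.
move=> c f g; apply/lfunP=> v.
by rewrite add_lfunE scale_lfunE !dualE add_lfunE scale_lfunE.
Qed.
Fact dual_act1 f : dact 1 f = f.
Proof. by apply/lfunP=> v; rewrite dualE act1. Qed.
Fact dual_actM a b f : dact (a * b) f = dact a (dact b f).
Proof.
apply/lfunP=> v; rewrite !dualE.
by rewrite -[_ * _]/((b : B^c) * (a : B^c)) actM.
Qed.

Definition dualmod : fdmod B :=
  FdMod dual_linearl dual_linearr dual_act1 dual_actM.
End Dual.

Section HomSpace.
Variables (k : fieldType) (B : falgType k) (M N : fdmod B).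

Let defect (b : B) (f : 'Hom(M, N)) : 'Hom(M, N) :=
  (f \o actf M b)%VF - (actf N b \o f)%VF.

Let defectE b f v : defect b f v = f (act b v) - act b (f v).
Proof. by rewrite add_lfunE opp_lfunE !comp_lfunE !actfE. Qed.

Let defect_linear b : linear (defect b).
Proof.
move=> c f g; apply/lfunP=> v.
rewrite defectE [RHS]add_lfunE scale_lfunE !defectE !add_lfunE !scale_lfunE linearP.
by rewrite scalerBr opprD !addrA (addrAC (c *: _)).
Qed.

(* Hom_B(M, N) as a subspace of Hom_k(M, N); it suffices to test commutation
   with a basis of B. *)
Definition homv : {vspace 'Hom(M, N)} :=
  (\bigcap_(i < \dim {:B}) lker (linfun (defect (vbasis {:B})`_i)))%VS.

Lemma mem_homv f : f \in homv <-> is_hom f.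
Proof.
have inE i : (f \in lker (linfun (defect (vbasis {:B})`_i))) =
             (defect (vbasis {:B})`_i f == 0).
  by rewrite memv_ker linfunE.
split=> [homf b v | homf]; last first.
  rewrite memvE; apply/subv_bigcapP=> i _; rewrite -memvE inE.
  by apply/eqP/lfunP=> v; rewrite defectE homf subrr zero_lfunE.
rewrite [b](coord_vbasis (memvf b)) !act_suml linear_sum.
apply: eq_bigr => i _; rewrite linearZ; congr (_ *: _).
move: homf; rewrite memvE => /subv_bigcapP/(_ i isT); rewrite -memvE inE.
by move=> /eqP/lfunP/(_ v); rewrite defectE zero_lfunE => /subr0_eq.
Qed.
End HomSpace.

Section Star.
Variables (k : fieldType) (B : falgType k).

Fact reg_linearl (v : B) : linear ( *%R^~ v).
Proof. by move=> c a b; rewrite mulrDl scalerAl. Qed.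
Fact reg_linearr (b : B) : linear ( *%R b).
Proof. by move=> c u v; rewrite mulrDr scalerAr. Qed.
Fact reg_actM (a b v : B) : a * b * v = a * (b * v).
Proof. by rewrite mulrA. Qed.
Definition regmod : fdmod B := FdMod reg_linearl reg_linearr (@mul1r B) reg_actM.

Section StarObj.
Variable P : fdmod B.

Definition starcar : vectType k := subvs_of (homv P regmod).

(* (g . b)(x) = g(x) b *)
Let sact (b : B^c) (g : starcar) : starcar :=
  vsproj (homv P regmod) (amulr (b : B) \o vsval g)%VF.
Fact starE b g x : vsval (sact b g) x = vsval g x * (b : B).
Proof.
rewrite vsprojK ?comp_lfunE ?lfunE //.
apply/mem_homv => a v; rewrite !comp_lfunE.
have /mem_homv -> := subvsP g; rewrite !lfunE /=.
by rewrite mulrA.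
Qed.

Let eqstar (g h : starcar) : (forall x, vsval g x = vsval h x) -> g = h.
Proof. by move=> e; apply/val_inj/lfunP. Qed.

Fact star_linearl g : linear (sact^~ g).
Proof.
move=> c a b; apply: eqstar => x.
by rewrite linearP add_lfunE scale_lfunE !starE mulrDr scalerAr.
Qed.
Fact star_linearr b : linear (sact b).
Proof.
move=> c g h; apply: eqstar => x.
rewrite linearP add_lfunE scale_lfunE !starE linearP add_lfunE scale_lfunE.
by rewrite mulrDl scalerAl.
Qed.
Fact star_act1 g : sact 1 g = g.
Proof. by apply: eqstar => x; rewrite starE mulr1. Qed.
Fact star_actM a b g : sact (a * b) g = sact a (sact b g).
Proof. by apply: eqstar => x; rewrite !starE mulrA. Qed.

Definition star : fdmod B^c :=
  FdMod star_linearl star_linearr star_act1 star_actM.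
End StarObj.

Definition starf (M N : fdmod B) (d : 'Hom(M, N)) : 'Hom(star N, star M) :=
  linfun (fun g : star N => vsproj (homv M regmod) (vsval g \o d)%VF : star M).

Lemma starfE (M N : fdmod B) (d : 'Hom(M, N)) : is_hom d ->
  forall (g : star N) x, vsval (starf d g) x = vsval g (d x).
Proof.
move=> hd g x; rewrite linfunE => [|c u v]; last first.
  rewrite -linearP; congr (vsproj _ _); apply/lfunP=> y.
  by rewrite add_lfunE scale_lfunE !comp_lfunE linearP add_lfunE scale_lfunE.
rewrite vsprojK ?comp_lfunE //; apply/mem_homv => b v.
by rewrite !comp_lfunE hd; have /mem_homv -> := subvsP g.
Qed.

Lemma starf_hom (M N : fdmod B) (d : 'Hom(M, N)) : is_hom d -> is_hom (starf d).
Proof.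
by move=> hd b g; apply/val_inj/lfunP=> x; rewrite starfE // !starE starfE.
Qed.

End Star.

Lemma stable_limg (k : fieldType) (B : falgType k) (M N : fdmod B)
  (f : 'Hom(M, N)) : is_hom f -> stable (limg f).
Proof.
by move=> hf b _ /memv_imgP[v _ ->]; rewrite -hf memv_img ?memvf.
Qed.

Definition coker (k : fieldType) (B : falgType k) (M N : fdmod B)
  (f : 'Hom(M, N)) (hf : is_hom f) : fdmod B := quotmod (stable_limg hf).

Section Tau.
Variables (k : fieldType) (B : falgType k).

Definition projective (P : fdmod B) :=
  forall (M N : fdmod B) (g : 'Hom(M, N)) (f : 'Hom(P, N)),
    is_hom g -> is_hom f -> limg g = fullv ->
    exists2 h : 'Hom(P, M), is_hom h & (g \o h)%VF = f.

Definition superfluous (M : fdmod B) (K : {vspace M}) :=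
  forall U : {vspace M}, stable U -> (U + K)%VS = fullv -> U = fullv.

(* P1 --d1--> P0 --d0--> M --> 0 exact, where d0 and the map P1 --> ker d0
   induced by d1 are projective covers. *)
Record min_proj_pres (M : fdmod B) := MinProjPres {
  pres_P1 : fdmod B;
  pres_P0 : fdmod B;
  pres_d1 : 'Hom(pres_P1, pres_P0);
  pres_d0 : 'Hom(pres_P0, M);
  pres_d1_hom : is_hom pres_d1;
  pres_d0_hom : is_hom pres_d0;
  pres_P1_projective : projective pres_P1;
  pres_P0_projective : projective pres_P0;
  pres_d0_surj : limg pres_d0 = fullv;
  pres_d1_exact : limg pres_d1 = lker pres_d0;
  pres_d0_superfluous : superfluous (lker pres_d0);
  pres_d1_superfluous : superfluous (lker pres_d1) }.

Definition Tr M (p : min_proj_pres M) : fdmod B^c :=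
  coker (starf_hom (@pres_d1_hom M p)).

Definition tau M (p : min_proj_pres M) : fdmod B := dualmod (Tr p).

(* A minimal projective presentation exists and is unique up to isomorphism, so
   one may equivalently quantify over all of them. *)
Definition tau_rigid (M : fdmod B) :=
  exists p : min_proj_pres M,
    forall f : 'Hom(M, tau p), is_hom f -> f = 0.

Definition indecomposable (M : fdmod B) :=
  \dim {:M} <> 0%N /\
  forall U V : fdmod B, mod_iso M (dsum U V) ->
    \dim {:U} = 0%N \/ \dim {:V} = 0%N.

Definition basic_rank_two (M : fdmod B) :=
  exists U V : fdmod B,
    [/\ indecomposable U, indecomposable V, ~ mod_iso U V
      & mod_iso M (dsum U V)].

(* The count q is rational so that closed formulas need neither truncated
   subtraction nor Euclidean division. *)
Definition num_iso_classes (C : fdmod B -> Prop) (q : rat) :=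
  exists N : nat, N%:R = q /\
  exists F : 'I_N -> fdmod B,
    [/\ forall i, C (F i),
        forall i j, mod_iso (F i) (F j) -> i = j
      & forall M, C M -> exists i, mod_iso M (F i)].

End Tau.

Arguments pres_P1 {k B M} p : rename.
Arguments pres_P0 {k B M} p : rename.
Arguments pres_d1 {k B M} p : rename.
Arguments pres_d0 {k B M} p : rename.
Arguments pres_d1_hom {k B M} p : rename.
Arguments pres_d0_hom {k B M} p : rename.
Arguments pres_P1_projective {k B M} p : rename.
Arguments pres_P0_projective {k B M} p : rename.
Arguments pres_d0_surj {k B M} p : rename.
Arguments pres_d1_exact {k B M} p : rename.
Arguments pres_d0_superfluous {k B M} p : rename.
Arguments pres_d1_superfluous {k B M} p : rename.
Definition trivext (k : fieldType) (A : falgType k) : Type :=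
  (A * 'Hom(A, k^o))%type.

Section TrivExt.
Variables (k : fieldType) (A : falgType k).
Local Notation T := (trivext A).
Local Notation DA := 'Hom(A, k^o).
Implicit Types (a b c x : A) (f g h : DA).

HB.instance Definition _ := Vector.copy T (A * DA)%type.

(* The A-bimodule structure of DA: (af)(x) = f(xa) and (fa)(x) = f(ax). *)
Definition dlact a f : DA := (f \o amulr a)%VF.
Definition dract f a : DA := (f \o amull a)%VF.

Lemma dlactE a f x : dlact a f x = f (x * a).
Proof. by rewrite comp_lfunE lfunE. Qed.
Lemma dractE f a x : dract f a x = f (a * x).
Proof. by rewrite comp_lfunE lfunE. Qed.

Lemma dlactD a f g : dlact a (f + g) = dlact a f + dlact a g.
Proof. by apply/lfunP=> x; rewrite !(add_lfunE, dlactE). Qed.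
Lemma dractD a f g : dract (f + g) a = dract f a + dract g a.
Proof. by apply/lfunP=> x; rewrite !(add_lfunE, dractE). Qed.
Lemma dlactDl a b f : dlact (a + b) f = dlact a f + dlact b f.
Proof. by apply/lfunP=> x; rewrite !(add_lfunE, dlactE) mulrDr linearD. Qed.
Lemma dractDl a b f : dract f (a + b) = dract f a + dract f b.
Proof. by apply/lfunP=> x; rewrite !(add_lfunE, dractE) mulrDl linearD. Qed.
Lemma dlactM a b f : dlact (a * b) f = dlact a (dlact b f).
Proof. by apply/lfunP=> x; rewrite !dlactE mulrA. Qed.
Lemma dractM a b f : dract f (a * b) = dract (dract f a) b.
Proof. by apply/lfunP=> x; rewrite !dractE mulrA. Qed.
Lemma dlractA a b f : dlact a (dract f b) = dract (dlact a f) b.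
Proof. by apply/lfunP=> x; rewrite !(dlactE, dractE) mulrA. Qed.
Lemma dlact1 f : dlact 1 f = f.
Proof. by apply/lfunP=> x; rewrite dlactE mulr1. Qed.
Lemma dract1 f : dract f 1 = f.
Proof. by apply/lfunP=> x; rewrite dractE mul1r. Qed.
Lemma dlact0 a : dlact a 0 = 0.
Proof. by apply/lfunP=> x; rewrite !(dlactE, zero_lfunE). Qed.
Lemma dract0 a : dract 0 a = 0.
Proof. by apply/lfunP=> x; rewrite !(dractE, zero_lfunE). Qed.

Definition tmul (s t : T) : T := (s.1 * t.1, dlact s.1 t.2 + dract s.2 t.1).
Definition tone : T := (1, 0).

Fact tmulA : associative tmul.
Proof.
move=> [a f] [b g] [c h]; rewrite /tmul /= mulrA; congr pair.
by rewrite dlactD dractD dlactM dractM dlractA addrA.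
Qed.
Fact tmul1 : left_id tone tmul.
Proof. by move=> [a f]; rewrite /tmul /= mul1r dlact1 dract0 addr0. Qed.
Fact tmulr1 : right_id tone tmul.
Proof. by move=> [a f]; rewrite /tmul /= mulr1 dract1 dlact0 add0r. Qed.
Fact tmulDl : left_distributive tmul +%R.
Proof.
move=> [a f] [b g] [c h]; rewrite /tmul; congr pair; first exact: mulrDl.
by rewrite /= dlactDl dractD addrACA.
Qed.
Fact tmulDr : right_distributive tmul +%R.
Proof.
move=> [a f] [b g] [c h]; rewrite /tmul; congr pair; first exact: mulrDr.
by rewrite /= dlactD dractDl addrACA.
Qed.
Fact tone_neq0 : tone != 0.
Proof. by apply/eqP => -[/eqP]; rewrite oner_eq0. Qed.

HB.instance Definition _ := GRing.Zmodule_isNzRing.Build T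
  tmulA tmul1 tmulr1 tmulDl tmulDr tone_neq0.

Fact tscaleAl (c : k) (s t : T) : c *: tmul s t = tmul (c *: s) t.
Proof.
congr pair; first by rewrite /= scalerAl.
apply/lfunP=> x; rewrite /= scale_lfunE !add_lfunE !(dlactE, dractE).
by rewrite scale_lfunE -scalerAr linearZ scalerDr.
Qed.
HB.instance Definition _ := GRing.Lmodule_isLalgebra.Build k T tscaleAl.

Fact tscaleAr (c : k) (s t : T) : c *: tmul s t = tmul s (c *: t).
Proof.
congr pair; first by rewrite /= scalerAr.
apply/lfunP=> x; rewrite /= scale_lfunE !add_lfunE !(dlactE, dractE).
by rewrite scale_lfunE -scalerAl linearZ scalerDr.
Qed.
HB.instance Definition _ := GRing.Lalgebra_isAlgebra.Build k T tscaleAr.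
HB.instance Definition _ := Algebra_isFalgebra.Build k T.

Lemma trivext_mulE (s t : T) :
  s * t = (s.1 * t.1, dlact s.1 t.2 + dract s.2 t.1).
Proof. by []. Qed.

End TrivExt.

Section Nu.
Variables (k : fieldType) (A : falgType k).
Local Notation DA := 'Hom(A, k^o).

Section NuObj.
Variable X : fdmod A.

(* DA (x)_k X is realized as Hom_k(A, X), the pure tensor f (x) x being the map
   a |-> f(a) x; its left A-module structure c(f (x) x) = (cf) (x) x becomes
   (c h)(a) = h(ac). *)
Let tact (c : A) (h : 'Hom(A, X)) : 'Hom(A, X) := (h \o amulr c)%VF.
Fact tactE c h a : tact c h a = h (a * c).
Proof. by rewrite comp_lfunE lfunE. Qed.
Fact tens_linearl h : linear (tact^~ h).
Proof.
move=> c a b; apply/lfunP => x.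
by rewrite [RHS]add_lfunE scale_lfunE !tactE mulrDr -scalerAr linearP.
Qed.
Fact tens_linearr c : linear (tact c).
Proof.
move=> a g h; apply/lfunP => x.
by rewrite [RHS]add_lfunE scale_lfunE !tactE add_lfunE scale_lfunE.
Qed.
Fact tens_act1 h : tact 1 h = h.
Proof. by apply/lfunP=> x; rewrite tactE mulr1. Qed.
Fact tens_actM a b h : tact (a * b) h = tact a (tact b h).
Proof. by apply/lfunP=> x; rewrite !tactE mulrA. Qed.
Definition tensmod : fdmod A :=
  FdMod tens_linearl tens_linearr tens_act1 tens_actM.

Definition tens (f : DA) (x : X) : tensmod := linfun (fun a => f a *: x).
Lemma tensE f x a : tens f x a = f a *: x.
Proof. by rewrite linfunE // => c u v; rewrite linearP scalerDl scalerA. Qed.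

(* On h = f (x) x this is fa (x) x - f (x) ax, see [tensrel_tens]. *)
Definition tensrel (a : A) (h : tensmod) : tensmod :=
  (h \o amull a)%VF - (actf X a \o h)%VF.

Lemma tensrelE a h x : tensrel a h x = h (a * x) - act a (h x).
Proof. by rewrite add_lfunE opp_lfunE !comp_lfunE actfE lfunE. Qed.

Lemma tensrel_tens a f x :
  tensrel a (tens f x) = tens (dract f a) x - tens f (act a x).
Proof.
apply/lfunP=> y; rewrite tensrelE add_lfunE opp_lfunE !tensE dractE.
by rewrite linearZ.
Qed.

Fact tensrel_linear a : linear (tensrel a).
Proof.
move=> c f g; apply/lfunP=> v.
rewrite tensrelE [RHS]add_lfunE scale_lfunE !tensrelE !add_lfunE !scale_lfunE.
by rewrite linearP scalerBr opprD !addrA (addrAC (c *: _)).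
Qed.

Definition nurel : {vspace tensmod} :=
  (\sum_(i < \dim {:A}) limg (linfun (tensrel (vbasis {:A})`_i)))%VS.

Lemma mem_nurel a h : tensrel a h \in nurel.
Proof.
have ->: tensrel a h =
    \sum_(i < \dim {:A}) coord (vbasis {:A}) i a *: tensrel (vbasis {:A})`_i h.
  apply/lfunP=> x; rewrite tensrelE sum_lfunE.
  rewrite {1 2}[a](coord_vbasis (memvf a)) act_suml mulr_suml linear_sum -sumrB.
  by apply: eq_bigr => i _; rewrite scale_lfunE tensrelE -scalerAl linearZ scalerBr.
apply: memv_suml => i _; apply: memvZ; apply: (subvP (sumv_sup i _ _)) => //.
by rewrite -(linfunE (tensrel_linear _)) memv_img ?memvf.
Qed.

Lemma nurel_ind (W : vectType k) (g : 'Hom(tensmod, W)) (U : {vspace W}) :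
  (forall a h, g (tensrel a h) \in U) -> forall t, t \in nurel -> g t \in U.
Proof.
move=> gU t; suff /subvP le: (nurel <= g @^-1: U)%VS by move/le; rewrite memv_preim.
apply/subv_sumP => i _; apply/subvP => _ /memv_imgP[h _ ->].
by rewrite -memv_preim (linfunE (tensrel_linear _)); apply: gU.
Qed.

Lemma nurel_stable : stable nurel.
Proof.
move=> c t; rewrite -actfE; apply: nurel_ind => a h; rewrite actfE.
suff ->: act c (tensrel a h) = tensrel a (act c h) by exact: mem_nurel.
by apply/lfunP=> x; rewrite tactE !tensrelE !tactE mulrA.
Qed.

Definition nu : fdmod A := quotmod nurel_stable.
Definition nuten (f : DA) (x : X) : nu := qproj nurel (tens f x).

Lemma act_qproj c h : act c (qproj nurel h : nu) = qproj nurel (act c h).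
Proof. exact: (qact_proj nurel_stable). Qed.

Lemma nuten_balanced f a x : nuten (dract f a) x = nuten f (act a x).
Proof. by apply/eqP; rewrite qproj_eq -tensrel_tens mem_nurel. Qed.

Lemma act_nuten c f x : act c (nuten f x) = nuten (dlact c f) x.
Proof.
rewrite act_qproj; congr (qproj _ _); apply/lfunP=> y.
by rewrite tactE !tensE dlactE.
Qed.

Lemma nuten_linearl x : linear (nuten^~ x).
Proof.
move=> c f g; rewrite -linearP; congr (qproj _ _); apply/lfunP=> y.
by rewrite add_lfunE scale_lfunE !tensE add_lfunE scale_lfunE scalerDl scalerA.
Qed.

Lemma nuten_linearr f : linear (nuten f).
Proof.
move=> c x y; rewrite -linearP; congr (qproj _ _); apply/lfunP=> z.
by rewrite add_lfunE scale_lfunE !tensE scalerDr !scalerA mulrC.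
Qed.

Let coordf i : DA := linfun (coord (vbasis {:A}) i : A -> k^o).

Lemma tens_decomp (h : tensmod) : h = \sum_(i < \dim {:A}) tens (coordf i) (h (vbasis {:A})`_i).
Proof.
apply: (iffLR (lfunP _ _)) => x.
rewrite {1}[x](coord_vbasis (memvf x)) linear_sum [RHS]sum_lfunE.
by apply: eq_bigr => i _; rewrite linearZ tensE lfunE.
Qed.

(* The universal property of the tensor product over A. *)
Lemma nu_ext (W : vectType k) (g g' : 'Hom(nu, W)) :
  (forall f x, g (nuten f x) = g' (nuten f x)) -> g = g'.
Proof.
move=> eqg; apply/lfunP=> w; rewrite -(qproj_repr w) (tens_decomp (vsval w)).
by rewrite !linear_sum; apply: eq_bigr => i _; apply: eqg.
Qed.

Lemma nu_univ (W : vectType k) (phi : DA -> X -> W) :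
    (forall x, linear (phi^~ x)) -> (forall f, linear (phi f)) ->
    (forall f a x, phi (dract f a) x = phi f (act a x)) ->
  exists g : 'Hom(nu, W), forall f x, g (nuten f x) = phi f x.
Proof.
move=> lphi rphi bal.
pose e i : A := (vbasis {:A})`_i.
pose G (h : tensmod) : W := \sum_(i < \dim {:A}) phi (coordf i) (h (e i)).
have linG : linear G.
  move=> c g h; rewrite scaler_sumr -big_split /=; apply: eq_bigr => i _.
  by rewrite add_lfunE scale_lfunE rphi.
have GE f x : G (tens f x) = phi f x.
  have {2}-> : f = \sum_(i < \dim {:A}) f (e i) *: coordf i.
    apply/lfunP=> y; rewrite {1}[y](coord_vbasis (memvf y)) linear_sum sum_lfunE.
    by apply: eq_bigr => i _; rewrite linearZ scale_lfunE lfunE; apply: mulrC.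
  have Lx f' : phi f' x = linfun (phi^~ x) f' by rewrite linfunE.
  rewrite Lx linear_sum; apply: eq_bigr => i _; rewrite linearZ /= -Lx tensE.
  have Rx y : phi (coordf i) y = linfun (phi (coordf i)) y by rewrite linfunE.
  by rewrite Rx linearZ /= -Rx.
pose Gl := linfun G : 'Hom(tensmod, W).
have GlE t : Gl t = G t by rewrite linfunE.
have G0 t : t \in nurel -> G t = 0.
  rewrite -GlE => /(nurel_ind (g := Gl) (U := 0%VS)) G0.
  apply/eqP; rewrite -memv0; apply: G0 => a h.
  have Ra y : tensrel a y = linfun (tensrel a) y.
    by rewrite (linfunE (tensrel_linear a)).
  rewrite (tens_decomp h) Ra !linear_sum /=; apply: memv_suml => i _.
  by rewrite -Ra tensrel_tens linearB /= !GlE !GE bal subrr mem0v.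
exists (linfun (fun w : nu => G (vsval w))) => f x; rewrite linfunE; last first.
  by move=> c u v; rewrite linearP linG.
apply/eqP; rewrite -GE -subr_eq0 -!GlE -linearB /= GlE.
by apply/eqP/G0/repr_qproj.
Qed.

End NuObj.

Definition nuf (X Y : fdmod A) (f : 'Hom(X, Y)) : 'Hom(nu X, nu Y) :=
  linfun (fun w : nu X => qproj (nurel Y) (f \o vsval w)%VF : nu Y).

Section NuMap.
Variables (X Y : fdmod A) (f : 'Hom(X, Y)).
Hypothesis hf : is_hom f.

Lemma nufE0 w : nuf f w = qproj (nurel Y) (f \o vsval w)%VF.
Proof.
rewrite linfunE // => c u v; rewrite -linearP; congr (qproj _ _); apply/lfunP=> x.
by rewrite !(add_lfunE, scale_lfunE, comp_lfunE) linearP.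
Qed.

Lemma nuf_qproj (h : tensmod X) :
  nuf f (qproj (nurel X) h) = qproj (nurel Y) (f \o h)%VF.
Proof.
rewrite nufE0; apply/eqP; rewrite qproj_eq.
have lF : linear (fun t : tensmod X => (f \o t)%VF : tensmod Y).
  move=> c u v; apply/lfunP=> x.
  by rewrite !(add_lfunE, scale_lfunE, comp_lfunE) linearP.
pose F : 'Hom(tensmod X, tensmod Y) :=
  linfun (fun t : tensmod X => (f \o t)%VF : tensmod Y).
have FE t : F t = (f \o t)%VF by rewrite linfunE.
have := repr_qproj (nurel X) h; move/(nurel_ind (g := F) (U := nurel Y)).
rewrite linearB /= !FE; apply=> a t; rewrite FE.
suff ->: (f \o tensrel a t)%VF = tensrel a (f \o t : tensmod Y)%VF.
  exact: mem_nurel.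
by apply/lfunP=> x; rewrite comp_lfunE !tensrelE !comp_lfunE linearB /= hf.
Qed.

Lemma nuf_nuten g x : nuf f (nuten g x) = nuten g (f x).
Proof.
rewrite nuf_qproj; congr (qproj _ _); apply/lfunP=> y.
by rewrite comp_lfunE !tensE linearZ.
Qed.

Lemma nuf_hom : is_hom (nuf f).
Proof.
move=> b w; rewrite -(qproj_repr w) act_qproj !nuf_qproj act_qproj.
by congr (qproj _ _); apply/lfunP=> y; rewrite /= !comp_lfunE.
Qed.
End NuMap.

End Nu.

Section Pairs.
Variables (k : fieldType) (A : falgType k).

(* The T(A)-module of a pair (X, alpha). *)
Section PairMod.
Variables (X : fdmod A) (alpha : 'Hom(nu X, X)).
Hypotheses (alpha_hom : is_hom alpha) (alpha_sq : (alpha \o nuf alpha = 0)%VF).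

Let pact (t : trivext A) (x : X) : X := act t.1 x + alpha (nuten t.2 x).

Fact pair_linearl x : linear (pact^~ x).
Proof.
move=> c s t; rewrite /pact /= nuten_linearl linearP actDl actZl.
by rewrite scalerDr addrACA.
Qed.
Fact pair_linearr t : linear (pact t).
Proof.
move=> c x y; rewrite /pact nuten_linearr !linearP.
by rewrite scalerDr addrACA.
Qed.
Fact pair_act1 x : pact 1 x = x.
Proof.
rewrite /pact /= act1 -[nuten _ _](linfunE (nuten_linearl x)).
by rewrite !linear0 addr0.
Qed.
Fact pair_actM s t x : pact (s * t) x = pact s (pact t x).
Proof.
rewrite /pact trivext_mulE /= actM.
have nutenDl f g y : nuten (f + g) y = nuten f y + nuten g y :> nu X.
  by have := nuten_linearl y 1 f g; rewrite !scale1r.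
have nutenDr f y z : nuten f (y + z) = nuten f y + nuten f z :> nu X.
  by have := nuten_linearr f 1 y z; rewrite !scale1r.
have sq f y : alpha (nuten f (alpha y)) = 0.
  by rewrite -(nuf_nuten alpha_hom) -comp_lfunE alpha_sq zero_lfunE.
rewrite nutenDl nutenDr !linearD /= sq addr0 nuten_balanced -act_nuten.
by rewrite alpha_hom addrA.
Qed.

Definition pairmod : fdmod (trivext A) :=
  FdMod pair_linearl pair_linearr pair_act1 pair_actM.
End PairMod.

Section ZMod.
Variable X : fdmod A.
Fact zero_is_hom (Y : fdmod A) : is_hom (0 : 'Hom(Y, X)).
Proof. by move=> b v; rewrite !zero_lfunE linear0. Qed.
Fact zero_sq : ((0 : 'Hom(nu X, X)) \o nuf (0 : 'Hom(nu X, X)) = 0)%VF.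
Proof. exact: comp_lfun0l. Qed.
Definition Zmod : fdmod (trivext A) := pairmod (@zero_is_hom (nu X)) zero_sq.
End ZMod.

(* The pair (X (+) Y, (0 0; beta 0)) for beta : nu(X) -> Y. *)
Section LowerTriangular.
Variables (X Y : fdmod A) (beta : 'Hom(nu X, Y)).
Hypothesis hbeta : is_hom beta.

Definition low_map : 'Hom(nu (dsum X Y), dsum X Y) :=
  (dinr X Y \o beta \o nuf (dfst X Y))%VF.

Lemma low_hom : is_hom low_map.
Proof.
move=> b v; rewrite !comp_lfunE.
by rewrite (nuf_hom (@dfst_hom _ _ _ _)) hbeta dinr_hom.
Qed.

Lemma low_sq : (low_map \o nuf low_map = 0)%VF.
Proof.
apply: nu_ext => f x; rewrite comp_lfunE (nuf_nuten low_hom) zero_lfunE.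
rewrite !comp_lfunE (nuf_nuten (@dfst_hom _ _ _ _)) dfstE [in dinr X Y (beta (nuf _ _))]dinrE /=.
by rewrite -[nuten f 0](linfunE (nuten_linearr f)) !linear0.
Qed.

Definition lowmod : fdmod (trivext A) := pairmod low_hom low_sq.
End LowerTriangular.

Fact id_is_hom (X : fdmod A) : is_hom (\1%VF : 'End(X)).
Proof. by move=> b v; rewrite !id_lfunE. Qed.

Definition Lmod (X : fdmod A) : fdmod (trivext A) := lowmod (@id_is_hom (nu X)).
End Pairs.

(* Vertex i + 1 of the quiver is i : 'I_n.  For i <= j there is exactly one path
   from i to j, here (i, j). *)
Definition linpath n := {p : 'I_n * 'I_n | (p.1 <= p.2)%N}.

Section Paths.
Variable n : nat.
Implicit Types p q r : linpath n.

Definition psrc p : 'I_n := (val p).1.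
Definition ptgt p : 'I_n := (val p).2.

(* pcat q p is the path "p, then q": left modules are then covariant
   representations of the quiver. *)
Definition pcat q p : option (linpath n) :=
  if ptgt p == psrc q then (insub (psrc p, ptgt q) : option (linpath n)) else None.

Lemma pcatE q p r :
  (pcat q p == Some r) =
  [&& ptgt p == psrc q, psrc p == psrc r & ptgt q == ptgt r].
Proof.
rewrite /pcat; case: (ptgt p =P psrc q) => //= pq.
have le: (psrc p <= ptgt q)%N.
  by apply: leq_trans (valP p) _; rewrite -/(ptgt p) pq; apply: (valP q).
case: insubP => [s _ sE | /negP[]] //=.
by rewrite (inj_eq (@Some_inj _)) -val_eqE sE (surjective_pairing (val r)) xpair_eqE.
Qed.
End Paths.

(* n = m + 1 *)
Definition pathalg (k : fieldType) (m : nat) : Type := {ffun linpath m.+1 -> k^o}.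

Section PathAlgebra.
Variables (k : fieldType) (m : nat).
Local Notation PA := (pathalg k m).
Local Notation vtx := 'I_m.+1.
Implicit Types x y z : PA.

HB.instance Definition _ := Vector.copy PA {ffun linpath m.+1 -> k^o}.

Definition pmul x y : PA :=
  [ffun r => \sum_q \sum_(p | pcat q p == Some r) x q * y p].
Definition pone : PA := [ffun r => (psrc r == ptgt r)%:R].

(* The coefficient of the path from i to j, 0 if there is none. *)
Definition coef x (i j : vtx) : k := oapp x 0 (insub (i, j)).

Lemma coefE x i j : coef x i j = \sum_(p | (psrc p == i) && (ptgt p == j)) x p.
Proof.
rewrite /coef; case: insubP => [p _ pij | ij] /=.
  rewrite (big_pred1 p) // => q.
  by rewrite -[RHS]val_eqE pij /psrc /ptgt; case: (val q).
rewrite big1 // => p /andP[/eqP pi /eqP pj]; case/negP: ij.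
by rewrite /= -pi -pj (valP p).
Qed.

Lemma coef_val x p : coef x (psrc p) (ptgt p) = x p.
Proof. by rewrite /coef -surjective_pairing valK. Qed.

Lemma coef_out x (i j : vtx) : (j < i)%N -> coef x i j = 0.
Proof. by move=> ji; rewrite /coef insubN //= -ltnNge. Qed.

Lemma coefP x y : (forall i j, coef x i j = coef y i j) -> x = y.
Proof. by move=> e; apply/ffunP=> p; rewrite -!coef_val. Qed.

Lemma coefD x y i j : coef (x + y) i j = coef x i j + coef y i j.
Proof. by rewrite !coefE -big_split; apply: eq_bigr => p _; rewrite ffunE. Qed.

Lemma coefZ c x i j : coef (c *: x) i j = c * coef x i j.
Proof. by rewrite !coefE big_distrr; apply: eq_bigr => p _; rewrite ffunE. Qed.

Lemma coef1 i j : coef pone i j = (i == j)%:R.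
Proof.
rewrite /coef; case: insubP => [p _ pij | ] /=.
  by rewrite ffunE /psrc /ptgt pij.
by case: eqP => // ->; rewrite leqnn.
Qed.

Lemma coefM x y i j : coef (pmul x y) i j = \sum_l coef x l j * coef y i l.
Proof.
have [ji | ij] := ltnP j i.
  rewrite coef_out // big1 // => l _.
  have [lj | jl] := leqP l j; last by rewrite coef_out ?mul0r.
  by rewrite [coef y i l]coef_out ?mulr0 // (leq_ltn_trans lj).
have [r -> ->] : exists2 r, i = psrc r & j = ptgt r.
  by exists (Sub (i, j) ij); rewrite /psrc /ptgt SubK.
rewrite coef_val ffunE.
under [RHS]eq_bigr do rewrite !coefE big_distrlr /=.
rewrite (eq_bigr (fun q => \sum_(p | [&& ptgt p == psrc q, psrc p == psrc r
  & ptgt q == ptgt r]) x q * y p)); last first.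
  by move=> q _; apply: eq_bigl => p; rewrite pcatE.
rewrite [RHS](exchange_big_dep (fun q => ptgt q == ptgt r)) /=; last first.
  by move=> l q _ /andP[].
rewrite [LHS](bigID (fun q => ptgt q == ptgt r)) /= [X in _ + X]big1 ?addr0.
  apply: eq_bigr => q ->; rewrite (big_pred1 (psrc q)).
    by apply: eq_bigl => p; rewrite andbT andbC.
  by move=> l; rewrite /= andbT eq_sym.
by move=> q /negPf ->; rewrite big_pred0 // => p; rewrite !andbF.
Qed.

Fact pmulA : associative pmul.
Proof.
move=> x y z; apply: coefP => i j; rewrite !coefM.
under eq_bigr do rewrite coefM big_distrr /=.
rewrite exchange_big /=; under [RHS]eq_bigr do rewrite coefM big_distrl /=.
by do 2!apply: eq_bigr => ? _; rewrite mulrA.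
Qed.
Fact pmul1 : left_id pone pmul.
Proof.
move=> x; apply: coefP => i j; rewrite coefM (bigD1 j) //= coef1 eqxx mul1r.
by rewrite big1 ?addr0 // => l /negPf nl; rewrite coef1 nl mul0r.
Qed.
Fact pmulr1 : right_id pone pmul.
Proof.
move=> x; apply: coefP => i j; rewrite coefM (bigD1 i) //= coef1 eqxx mulr1.
by rewrite big1 ?addr0 // => l nl; rewrite coef1 eq_sym (negPf nl) mulr0.
Qed.
Fact pmulDl : left_distributive pmul +%R.
Proof.
move=> x y z; apply: coefP => i j; rewrite coefD !coefM -big_split /=.
by apply: eq_bigr => l _; rewrite coefD mulrDl.
Qed.
Fact pmulDr : right_distributive pmul +%R.
Proof.
move=> x y z; apply: coefP => i j; rewrite coefD !coefM -big_split /=.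
by apply: eq_bigr => l _; rewrite coefD mulrDr.
Qed.
Fact pone_neq0 : pone != 0.
Proof.
apply/eqP => /(congr1 (fun x => coef x ord0 ord0)) /eqP.
by rewrite coef1 eqxx -(scale0r pone) coefZ mul0r oner_eq0.
Qed.
HB.instance Definition _ := GRing.Zmodule_isNzRing.Build PA
  pmulA pmul1 pmulr1 pmulDl pmulDr pone_neq0.

Fact pscaleAl (c : k) x y : c *: pmul x y = pmul (c *: x) y.
Proof.
apply: coefP => i j; rewrite coefZ !coefM big_distrr /=.
by apply: eq_bigr => l _; rewrite coefZ mulrA.
Qed.
HB.instance Definition _ := GRing.Lmodule_isLalgebra.Build k PA pscaleAl.
Fact pscaleAr (c : k) x y : c *: pmul x y = pmul x (c *: y).
Proof.
apply: coefP => i j; rewrite coefZ !coefM big_distrr /=.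
by apply: eq_bigr => l _; rewrite coefZ mulrCA.
Qed.
HB.instance Definition _ := GRing.Lalgebra_isAlgebra.Build k PA pscaleAr.
HB.instance Definition _ := Algebra_isFalgebra.Build k PA.

(* a and b are vertices numbered from 1. *)
Definition invertex (a b : nat) := {i : vtx | (a <= i.+1 <= b)%N}.

Section Interval.
Variables a b : nat.
Let IC : vectType k := {ffun invertex a b -> k^o}.

Let iact (x : PA) (v : IC) : IC :=
  [ffun j => \sum_i coef x (val i) (val j) * v i].

Fact int_linearl v : linear (iact^~ v).
Proof.
move=> c x y; apply/ffunP=> j; rewrite !ffunE scaler_sumr -big_split /=.
by apply: eq_bigr => i _; rewrite coefD coefZ mulrDl -mulrA.
Qed.
Fact int_linearr x : linear (iact x).
Proof.
move=> c u v; apply/ffunP=> j; rewrite !ffunE scaler_sumr -big_split /=.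
by apply: eq_bigr => i _; rewrite !ffunE mulrDr -[c *: u i]/(_ * _) mulrCA.
Qed.
Fact int_act1 v : iact 1 v = v.
Proof.
apply/ffunP=> j; rewrite ffunE (bigD1 j) //= coef1 eqxx mul1r.
rewrite big1 ?addr0 // => i nij; rewrite coef1.
by rewrite val_eqE (negPf nij) mul0r.
Qed.
Fact int_actM x y v : iact (x * y) v = iact x (iact y v).
Proof.
apply/ffunP=> j; rewrite !ffunE.
under [RHS]eq_bigr do rewrite ffunE big_distrr /=.
rewrite exchange_big /=; apply: eq_bigr => i _.
rewrite coefM big_distrl /= (bigID (fun l : vtx => a <= l.+1 <= b)%N) /=.
rewrite [X in _ + X]big1 ?addr0.
  rewrite (big_sub [pred l : vtx | a <= l.+1 <= b]%N).
  by apply: eq_bigr => l _; rewrite mulrA.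
move=> l nl; have [il | li] := leqP (val i) l; last first.
  by rewrite [coef y _ _]coef_out ?mulr0 ?mul0r.
have [lj | jl] := leqP l (val j); last by rewrite coef_out ?mul0r.
case/negP: nl; have /andP[ai _] := valP i; have /andP[_ jb] := valP j.
by rewrite (leq_trans ai) ?(leq_trans _ jb).
Qed.

Definition intmod : fdmod PA :=
  FdMod int_linearl int_linearr int_act1 int_actM.
End Interval.
End PathAlgebra.

Section Families.
Variables (k : fieldType) (m : nat).
Let n := m.+1.
Local Notation T := (trivext (pathalg k m)).

Definition projmod (a : nat) : fdmod (pathalg k m) := intmod k m a n.

(* For a <= r, the inclusion P_r -> P_a (extension by zero); only used for
   a < r, the value 0 otherwise is a dummy that keeps the map total. *)
Definition projincl (r a : nat) : 'Hom(projmod r, projmod a) :=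
  linfun (fun v : projmod r => [ffun i : invertex m a n =>
    if (a <= r)%N then oapp v 0 (insub (val i) : option (invertex m r n))
    else 0] : projmod a).

Lemma projinclE r a v i :
  projincl r a v i =
  if (a <= r)%N then oapp v 0 (insub (val i) : option (invertex m r n)) else 0.
Proof.
rewrite linfunE ?ffunE // => c x y; apply/ffunP=> j; rewrite !ffunE.
case: ifP => _; last by rewrite scaler0 addr0.
by case: insub => [l|] /=; rewrite ?ffunE ?scaler0 ?addr0.
Qed.

Lemma projincl_hom r a : is_hom (projincl r a).
Proof.
move=> x v; apply/ffunP=> j; rewrite projinclE [RHS]ffunE.
have [ar | ra] := leqP a r; last first.
  by rewrite big1 // => i _; rewrite projinclE leqNgt ra mulr0.
pose F (i : 'I_m.+1) : k :=
  coef x i (val j) * oapp v 0 (insub i : option (invertex m r n)).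
transitivity (\sum_(i : 'I_m.+1 | (a <= i.+1 <= n)%N) F i); last first.
  rewrite (big_sub [pred i : 'I_m.+1 | a <= i.+1 <= n]%N).
  by apply: eq_bigr => i _; rewrite projinclE ar.
rewrite (bigID (fun i : 'I_m.+1 => r <= i.+1 <= n)%N) /= [X in _ + X]big1 ?addr0.
  rewrite (eq_bigl (fun i => i \in [pred i : 'I_m.+1 | r <= i.+1 <= n]%N)).
  2: move=> i; rewrite inE /=; case: (boolP (r <= i.+1 <= n)%N); rewrite ?andbF //.
  2: by case/andP=> ri ->; rewrite (leq_trans ar ri).
  rewrite big_sub /F; case: insubP => [l _ lj | jr] /=.
    rewrite ffunE; apply: eq_bigr => i _.
    by rewrite lj valK.
  rewrite big1 // => i _; rewrite coef_out ?mul0r //.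
  move: jr; rewrite ltn_ord andbT -ltnNge => jr.
  by rewrite -ltnS (leq_trans jr) //; case/andP: (valP i).
by move=> i /andP[_ ri]; rewrite /F insubN ?mulr0.
Qed.

Definition modX (a b : nat) : fdmod T := Zmod (intmod k m a b).
Definition modR (r : nat) : fdmod T := Zmod (projmod r).
Definition modL (s : nat) : fdmod T := Lmod (projmod s).
Definition modO (a b : nat) : fdmod T :=
  lowmod (nuf_hom (@projincl_hom b.+1 a)).

Definition rangeX (a b : nat) := [&& 1 <= a, a <= b & b < n]%N.
Definition rangeR (r : nat) := (2 <= r <= n)%N.
Definition rangeL (s : nat) := (1 <= s <= n)%N.
Definition rangeO (a b : nat) := [&& 1 <= a, a < b & b < n]%N.

(* [a, b] precedes [c, d] *)
Definition before (a b c d : nat) := (a < c)%N || (a == c) && (d < b)%N.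

(* [c, d] is properly contained in [a, b] *)
Definition psubint (c d a b : nat) :=
  [&& a <= c, d <= b & (c, d) != (a, b)]%N.

Implicit Type M : fdmod T.

Definition type1 M := exists a b c d : nat,
  [/\ rangeX a b, rangeX c d, before a b c d
    & mod_iso M (dsum (modX a b) (modX c d))].
Definition type2 M := exists a b r : nat,
  [/\ rangeX a b, rangeR r & mod_iso M (dsum (modX a b) (modR r))].
Definition type3 M := exists a b s : nat,
  [/\ rangeX a b, rangeL s & mod_iso M (dsum (modX a b) (modL s))].
Definition type4 M := exists a b c d : nat,
  [/\ rangeX a b, rangeO c d & mod_iso M (dsum (modX a b) (modO c d))].
Definition type5 M := exists r s : nat,
  [/\ rangeR r, rangeR s & mod_iso M (dsum (modR r) (modR s))].
Definition type6 M := exists r s : nat,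
  [/\ rangeR r, rangeL s & mod_iso M (dsum (modR r) (modL s))].
Definition type7 M := exists r c d : nat,
  [/\ rangeR r, rangeO c d & mod_iso M (dsum (modR r) (modO c d))].
Definition type8 M := exists r s : nat,
  [/\ rangeL r, rangeL s & mod_iso M (dsum (modL r) (modL s))].
Definition type9 M := exists s c d : nat,
  [/\ rangeL s, rangeO c d & mod_iso M (dsum (modL s) (modO c d))].
Definition type10 M := exists a b c d : nat,
  [/\ rangeO a b, rangeO c d, before a b c d
    & mod_iso M (dsum (modO a b) (modO c d))].

End Families.

(* Main.v *)
(* T(kA_n) is the self-injective Nakayama algebra given by the cyclic quiver with n
   vertices and all paths of length n + 1 as relations: a module is a vector space
   graded by Z/n with an operator x of degree 1 such that x^(n+1) = 0.  By the graded
   Jordan normal form the indecomposables are uniserial, determined by the vertex i of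
   their top and their length l <= n + 1.  The minimal presentation of M(i, l) is
   P(i + l) -> P(i) for l <= n, while M(i, n + 1) is projective.

   Since Tr M (x) N is the cokernel of Hom(d1, N), one has Hom(N, tau M) = 0 if and only
   if Hom(d1, N) is onto.  For M = M(i, l) with l <= n this says that
   x^l : e_i N -> e_(i+l) N is onto, and for N = M(j, l') that no t < min(l, l')
   satisfies j + t = i + l mod n.  For l = l' and i = j this excludes exactly l = n, and
   the remaining (i, l) are those of the modules X, R, L and Omega.  All conditions and
   counts are then arithmetic. *)

Require Import Defs.
From HB Require Import structures.
From mathcomp Require Import all_boot all_order all_algebra all_field.
From mathcomp Require Import zify ring.

Set Implicit Arguments.
Unset Strict Implicit.
Unset Printing Implicit Defensive.

Import GRing.Theory.
Local Open Scope ring_scope.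

(** [tau_rigid] accepts any minimal presentation, so refuting it requires that presentations be
    unique ([extends_unique]); after that one explicit presentation per module decides. The quotient
    of the cyclic path algebra is never constructed. [cyclic_gens] keeps the relations between the
    idempotents e a and the sum x of the arrows, with an induction principle saying that they
    generate; the theory of uniserial modules is developed over such a system. That x^n e i is
    nonzero does not follow from these relations: it enters through the modules L(P_s), which are
    the indecomposable projectives. Krull-Schmidt is required only for two uniserial summands, where
    the ranks of x^t e h, additive in direct sums, recover the multiplicities. Tops and lengths (i,
    l) are (a, b - a + 1) for X, (r, n - r + 1) for R, (s, n + 1) for L and (b + 1, n - b + a) for
    Omega. Two modules R, or two modules L, are always compatible, even when equal. Therefore types
    5 and 8 carry the condition of being basic explicitly, while in the other types the summands are
    never isomorphic. *)

(** * Linear algebra *)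

Section VectorSpaces.
Variable k : fieldType.
Implicit Types U V W : vectType k.

Lemma functional_neq0 V (v : V) : v != 0 -> exists phi : 'Hom(V, k^o), phi v = 1.
Proof.
move=> nz; have [/forallP c0|] := boolP [forall i, coord (vbasis {:V}) i v == 0].
  case/eqP: nz; rewrite (coord_vbasis (memvf v)) big1 // => i _.
  by rewrite (eqP (c0 i)) scale0r.
rewrite negb_forall => /existsP[i nzi].
exists (linfun (fun u : V => (coord (vbasis {:V}) i v)^-1 * coord (vbasis {:V}) i u : k^o)).
rewrite linfunE ?mulVf // => c x y.
by rewrite linearP mulrDr; congr (_ + _); apply: mulrCA.
Qed.

Lemma bij_inj_dim U V (f : 'Hom(U, V)) :
  injective f -> (\dim {:V} <= \dim {:U})%N -> bijective f.
Proof.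
move=> inj le.
have k0 : lker f == 0%VS by apply/lker0P.
have full : limg f = fullv.
  by apply/eqP; rewrite eqEdim subvf /= limg_dim_eq ?(eqP k0) ?capv0.
by exists (f^-1)%VF => x; [exact: lker0_lfunK | rewrite limg_lfunVK ?full ?memvf].
Qed.

Lemma bij_surj_dim U V (f : 'Hom(U, V)) :
  limg f = fullv -> (\dim {:U} <= \dim {:V})%N -> bijective f.
Proof.
move=> full le; apply: bij_inj_dim; last by rewrite -full -(limg_ker_dim f fullv) leq_addl.
apply/lker0P; rewrite -dimv_eq0 -leqn0.
have := limg_ker_dim f fullv; rewrite capfv full => e.
by rewrite -(leq_add2r (\dim {:V})) add0n e.
Qed.

Lemma limg_fullP U V (f : 'Hom(U, V)) :
  (forall v, exists u, f u = v) <-> limg f = fullv.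
Proof.
split=> [s | full v].
  apply/eqP; rewrite eqEsubv subvf /=; apply/subvP=> v _.
  by have [u <-] := s v; rewrite memv_img ?memvf.
have : v \in limg f by rewrite full memvf.
by case/memv_imgP=> u _ ->; exists u.
Qed.

End VectorSpaces.

(** * Homomorphisms, direct sums and projective modules *)

Section Homs.
Variables (k : fieldType) (B : falgType k).
Implicit Types M N P : fdmod B.

Lemma hom_id M : is_hom (\1%VF : 'End(M)).
Proof. by move=> b v; rewrite !id_lfunE. Qed.

Lemma hom_comp M N P (g : 'Hom(N, P)) (f : 'Hom(M, N)) :
  is_hom g -> is_hom f -> is_hom (g \o f)%VF.
Proof. by move=> hg hf b v; rewrite !comp_lfunE hf hg. Qed.

Lemma hom_add M N (f g : 'Hom(M, N)) : is_hom f -> is_hom g -> is_hom (f + g).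
Proof. by move=> hf hg b v; rewrite !add_lfunE hf hg linearD. Qed.

Lemma hom_inv M N (f : 'Hom(M, N)) : is_hom f -> bijective f ->
  [/\ is_hom (f^-1)%VF, cancel f (f^-1)%VF & cancel (f^-1)%VF f].
Proof.
move=> hf bf; have inj := bij_inj bf.
have fK : cancel f (f^-1)%VF by apply: lker0_lfunK; apply/lker0P.
have Kf : cancel (f^-1)%VF f.
  by case: bf => g gK Kg x; rewrite -{1}(Kg x) fK Kg.
by split=> // b v; apply: inj; rewrite Kf hf Kf.
Qed.

Lemma mod_iso_refl M : mod_iso M M.
Proof.
by exists \1%VF; [exact: hom_id | exists id => x; rewrite id_lfunE].
Qed.

Lemma mod_iso_sym M N : mod_iso M N -> mod_iso N M.
Proof.
case=> f hf bf; have [hg fK Kf] := hom_inv hf bf.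
by exists (f^-1)%VF => //; exists f.
Qed.

Lemma mod_iso_trans N M P : mod_iso M N -> mod_iso N P -> mod_iso M P.
Proof.
case=> f hf bf [g hg bg]; exists (g \o f)%VF; first exact: hom_comp.
have [f' fK Kf] := bf; have [g' gK Kg] := bg.
by exists (f' \o g') => x; rewrite /= comp_lfunE ?(gK, fK) ?(Kf, Kg).
Qed.

Lemma mod_iso_dim M N : mod_iso M N -> \dim {:M} = \dim {:N}.
Proof.
move=> iso; suff le P Q : mod_iso P Q -> (\dim {:P} <= \dim {:Q})%N.
  by apply/eqP; rewrite eqn_leq !le //; apply: mod_iso_sym.
case=> f _ bf; have k0 : lker f == 0%VS by apply/lker0P/bij_inj.
by rewrite -(@limg_dim_eq _ _ _ f fullv) ?(eqP k0) ?capv0 ?dimvS ?subvf.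
Qed.

Lemma qproj_hom M (U : {vspace M}) (stU : stable U) :
  is_hom (qproj U : 'Hom(M, quotmod stU)).
Proof. by move=> b v; rewrite -(qact_proj stU). Qed.

Lemma qproj_surj (V : vectType k) (U : {vspace V}) : limg (qproj U) = fullv.
Proof. by apply/limg_fullP => w; exists (vsval w); rewrite qproj_repr. Qed.

Lemma lker_qproj (V : vectType k) (U : {vspace V}) : lker (qproj U) = U.
Proof. by apply/vspaceP=> v; rewrite memv_ker qproj_eq0. Qed.

Lemma lker_stable M N (f : 'Hom(M, N)) : is_hom f -> stable (lker f).
Proof. by move=> hf b v; rewrite !memv_ker hf => /eqP->; rewrite linear0. Qed.

(** [projective] speaks only of surjections, whereas here [g] need only cover the image of [f]. The
    target is replaced by M / ker g: composing [f] with the linear pseudo-inverse of [g] becomes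
    equivariant there, because the ambiguity lies in ker g. *)
Lemma proj_lift P M N (g : 'Hom(M, N)) (f : 'Hom(P, N)) :
  projective P -> is_hom g -> is_hom f -> (forall p, exists m, g m = f p) ->
  exists2 h : 'Hom(P, M), is_hom h & forall p, g (h p) = f p.
Proof.
move=> pP hg hf sub.
have fV p : g (g^-1%VF (f p)) = f p.
  by rewrite limg_lfunVK //; have [m <-] := sub p; rewrite memv_img ?memvf.
pose Q := quotmod (lker_stable hg).
pose fb : 'Hom(P, Q) := (qproj (lker g) \o (g^-1 \o f))%VF.
have fbE p : fb p = qproj (lker g) (g^-1%VF (f p)) by rewrite !comp_lfunE.
have hfb : is_hom fb.
  move=> b p; rewrite !fbE -(qproj_hom (lker_stable hg)).
  by apply/eqP; rewrite qproj_eq memv_ker linearB /= hg !fV hf subrr.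
have [h hh e] := pP _ _ _ _ (qproj_hom (lker_stable hg)) hfb (qproj_surj _).
exists h => // p; have := congr1 (fun u : 'Hom(P, Q) => u p) e.
rewrite comp_lfunE fbE => /eqP; rewrite qproj_eq memv_ker linearB /= fV.
by rewrite subr_eq0 => /eqP.
Qed.

Section DirectSums.
Variables M N : fdmod B.

Definition dsnd : 'Hom(dsum M N, N) := linfun (fun v : dsum M N => v.2).
Definition dinl : 'Hom(M, dsum M N) := linfun (fun x : M => (x, 0) : dsum M N).

Lemma dsndE v : dsnd v = v.2.
Proof. by rewrite linfunE. Qed.
Lemma dinlE x : dinl x = (x, 0).
Proof.
rewrite linfunE // => c u v.
by congr pair; rewrite -[RHS]/(c *: (0 : N) + 0) scaler0 addr0.
Qed.
Lemma dsnd_hom : is_hom dsnd.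
Proof. by move=> b v; rewrite !dsndE. Qed.
Lemma dinl_hom : is_hom dinl.
Proof. by move=> b v; rewrite !dinlE; congr pair; rewrite linear0. Qed.

Lemma act_dsum b (u : M) (v : N) :
  act b ((u, v) : dsum M N) = (act b u, act b v).
Proof. by []. Qed.

Lemma dim_dsum : \dim {:dsum M N} = (\dim {:M} + \dim {:N})%N.
Proof. by rewrite !dimvf. Qed.

Lemma dsum_decomp (v : dsum M N) : v = dinl v.1 + dinr M N v.2.
Proof.
rewrite dinlE dinrE; case: v => x y.
by congr pair; rewrite /= ?addr0 ?add0r.
Qed.
End DirectSums.

Section SumMap.
Variables (M N P Q : fdmod B).

Definition dcopair (f : 'Hom(M, P)) (g : 'Hom(N, P)) : 'Hom(dsum M N, P) :=
  (f \o dfst M N)%VF + (g \o dsnd M N)%VF.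
Lemma dcopairE f g v : dcopair f g v = f v.1 + g v.2.
Proof. by rewrite add_lfunE !comp_lfunE dfstE dsndE. Qed.
Lemma dcopair_hom f g : is_hom f -> is_hom g -> is_hom (dcopair f g).
Proof. by move=> hf hg b v; rewrite !dcopairE /= hf hg linearD. Qed.

Definition dmap (f : 'Hom(M, P)) (g : 'Hom(N, Q)) : 'Hom(dsum M N, dsum P Q) :=
  (dinl P Q \o f \o dfst M N)%VF + (dinr P Q \o g \o dsnd M N)%VF.
Lemma dmapE f g v : dmap f g v = (f v.1, g v.2).
Proof.
rewrite add_lfunE !comp_lfunE dfstE dsndE dinlE dinrE.
by congr pair; rewrite /= ?addr0 ?add0r.
Qed.
Lemma dmap_hom f g : is_hom f -> is_hom g -> is_hom (dmap f g).
Proof. by move=> hf hg b v; rewrite !dmapE /= hf hg. Qed.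
End SumMap.

Lemma dsum_iso M N P Q : mod_iso M P -> mod_iso N Q -> mod_iso (dsum M N) (dsum P Q).
Proof.
case=> f hf [f' fK Kf] [g hg [g' gK Kg]]; exists (dmap f g); first exact: dmap_hom.
exists (fun v : dsum P Q => (f' v.1, g' v.2)) => -[x y]; rewrite dmapE /=.
  by rewrite fK gK.
by rewrite Kf Kg.
Qed.

Lemma dsumC M N : mod_iso (dsum M N) (dsum N M).
Proof.
have E (P Q : fdmod B) (v : dsum P Q) : dcopair (dinr Q P) (dinl Q P) v = (v.2, v.1).
  rewrite dcopairE dinlE dinrE.
  by congr pair; rewrite /= ?addr0 ?add0r.
exists (dcopair (dinr N M) (dinl N M)).
  by apply: dcopair_hom; [exact: dinr_hom | exact: dinl_hom].
by exists (dcopair (dinr M N) (dinl M N)) => -[x y]; rewrite !E.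
Qed.

Lemma dsum_projective P Q : projective P -> projective Q -> projective (dsum P Q).
Proof.
move=> pP pQ M N g f hg hf full; have s := iffRL (limg_fullP _) full.
have [h hh hE] := proj_lift pP hg (hom_comp hf (@dinl_hom P Q)) (fun _ => s _).
have [h' hh' hE'] := proj_lift pQ hg (hom_comp hf (@dinr_hom _ _ P Q)) (fun _ => s _).
exists (dcopair h h'); first exact: dcopair_hom.
apply/lfunP=> v; rewrite comp_lfunE dcopairE linearD /= hE hE' !comp_lfunE.
by rewrite -linearD -dsum_decomp.
Qed.

End Homs.

(** * Tau-rigidity in terms of minimal presentations *)

Section FreeModule.
Variables (k : fieldType) (B : falgType k) (d : nat).
Let F : vectType k := {ffun 'I_d -> B}.
Let fact (b : B) (f : F) : F := [ffun i => b * f i].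
Fact free_linearl f : linear (fact^~ f).
Proof. by move=> c a b; apply/ffunP=> i; rewrite !ffunE mulrDl scalerAl. Qed.
Fact free_linearr b : linear (fact b).
Proof. by move=> c f g; apply/ffunP=> i; rewrite !ffunE mulrDr scalerAr. Qed.
Fact free_act1 f : fact 1 f = f.
Proof. by apply/ffunP=> i; rewrite ffunE mul1r. Qed.
Fact free_actM a b f : fact (a * b) f = fact a (fact b f).
Proof. by apply/ffunP=> i; rewrite !ffunE mulrA. Qed.
Definition freemod : fdmod B :=
  FdMod free_linearl free_linearr free_act1 free_actM.

Lemma freemod_coord_hom i : is_hom (linfun (fun f : freemod => (f i : regmod B))).
Proof.
have lin : linear (fun f : freemod => (f i : regmod B)).
  by move=> c f g; rewrite !ffunE.
by move=> b f; rewrite !(linfunE lin) ffunE.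
Qed.

Lemma freemod_coordE i (f : freemod) :
  linfun (fun f : freemod => (f i : regmod B)) f = f i.
Proof. by rewrite linfunE // => c g h; rewrite !ffunE. Qed.
End FreeModule.

Section TauCriterion.
Variables (k : fieldType) (B : falgType k).
Implicit Types M N P : fdmod B.

(** The dual basis lemma. A linear basis of P gives a surjection onto P from a free module of rank
    dim P; by projectivity it splits, and the coordinates of the section are the [g i]. *)
Lemma dual_basis P : projective P ->
  exists (d : nat) (g : 'I_d -> star P) (p : 'I_d -> P),
    forall x, x = \sum_i act (vsval (g i) x : B) (p i).
Proof.
move=> pP; pose d := \dim {:P}; pose p (i : 'I_d) : P := (vbasis {:P})`_i.
pose F := freemod B d.
pose e (f : F) : P := \sum_i act (f i) (p i).
have le : linear e.
  move=> c f g; rewrite /e scaler_sumr -big_split /=; apply: eq_bigr => i _.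
  by rewrite !ffunE actDl actZl.
pose E : 'Hom(F, P) := linfun e; have EE f : E f = e f by rewrite linfunE.
have hE : is_hom E.
  move=> b f; rewrite !EE /e linear_sum; apply: eq_bigr => i _.
  by rewrite ffunE actM.
have sE x : exists f, E f = \1%VF x.
  exists [ffun i => (coord (vbasis {:P}) i x)%:A].
  rewrite id_lfunE EE /e [RHS](coord_vbasis (memvf x)).
  by apply: eq_bigr => i _; rewrite ffunE actZl act1.
have [h hh hE'] := proj_lift pP hE (@hom_id _ _ P) sE.
pose pr i : 'Hom(P, regmod B) := (linfun (fun f : F => (f i : regmod B)) \o h)%VF.
have mem i : pr i \in homv P (regmod B).
  by apply/mem_homv/hom_comp => //; apply: freemod_coord_hom.
exists d, (fun i => vsproj _ (pr i)), p => x.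
rewrite -[LHS](id_lfunE x) -hE' EE; apply: eq_bigr => i _.
by rewrite vsprojK // comp_lfunE freemod_coordE.
Qed.

(* Surjectivity of Hom(d1, N). *)
Definition extends P1 P0 (d1 : 'Hom(P1, P0)) N :=
  forall g : 'Hom(P1, N), is_hom g ->
    exists2 h : 'Hom(P0, N), is_hom h & forall x, h (d1 x) = g x.

Section Tensors.
Variables (P N : fdmod B).

(** The image of the pure tensor g (x) v under the canonical map from P^* (x) N to Hom(P, N). By the
    dual basis lemma this map is onto when P is projective, so tensors can be handled as
    homomorphisms. *)
Definition ptens (g : star P) (v : N) : 'Hom(P, N) :=
  linfun (fun x : P => act (vsval g x : B) v).
Lemma ptensE g v x : ptens g v x = act (vsval g x : B) v.
Proof.
by rewrite linfunE // => c y z; rewrite linearP actDl actZl.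
Qed.
Lemma ptens_hom g v : is_hom (ptens g v).
Proof.
move=> b x; rewrite !ptensE.
by have /mem_homv -> := subvsP g; rewrite -actM.
Qed.
Lemma ptens_linearl v : linear (ptens^~ v).
Proof.
move=> c f g; apply/lfunP=> x.
by rewrite add_lfunE scale_lfunE !ptensE linearP add_lfunE scale_lfunE actDl actZl.
Qed.
Lemma ptens_linearr g : linear (ptens g).
Proof.
move=> c f h; apply/lfunP=> x.
by rewrite add_lfunE scale_lfunE !ptensE linearP.
Qed.
Lemma ptens_balanced (b : B) g v : ptens (act (b : B^c) g) v = ptens g (act b v).
Proof. by apply/lfunP=> x; rewrite !ptensE starE actM. Qed.
End Tensors.

(* Hom(N, tau M) is dual to Tr M (x) N, which is the cokernel of Hom(d1, N)
   because Hom(P, N) = P^* (x) N for P projective. *)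
Lemma hom_tau_eq0 M (p : min_proj_pres M) N :
  (forall f : 'Hom(N, tau p), is_hom f -> f = 0) <-> extends (pres_d1 p) N.
Proof.
set d1 := pres_d1 p; have hd1 : is_hom d1 := pres_d1_hom p.
set P1 := pres_P1 p; set P0 := pres_P0 p.
have [r1 [a1 [p1 E1]]] := dual_basis (pres_P1_projective p : projective P1).
have [r0 [a0 [p0 E0]]] := dual_basis (pres_P0_projective p : projective P0).
have tens_sum (g : 'Hom(P1, N)) : is_hom g -> g = \sum_i ptens (a1 i) (g (p1 i)).
  move=> hg; apply/lfunP=> x; rewrite sum_lfunE {1}(E1 x) linear_sum.
  by apply: eq_bigr => i _; rewrite /= hg ptensE.
pose proj (g : star P1) : Tr p := qproj (limg (starf d1)) g.
have act_proj (b : B^c) c : act b (proj c) = proj (act b c).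
  exact: esym (@qproj_hom _ _ _ _ (stable_limg (starf_hom (pres_d1_hom p))) b c).
split=> [tau0 g hg | ext f hf].
  pose S : {vspace 'Hom(P1, N)} :=
    (linfun (fun h : 'Hom(P0, N) => (h \o d1)%VF : 'Hom(P1, N)) @: homv P0 N)%VS.
  have lS : linear (fun h : 'Hom(P0, N) => (h \o d1)%VF : 'Hom(P1, N)).
    move=> c u v; apply/lfunP=> x.
    by rewrite !(add_lfunE, scale_lfunE, comp_lfunE).
  have [/memv_imgP[h /mem_homv hh ->] | ngS] := boolP (g \in S).
    by exists h => // x; rewrite (linfunE lS) comp_lfunE.
  rewrite -qproj_eq0 in ngS; have [phi phi1] := functional_neq0 ngS.
  (* If g does not extend, some functional vanishes on the image of Hom(d1, N) but not at g.
     Evaluated on tensors a (x) v it defines a map N -> D Tr M, and its value at g contradicts the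
     vanishing of that map. *)
  pose Phi : 'Hom('Hom(P1, N), k^o) := (phi \o qproj S)%VF.
  have Phi0 h : is_hom h -> Phi (h \o d1)%VF = 0.
    move=> hh; rewrite comp_lfunE -(linfunE lS) [qproj _ _](_ : _ = 0) ?linear0 //.
    by apply/eqP; rewrite qproj_eq0 memv_img //; apply/mem_homv.
  pose F0 (v : N) (t : Tr p) : k^o := Phi (ptens (vsval t : star P1) v).
  have lF0 v : linear (F0 v).
    by move=> c s t; rewrite /F0 linearP ptens_linearl linearP.
  pose F1 (v : N) : tau p := linfun (F0 v).
  have F1E v a : F1 v (proj a) = Phi (ptens a v).
    rewrite (linfunE (lF0 v)) /F0.
    have /memv_imgP[b _ e] := repr_qproj (limg (starf d1)) a.
    apply/eqP; rewrite -subr_eq0 -linearB.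
    have -> : ptens (vsval (proj a)) v - ptens a v = (ptens b v \o d1)%VF.
      apply/lfunP=> x; rewrite add_lfunE opp_lfunE comp_lfunE !ptensE -starfE // -e.
      rewrite linearB /= add_lfunE opp_lfunE.
      by rewrite actDl -[- vsval a x]scaleN1r actZl scaleN1r.
    by rewrite /= Phi0 //; apply: ptens_hom.
  have lF1 : linear F1.
    move=> c u v; apply/lfunP=> t; rewrite -(qproj_repr t) add_lfunE scale_lfunE.
    by rewrite !F1E ptens_linearr linearP.
  have hF : is_hom (linfun F1 : 'Hom(N, tau p)).
    move=> b v; rewrite !(linfunE lF1); apply/lfunP=> t; rewrite -(qproj_repr t).
    by rewrite dualE -/(proj _) act_proj !F1E ptens_balanced.
  have F10 v : F1 v = 0 by rewrite -(linfunE lF1) (tau0 _ hF) zero_lfunE.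
  suff : phi (qproj S g) = 0 by rewrite phi1 => /eqP; rewrite oner_eq0.
  rewrite -comp_lfunE -/Phi (tens_sum g hg) linear_sum big1 // => i _.
  by rewrite /= -F1E F10 zero_lfunE.
apply/lfunP=> v; rewrite zero_lfunE; apply/lfunP=> t; rewrite -(qproj_repr t) zero_lfunE.
move: (vsval t) => a; rewrite -/(proj a).
have bal (b : B) c u : f u (proj (act (b : B^c) c)) = f (act b u) (proj c).
  by rewrite hf dualE act_proj.
have kill c u : f u (proj (starf d1 c)) = 0.
  have -> : proj (starf d1 c) = 0.
    by apply/eqP; rewrite qproj_eq0 memv_img ?memvf.
  by rewrite linear0.
(* Conversely [f] induces a functional on Hom(P1, N). The dual basis of P1 serves to write it down
   on an arbitrary g; on tensors it is given by [f] itself ([PhiE]). *)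
pose Phi (g : 'Hom(P1, N)) : k^o := \sum_i f (g (p1 i)) (proj (a1 i)).
have PhiE c u : Phi (ptens c u) = f u (proj c).
  rewrite {2}(_ : c = \sum_i act (vsval c (p1 i) : B^c) (a1 i)).
    rewrite /proj linear_sum linear_sum; apply: eq_bigr => i _.
    by rewrite ptensE -bal.
  apply/val_inj/lfunP=> x; rewrite linear_sum sum_lfunE {1}(E1 x) linear_sum.
  apply: eq_bigr => i _; rewrite /= starE.
  by have /mem_homv -> := subvsP c.
have PhiD g h : Phi (g + h) = Phi g + Phi h.
  by rewrite -big_split; apply: eq_bigr => i _; rewrite !add_lfunE linearD add_lfunE.
have Phi00 : Phi 0 = 0.
  by apply: big1 => i _; rewrite zero_lfunE linear0 zero_lfunE.
have [h hh hE] := ext _ (ptens_hom a v).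
rewrite -PhiE.
(* Expanding the extension h in the dual basis of P0 exhibits the tensor as a sum of tensors whose
   left factors come from P0^*, and these vanish in Tr M. *)
have -> : ptens a v = \sum_i ptens (starf d1 (a0 i)) (h (p0 i)).
  apply/lfunP=> x; rewrite -hE {1}(E0 (d1 x)) linear_sum sum_lfunE.
  by apply: eq_bigr => i _; rewrite /= hh ptensE starfE.
rewrite (big_morph Phi PhiD Phi00) big1 // => i _.
by rewrite PhiE kill.
Qed.

(* Two minimal projective presentations of M are isomorphic. *)
Lemma extends_unique M (p q : min_proj_pres M) N :
  extends (pres_d1 p) N -> extends (pres_d1 q) N.
Proof.
have lift0 (u w : min_proj_pres M) : exists h : 'Hom(pres_P0 u, pres_P0 w),
    [/\ is_hom h, forall x, pres_d0 w (h x) = pres_d0 u x & limg h = fullv].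
  have s := iffRL (limg_fullP _) (pres_d0_surj w).
  have [h hh hE] := proj_lift (pres_P0_projective u) (pres_d0_hom w) (pres_d0_hom u) (fun _ => s _).
  exists h; split=> //; apply: (pres_d0_superfluous w); first exact: stable_limg.
  apply/eqP; rewrite eqEsubv subvf /=; apply/subvP=> y _.
  have [z zE] := iffRL (limg_fullP _) (pres_d0_surj u) (pres_d0 w y).
  rewrite -[y](addrNK (h z)) addrC memv_add ?memv_img ?memvf //.
  by rewrite memv_ker linearB /= hE zE subrr.
have [h0 [hh0 E0 s0]] := lift0 p q; have [k0 [_ _ t0]] := lift0 q p.
(* There are surjections both ways between the two modules P0, so their dimensions agree. *)
have b0 : bijective h0.
  apply: bij_surj_dim => //; rewrite -[X in (X <= _)%N](congr1 (fun U => \dim U) t0).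
  by rewrite -(limg_ker_dim k0 fullv) leq_addl.
have [hi0 K0 K0'] := hom_inv hh0 b0.
have ker_img (u : min_proj_pres M) y : pres_d0 u y = 0 -> exists x, pres_d1 u x = y.
  move=> y0; have : y \in limg (pres_d1 u) by rewrite pres_d1_exact memv_ker y0.
  by case/memv_imgP=> x _ ->; exists x.
have img_ker (u : min_proj_pres M) x : pres_d0 u (pres_d1 u x) = 0.
  by apply/eqP; rewrite -memv_ker -pres_d1_exact memv_img ?memvf.
have [|h1 hh1 E1] := proj_lift (pres_P1_projective p) (pres_d1_hom q)
    (hom_comp hh0 (pres_d1_hom p)).
  by move=> x; apply: ker_img; rewrite comp_lfunE E0 img_ker.
have s1 : limg h1 = fullv.
  apply: (pres_d1_superfluous q); first exact: stable_limg.
  apply/eqP; rewrite eqEsubv subvf /=; apply/subvP=> y _.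
  have [|z zE] := ker_img p (h0^-1%VF (pres_d1 q y)).
    by rewrite -E0 K0' img_ker.
  rewrite -[y](addrNK (h1 z)) addrC memv_add ?memv_img ?memvf //.
  by rewrite memv_ker linearB /= E1 comp_lfunE zE K0' subrr.
move=> ext g hg; have [h hh hE] := ext _ (hom_comp hg hh1).
exists (h \o h0^-1)%VF; first exact: hom_comp.
move=> y; have [x <-] := iffRL (limg_fullP _) s1 y.
by rewrite comp_lfunE E1 comp_lfunE K0 hE comp_lfunE.
Qed.

(** [tau_rigid] comes with a presentation of its own; uniqueness allows the test to be made on
    whichever one is at hand. *)
Lemma tau_rigid_extends M (p : min_proj_pres M) : tau_rigid M <-> extends (pres_d1 p) M.
Proof.
split=> [[q /hom_tau_eq0] | ext]; first exact: extends_unique.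
by exists p; apply/hom_tau_eq0.
Qed.

Lemma tau_rigid_iso M N : mod_iso M N -> tau_rigid M -> tau_rigid N.
Proof.
case=> f hf bf [p /hom_tau_eq0 ext].
have [hg fK Kf] := hom_inv hf bf.
have surj : limg (f \o pres_d0 p)%VF = fullv.
  apply/limg_fullP => y; have [x xE] := iffRL (limg_fullP _) (pres_d0_surj p) (f^-1%VF y).
  by exists x; rewrite comp_lfunE xE Kf.
have kerE : lker (f \o pres_d0 p)%VF = lker (pres_d0 p).
  apply/vspaceP=> x; rewrite !memv_ker comp_lfunE.
  by rewrite -(inj_eq (can_inj fK) (pres_d0 p x)) linear0.
have ex : limg (pres_d1 p) = lker (f \o pres_d0 p)%VF by rewrite kerE pres_d1_exact.
have sf : superfluous (lker (f \o pres_d0 p)%VF).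
  by rewrite kerE; apply: pres_d0_superfluous.
pose q := MinProjPres (pres_d1_hom p) (hom_comp hf (pres_d0_hom p))
  (pres_P1_projective p) (pres_P0_projective p) surj ex sf (pres_d1_superfluous p).
apply/(tau_rigid_extends q) => g hgg /=.
have [h hh hE] := ext _ (hom_comp hg hgg).
exists (f \o h)%VF; first exact: hom_comp.
by move=> x; rewrite comp_lfunE hE comp_lfunE Kf.
Qed.

End TauCriterion.

(** * Generators of the trivial extension *)

Section Generators.
Variables (k : fieldType) (m : nat).
Local Notation n := m.+1.
Local Notation A := (pathalg k m).
Local Notation T := (trivext A).
Local Notation DA := 'Hom(A, k^o).
Implicit Types x y z : A.

(* Vertices are numbered from 0 here; out of range coefficients vanish. *)
Definition ncoef z (i j : nat) : k :=
  \sum_(r : linpath n | (psrc r == i :> nat) && (ptgt r == j :> nat)) z r.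

Definition npath (i j : nat) : A :=
  [ffun r => ((psrc r == i :> nat) && (ptgt r == j :> nat))%:R].

Lemma ncoef_ord z (i j : 'I_n) : ncoef z i j = coef z i j.
Proof. by rewrite Defs.coefE. Qed.

Lemma ncoef_gt z i j : (j < i)%N -> ncoef z i j = 0.
Proof.
move=> ji; apply: big1 => r /andP[/eqP ri /eqP rj].
by have := valP r; rewrite -/(psrc r) -/(ptgt r) ri rj leqNgt ji.
Qed.

Lemma ncoef_out z i j : (m < j)%N -> ncoef z i j = 0.
Proof.
move=> ji; apply: big1 => r /andP[_ /eqP rj].
by have := ltn_ord (ptgt r); rewrite rj ltnS leqNgt ji.
Qed.

Lemma npath_out i j : (m < j)%N -> npath i j = 0.
Proof.
move=> ji; apply/ffunP=> r; rewrite !ffunE; case: andP => // -[_ /eqP rj].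
by have := ltn_ord (ptgt r); rewrite rj ltnS leqNgt ji.
Qed.

Lemma ncoef_npath i j (a b : 'I_n) : (i <= j)%N ->
  ncoef (npath i j) a b = ((a == i :> nat) && (b == j :> nat))%:R.
Proof.
move=> ij; rewrite ncoef_ord /coef; case: insubP => [r _ rab | ab] /=.
  by rewrite ffunE /psrc /ptgt rab.
by case: andP => // -[/eqP ai /eqP bj]; rewrite /= ai bj ij in ab.
Qed.

Lemma ncoefP x y : (forall i j : 'I_n, ncoef x i j = ncoef y i j) -> x = y.
Proof. by move=> e; apply: Defs.coefP => i j; rewrite -!ncoef_ord. Qed.

Lemma ncoefM x y i j :
  ncoef (x * y) i j = \sum_(l < n) ncoef x l j * ncoef y i l.
Proof.
have [ji | ij] := ltnP j i.
  rewrite ncoef_gt // big1 // => l _.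
  have [lj | jl] := leqP l j; last by rewrite ncoef_gt ?mul0r.
  by rewrite [ncoef y i l]ncoef_gt ?mulr0 // (leq_ltn_trans lj).
have [jm | mj] := leqP j m; last first.
  by rewrite ncoef_out // big1 // => l _; rewrite ncoef_out ?mul0r.
have ltj : (j < n)%N by []. have lti : (i < n)%N by apply: leq_ltn_trans ltj.
rewrite (ncoef_ord _ (Ordinal lti) (Ordinal ltj)) Defs.coefM.
by apply: eq_bigr => l _; rewrite -!ncoef_ord.
Qed.

Lemma ncoef_linear i j : linear (fun z => ncoef z i j : k^o).
Proof.
move=> c x y; rewrite /ncoef scaler_sumr -big_split /=.
by apply: eq_bigr => r _; rewrite !ffunE.
Qed.

Definition ndual i j : DA := linfun (fun z => ncoef z i j : k^o).
Lemma ndualE i j z : ndual i j z = ncoef z i j.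
Proof. by rewrite (linfunE (@ncoef_linear i j)). Qed.

Lemma ndual_gt i j : (j < i)%N -> ndual i j = 0.
Proof. by move=> ij; apply/lfunP=> z; rewrite ndualE ncoef_gt ?zero_lfunE. Qed.

Definition arrows : A := [ffun r => (ptgt r == (psrc r).+1 :> nat)%:R].

Lemma ncoef_arrows (a b : 'I_n) : ncoef arrows a b = (b == a.+1 :> nat)%:R.
Proof.
rewrite ncoef_ord /coef; case: insubP => [r _ rab | ab] /=.
  by rewrite ffunE /psrc /ptgt rab.
by case: eqP => // ba; rewrite /= ba leqnSn in ab.
Qed.

Lemma ncoef_npath_mul z i j a b : (i <= j <= m)%N ->
  ncoef (npath i j * z) a b = (b == j)%:R * ncoef z a i.
Proof.
case/andP=> ij jm; have lti : (i < n)%N by lia.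
rewrite ncoefM (bigD1 (Ordinal lti)) //= big1 ?addr0.
  have [bm | mb] := leqP b m.
    by rewrite (ncoef_npath (Ordinal lti) (Ordinal (bm : b < n)%N)) // eqxx.
  rewrite ncoef_out // mul0r; case: eqP => [e|]; last by rewrite mul0r.
  by move: mb; rewrite e ltnNge jm.
move=> l nl; have [bm | mb] := leqP b m; last by rewrite ncoef_out ?mul0r.
rewrite (ncoef_npath l (Ordinal (bm : b < n)%N)) //.
by rewrite -[l == i :> nat]/(l == Ordinal lti) (negPf nl) mul0r.
Qed.

Lemma ncoef_mul_npath z i j a b : (i <= j <= m)%N ->
  ncoef (z * npath i j) a b = (a == i)%:R * ncoef z j b.
Proof.
case/andP=> ij jm.
rewrite ncoefM (bigD1 (Ordinal (jm : j < n)%N)) //= big1 ?addr0.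
  have [am | ma] := leqP a m.
    by rewrite (ncoef_npath (Ordinal (am : a < n)%N) (Ordinal (jm : j < n)%N)) // eqxx andbT mulrC.
  rewrite [ncoef (npath _ _) _ _]ncoef_gt ?mulr0; last by lia.
  by case: eqP => [e|]; [lia | rewrite mul0r].
move=> l nl; have [am | ma] := leqP a m; last first.
  by rewrite [ncoef (npath _ _) _ _]ncoef_gt ?mulr0 //; have := ltn_ord l; lia.
rewrite (ncoef_npath (Ordinal (am : a < n)%N) l) //.
by rewrite -[l == j :> nat]/(l == Ordinal (jm : j < n)%N) (negPf nl) andbF mulr0.
Qed.

Lemma ncoef_arrows_mul z a b : (b < m)%N ->
  ncoef (arrows * z) a b.+1 = ncoef z a b.
Proof.
move=> bm; have lb : (b < n)%N by apply: ltnW.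
rewrite ncoefM (bigD1 (Ordinal lb)) //= big1 ?addr0.
  by rewrite (ncoef_arrows (Ordinal lb) (Ordinal (bm : b.+1 < n)%N)) eqxx mul1r.
move=> l nl; rewrite (ncoef_arrows l (Ordinal (bm : b.+1 < n)%N)) /= eqSS eq_sym.
by rewrite -[l == b :> nat]/(l == Ordinal lb) (negPf nl) mul0r.
Qed.

Lemma ncoef_arrows_mul0 z a : ncoef (arrows * z) a 0 = 0.
Proof.
by rewrite ncoefM big1 // => l _; rewrite (ncoef_arrows l ord0) mul0r.
Qed.

Lemma ncoef_mul_arrows z a b : (a < m)%N ->
  ncoef (z * arrows) a b = ncoef z a.+1 b.
Proof.
move=> am; have la : (a < n)%N by apply: ltnW.
rewrite ncoefM (bigD1 (Ordinal (am : a.+1 < n)%N)) //= big1 ?addr0.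
  by rewrite (ncoef_arrows (Ordinal la) (Ordinal (am : a.+1 < n)%N)) eqxx mulr1.
move=> l nl; rewrite (ncoef_arrows (Ordinal la) l) /=.
by rewrite -[l == a.+1 :> nat]/(l == Ordinal (am : a.+1 < n)%N) (negPf nl) mulr0.
Qed.

Lemma ncoef_mul_arrows_max z a b : (m <= a)%N -> ncoef (z * arrows) a b = 0.
Proof.
move=> ma; rewrite ncoefM big1 // => l _; have [am | ma'] := leqP a m; last first.
  by rewrite [ncoef arrows _ _]ncoef_gt ?mulr0 //; have := ltn_ord l; lia.
rewrite (ncoef_arrows (Ordinal (am : a < n)%N) l) /=.
by have := ltn_ord l; case: eqP => [|_]; rewrite ?mulr0 //; lia.
Qed.

(* The arrows of the cyclic quiver of T(A): those of the linear quiver, and the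
   functional dual to the longest path, which goes from the last vertex back to the
   first one. *)
Definition gen : T := (arrows, ndual 0 m).
(** Adding m = n - 1 stands for subtracting 1 modulo n: it converts the numbering from 1 to the one
    from 0 without truncation, and a = 0 means the last vertex. *)
Definition vtx a : nat := ((a + m) %% n)%N.
(* The idempotent of vertex a, where a >= 1 is read modulo n. *)
Definition idem a : T := (npath (vtx a) (vtx a), 0).

Lemma vtx_le a : (vtx a <= m)%N.
Proof. by rewrite -ltnS ltn_mod. Qed.

Lemma vtx_eq a b : (vtx a == vtx b) = (a == b %[mod n]).
Proof. exact: eqn_modDr. Qed.

Lemma vtx_small a : (1 <= a <= n)%N -> vtx a = a.-1.
Proof.
move=> /andP[a1 an]; rewrite /vtx (_ : a + m = a.-1 + n)%N; last by lia.
by rewrite modnDr modn_small //; lia.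
Qed.

Lemma vtxS a : vtx a.+1 = if vtx a == m then 0%N else (vtx a).+1.
Proof.
rewrite /vtx addSn -(addn1 (a + m)) -modnDml; have := ltn_mod (a + m) n.
case: eqP => [-> _ | ne lt]; first by rewrite addn1 modnn.
by rewrite modn_small addn1 //; lia.
Qed.

Lemma idem_eq a b : a = b %[mod n] -> idem a = idem b.
Proof. by move/eqP; rewrite -vtx_eq => /eqP e; rewrite /idem e. Qed.

Lemma ncoef0 a b : ncoef 0 a b = 0.
Proof. by rewrite -ndualE linear0. Qed.

Lemma npath_mul i j l p : (i <= j <= m)%N -> (l <= p <= m)%N ->
  npath l p * npath i j = if j == l then npath i p else 0.
Proof.
move=> /andP[ij jm] lpm; have /andP[lp pm] := lpm; apply: ncoefP => a b.
have ltl : (l < n)%N by lia.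
rewrite ncoef_npath_mul // (ncoef_npath a (Ordinal ltl)) //=.
rewrite -natrM mulnb; case: (j =P l) => [e | ne].
  by rewrite ncoef_npath; [congr _%:R; lia | lia].
by rewrite ncoef0 (_ : _ && _ = false) //; lia.
Qed.

Lemma idemM a b : idem a * idem b = if a == b %[mod n] then idem a else 0.
Proof.
have va := vtx_le a; have vb := vtx_le b.
rewrite trivext_mulE /= npath_mul ?leqnn // dlact0 dract0 addr0 -vtx_eq eq_sym.
by case: eqP => // e; rewrite /idem e.
Qed.

Lemma npath1E : \sum_(i < n) npath i i = 1.
Proof.
apply/ffunP=> r; rewrite sum_ffunE ffunE (bigD1 (psrc r)) //= big1 ?addr0.
  by rewrite ffunE eqxx /= eq_sym.
by move=> i ni; rewrite ffunE [psrc r == i :> nat]eq_sym (negPf ni : (i == psrc r :> nat) = false).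
Qed.

Lemma sum_idem : \sum_(1 <= a < n.+1) idem a = 1.
Proof.
rewrite big_add1 big_mkord.
transitivity (\sum_(i < n) (npath i i, 0) : T).
  by apply: eq_bigr => i _; rewrite /idem vtx_small //=; apply: ltn_ord.
have -> : (1 : T) = (\sum_(i < n) npath i i, 0) by rewrite npath1E.
elim/big_ind2: _ => // x1 x2 y1 y2 -> ->.
by congr pair; rewrite /= addr0.
Qed.

(** [gen] prolongs a path at its end. At the last vertex the linear part dies, as [npath i n] is 0,
    and the functional component of [gen] yields the dual of the path from 0 to i. *)
Lemma gen_npath i j : (i <= j <= m)%N ->
  gen * ((npath i j, 0) : T) = (npath i j.+1, if j == m then ndual 0 i else 0).
Proof.
move=> ijm; have /andP[ij jm] := ijm; rewrite trivext_mulE /=; congr pair.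
  apply: ncoefP => a -[[|b] ltb].
    by rewrite ncoef_arrows_mul0 ncoef_npath //=; [rewrite andbF | lia].
  rewrite ncoef_arrows_mul //=.
  by rewrite (ncoef_npath a (Ordinal (ltnW ltb))) // (ncoef_npath a (Ordinal ltb)) //= leqW.
rewrite dlact0 add0r; apply/lfunP=> z; rewrite dractE ndualE ncoef_npath_mul //.
rewrite eq_sym; case: (j =P m) => _; first by rewrite mul1r ndualE.
by rewrite mul0r zero_lfunE.
Qed.

Lemma dract0r (f : DA) : dract f 0 = 0.
Proof. by apply/lfunP=> z; rewrite dractE mul0r linear0 zero_lfunE. Qed.

Lemma gen_ndual i j : (i <= j <= m)%N ->
  gen * ((0, ndual i j) : T) = (0, ndual i.+1 j).
Proof.
move=> /andP[ij jm]; rewrite trivext_mulE /= mulr0; congr pair.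
rewrite dract0r addr0; apply/lfunP=> z; rewrite dlactE !ndualE.
have [im | mi] := ltnP i m; first by rewrite ncoef_mul_arrows.
by rewrite ncoef_mul_arrows_max // ncoef_gt //; lia.
Qed.

Lemma gen_pow_path a t : (1 <= a)%N -> (a + t <= n)%N ->
  gen ^+ t * idem a = (npath a.-1 (a.-1 + t), 0).
Proof.
move=> a1; elim: t => [|t IH] le; first by rewrite mul1r addn0 /idem vtx_small //; lia.
rewrite exprS -mulrA IH ?gen_npath; try lia.
by rewrite addnS; have -> : (a.-1 + t == m)%N = false by lia.
Qed.

(** It takes n - a arrows to reach the last vertex and one more to cross into D(A); each further one
    raises the source of the dual path. At t = a - 1, that is for the power n, the dual of the
    trivial path at a is reached, and the next power is 0. *)
Lemma gen_pow_dual a t : (1 <= a <= n)%N ->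
  gen ^+ (n - a + t.+1) * idem a = (0, ndual t a.-1).
Proof.
move=> /andP[a1 an]; elim: t => [|t IH].
  rewrite addn1 exprS -mulrA gen_pow_path ?gen_npath; try lia.
  by have -> : (a.-1 + (n - a) = m)%N by [lia]; rewrite eqxx npath_out.
rewrite addnS exprS -mulrA IH.
have [le | lt] := leqP t a.-1; first by rewrite gen_ndual //; lia.
by rewrite !ndual_gt ?mulr0 //; lia.
Qed.

Lemma gen_nilp : gen ^+ n.+1 = 0.
Proof.
rewrite -[_ ^+ _]mulr1 -sum_idem mulr_sumr big_nat_cond big1 // => a.
rewrite andbT => /andP[a1 an].
rewrite (_ : n.+1 = n - a + a.+1)%N ?gen_pow_dual ?a1 //; last by lia.
by rewrite ndual_gt //; lia.
Qed.

Lemma gen_idem a : gen * idem a = idem a.+1 * gen.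
Proof.
have va := vtx_le a; rewrite /idem gen_npath ?leqnn //.
rewrite trivext_mulE /= vtxS dract0 addr0; congr pair.
  apply: ncoefP => i j; rewrite ncoef_npath_mul; last by case: ifP => ?; lia.
  have [ea | na] := eqVneq (vtx a) m.
    rewrite npath_out ?ea // ncoef0.
    case: (nat_of_ord j =P 0%N) => [_ | _]; last by rewrite mul0r.
    by rewrite (ncoef_arrows i ord0) mulr0.
  have lta : ((vtx a).+1 < n)%N by lia.
  rewrite (ncoef_npath i j) // (ncoef_arrows i (Ordinal lta)) -natrM mulnb /=.
  by congr _%:R; lia.
apply/lfunP=> z; rewrite dlactE ndualE ncoef_mul_npath; last by case: ifP => ?; lia.
have [ea | na] := eqVneq (vtx a) m; first by rewrite eqxx mul1r ndualE ea.
by rewrite mul0r zero_lfunE.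
Qed.

Lemma gen_pow_idem t a : gen ^+ t * idem a = idem (a + t) * gen ^+ t.
Proof.
elim: t a => [|t IH] a; first by rewrite mul1r mulr1 addn0.
by rewrite exprSr -mulrA gen_idem mulrA IH -mulrA -exprSr addSnnS.
Qed.

(** By [gen_pow_path] and [gen_pow_dual] the elements [gen ^+ s * idem a] include all paths and all
    functionals of the dual basis, so they span T(A). Thanks to this, equivariance of maps and
    stability of subspaces need only be checked on generators. *)
Lemma trivext_ind (Q : T -> Prop) :
  (forall s t : T, Q s -> Q t -> Q (s + t)) -> (forall c (t : T), Q t -> Q (c *: t)) ->
  (forall s t : T, Q s -> Q t -> Q (s * t)) -> (forall a, Q (idem a)) -> Q gen ->
  forall t : T, Q t.
Proof.
move=> QD QZ QM Qi Qg.
have Q0 : Q 0 by rewrite -(scale0r gen); apply: QZ.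
have QX1 a s : Q (gen ^+ s * idem a).
  elim: s => [|s IH]; first by rewrite mul1r.
  by rewrite exprS -mulrA; apply: QM.
have pathE (z : A) : z = \sum_(r : linpath n) z r *: npath (psrc r) (ptgt r).
  apply/ffunP=> r; rewrite sum_ffunE (bigD1 r) //= big1 ?addr0.
    by rewrite !ffunE !eqxx -[_ *: _]/(_ * _) mulr1.
  move=> s ns; rewrite !ffunE; case: andP => [[/eqP e1 /eqP e2] | _]; last by rewrite scaler0.
  case/eqP: ns; apply: val_inj; rewrite (surjective_pairing (val s)) (surjective_pairing (val r)).
  by congr pair; apply: val_inj; rewrite /= ?e1 ?e2.
case=> a f.
have -> : ((a, f) : T) = ((a, 0) : T) + (0, f).
  by rewrite -[RHS]/(a + 0, 0 + f) addr0 add0r.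
apply: (QD).
  have QA (c : k) (x y : A) : Q (x, 0) -> Q (y, 0) -> Q (c *: x + y, 0).
    move=> Qx Qy; have := QD _ _ (QZ c _ Qx) Qy.
    by rewrite -[X in Q X]/(c *: x + y, c *: 0 + 0) scaler0 addr0.
  rewrite (pathE a); elim/big_rec: _ => // r y _; apply: QA.
  have lt := ltn_ord (ptgt r); have le := valP r; rewrite -/(psrc r) -/(ptgt r) in le.
  have := @gen_pow_path (psrc r).+1 (ptgt r - psrc r) isT.
  by rewrite /= subnKC // => <-; [apply: QX1 | lia].
have QDA (c : k) (x y : DA) : Q (0, x) -> Q (0, y) -> Q (0, c *: x + y).
  move=> Qx Qy; have := QD _ _ (QZ c _ Qx) Qy.
  by rewrite -[X in Q X]/(c *: 0 + 0, c *: x + y) scaler0 addr0.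
have -> : f = \sum_(r : linpath n) f (npath (psrc r) (ptgt r)) *: ndual (psrc r) (ptgt r).
  apply/lfunP=> z; rewrite {1}(pathE z) linear_sum sum_lfunE; apply: eq_bigr => r _.
  by rewrite linearZ scale_lfunE ndualE ncoef_ord coef_val; exact: mulrC.
elim/big_rec: _ => // r y _; apply: QDA.
by have := @gen_pow_dual (ptgt r).+1 (psrc r) (ltn_ord (ptgt r)) => /= <-.
Qed.

End Generators.

(** * Uniserial modules *)

(* What is used of the path algebra of the cyclic quiver with n vertices modulo the
   paths of length n + 1: e a is the idempotent of the vertex a mod n, and x the sum
   of the arrows. *)
Record cyclic_gens (k : fieldType) (B : falgType k) (n : nat) (e : nat -> B) (x : B) : Prop :=
  CyclicGens {
    gens_eM : forall a b, e a * e b = if a == b %[mod n] then e a else 0;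
    gens_eq : forall a b, a = b %[mod n] -> e a = e b;
    gens_xe : forall t a, x ^+ t * e a = e (a + t)%N * x ^+ t;
    gens_sum : \sum_(1 <= a < n.+1) e a = 1;
    gens_nilp : x ^+ n.+1 = 0;
    gens_ind : forall Q : B -> Prop,
      (forall s t, Q s -> Q t -> Q (s + t)) -> (forall c t, Q t -> Q (c *: t)) ->
      (forall s t, Q s -> Q t -> Q (s * t)) -> (forall a, Q (e a)) -> Q x ->
      forall t, Q t }.

Section Uniserial.
Variables (k : fieldType) (B : falgType k) (n : nat) (e : nat -> B) (x : B).
Hypothesis gens : cyclic_gens n e x.
Implicit Types M N P Q : fdmod B.

Definition eact M a (v : M) : M := act (e a) v.
Definition xact M t (v : M) : M := act (x ^+ t) v.

Lemma xact_xact M s t (v : M) : xact s (xact t v) = xact (s + t) v.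
Proof. by rewrite /xact -actM exprD. Qed.
Lemma xact0 M (v : M) : xact 0 v = v.
Proof. exact: act1. Qed.
Lemma xact_nilp M t (v : M) : (n < t)%N -> xact t v = 0.
Proof. by move=> lt; rewrite /xact -(subnK lt) exprD (gens_nilp gens) mulr0 act0l. Qed.
Lemma xact_eact M t a (v : M) : xact t (eact a v) = eact (a + t) (xact t v).
Proof. by rewrite /xact /eact -!actM (gens_xe gens). Qed.
Lemma eact_eact M a b (v : M) : eact a (eact b v) = if a == b %[mod n] then eact a v else 0.
Proof. by rewrite /eact -actM (gens_eM gens); case: ifP => // _; rewrite act0l. Qed.
Lemma eact_mod M a b (v : M) : a = b %[mod n] -> eact a v = eact b v.
Proof. by move=> ab; rewrite /eact (gens_eq gens ab). Qed.
Lemma eact_xact M i a t (v : M) : eact i v = v ->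
  eact a (xact t v) = if a == i + t %[mod n] then xact t v else 0.
Proof.
move=> iv; rewrite -{1}iv xact_eact eact_eact; case: eqP => // ai.
by rewrite (eact_mod _ ai) -xact_eact iv.
Qed.
Lemma eact_decomp M (v : M) : v = \sum_(1 <= a < n.+1) eact a v.
Proof.
rewrite -{1}[v]act1 -(gens_sum gens) /eact.
exact: (big_morph (act^~ v) (fun a b => actDl a b v) (act0l v)).
Qed.

Lemma xact_eq0_ge M s t (v : M) : (s <= t)%N -> xact s v = 0 -> xact t v = 0.
Proof. by move=> st v0; rewrite -(subnK st) -xact_xact v0 /xact linear0. Qed.

Lemma xact_sum M t I (r : seq I) (P : pred I) (F : I -> M) :
  xact t (\sum_(i <- r | P i) F i) = \sum_(i <- r | P i) xact t (F i).
Proof. exact: linear_sum. Qed.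
Lemma eact_sum M a I (r : seq I) (P : pred I) (F : I -> M) :
  eact a (\sum_(i <- r | P i) F i) = \sum_(i <- r | P i) eact a (F i).
Proof. exact: linear_sum. Qed.
Lemma xactZ M t c (v : M) : xact t (c *: v) = c *: xact t v.
Proof. exact: linearZ. Qed.
Lemma eactZ M a c (v : M) : eact a (c *: v) = c *: eact a v.
Proof. exact: linearZ. Qed.

Lemma hom_xact M N (f : 'Hom(M, N)) t v : is_hom f -> f (xact t v) = xact t (f v).
Proof. by move=> hf; apply: hf. Qed.
Lemma hom_eact M N (f : 'Hom(M, N)) a v : is_hom f -> f (eact a v) = eact a (f v).
Proof. by move=> hf; apply: hf. Qed.

Lemma hom_gens M N (f : 'Hom(M, N)) :
  (forall a v, f (eact a v) = eact a (f v)) -> (forall v, f (xact 1 v) = xact 1 (f v)) -> is_hom f.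
Proof.
move=> fE fX; apply: (gens_ind gens) => [s t hs ht | c t ht | s t hs ht | // | //] v.
- by rewrite !actDl linearD /= hs ht.
- by rewrite !actZl linearZ /= ht.
by rewrite !actM hs ht.
Qed.

Lemma stable_gens M (U : {vspace M}) :
  (forall a v, v \in U -> eact a v \in U) -> (forall v, v \in U -> xact 1 v \in U) -> stable U.
Proof.
move=> fE fX; apply: (gens_ind gens) => [s t hs ht | c t ht | s t hs ht | // | //] v vU.
- by rewrite actDl memvD ?hs ?ht.
- by rewrite actZl memvZ ?ht.
by rewrite actM hs ?ht.
Qed.

(** Induction on t: applying x^(h - t) kills the terms beyond t, the earlier ones vanish by
    induction, and c t x^h w remains. [L] may exceed h + 1, in which case the terms beyond h are
    zero and their coefficients stay free. *)
Lemma xact_indep M h L (c : nat -> k) (w : M) :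
    xact h w != 0 -> xact h.+1 w = 0 -> \sum_(t < L) c t *: xact t w = 0 ->
  forall t, (t <= h)%N -> (t < L)%N -> c t = 0.
Proof.
move=> nz z s0; elim/ltn_ind => t IH th tN; apply/eqP; apply: contraNT nz => ct.
have := congr1 (xact (h - t)) s0; rewrite xact_sum (bigD1 (Ordinal tN)) //= big1.
  rewrite addr0 xactZ xact_xact subnK // [RHS]linear0 => /eqP.
  by rewrite scaler_eq0 (negPf ct).
move=> s ns; have [st | ts] := ltnP s t; first by rewrite IH ?scale0r ?[LHS]linear0 //; lia.
rewrite xactZ xact_xact (xact_eq0_ge _ z) ?scaler0 //.
by have : s != t :> nat by []; lia.
Qed.

(* i is the vertex of the top and l the length. *)
Definition uniserial_gen M i l (v : M) :=
  [/\ eact i v = v, xact l v = 0, xact l.-1 v != 0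
    & forall u, exists c : nat -> k, u = \sum_(t < l) c t *: xact t v].

Definition uniserial i l M := (0 < l)%N /\ exists v : M, uniserial_gen i l v.

Section UniGen.
Variables (M : fdmod B) (i l : nat) (v : M).
Hypotheses (l0 : (0 < l)%N) (gv : uniserial_gen i l v).

Let b : l.-tuple M := [tuple xact t v | t < l].

Lemma uni_indep L (c : nat -> k) : \sum_(t < L) c t *: xact t v = 0 ->
  forall t, (t < l)%N -> (t < L)%N -> c t = 0.
Proof.
have [_ z nz _] := gv => s0 t tl; apply: (xact_indep nz _ s0); last by lia.
by rewrite prednK.
Qed.

Lemma uni_basis : basis_of fullv b.
Proof.
have [_ _ _ sp] := gv; apply/andP; split.
  rewrite eqEsubv subvf /=; apply/subvP=> u _; have [c ->] := sp u.
  apply: memv_suml => t _; apply/memvZ/memv_span.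
  by apply/(tnthP b); exists t; rewrite tnth_mktuple.
apply/freeP => c s0 t; pose c' s := if insub s is Some r then c r else 0.
have c'E (s : 'I_l) : c' s = c s by rewrite /c' valK.
rewrite -c'E; apply: (@uni_indep l c') => //; rewrite -[RHS]s0.
by apply: eq_bigr => s _; rewrite c'E -tnth_nth tnth_mktuple.
Qed.

Lemma uni_dim : \dim {:M} = l.
Proof. by have /size_basis := uni_basis. Qed.

Lemma uni_len : (l <= n.+1)%N.
Proof.
have [_ _ nz _] := gv; rewrite leqNgt; apply: contra nz => lt.
by rewrite xact_nilp //; lia.
Qed.

Lemma uni_homE N (f g : 'Hom(M, N)) : is_hom f -> is_hom g -> f v = g v ->
  forall u, f u = g u.
Proof.
have [_ _ _ sp] := gv => hf hg fg u; have [c ->] := sp u.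
by rewrite !linear_sum; apply: eq_bigr => t _; rewrite !linearZ /= !hom_xact // fg.
Qed.

(** The universal property: a uniserial module is generated by v at vertex i with the single
    relation x^l v = 0. For l = n + 1 that relation holds for every w, whence projectivity in
    [uni_projective]. *)
Lemma uni_hom N (w : N) : eact i w = w -> xact l w = 0 ->
  exists2 f : 'Hom(M, N), is_hom f & f v = w.
Proof.
have [iv z _ sp] := gv => iw zw.
pose F u := \sum_(t < l) coord b t u *: xact t w.
have lF : linear F.
  move=> c y u; rewrite /F scaler_sumr -big_split /=; apply: eq_bigr => t _.
  by rewrite linearP scalerDl scalerA.
have fb : free b by have /andP[] := uni_basis.
have coordX (s r : 'I_l) : coord b s (xact r v) = (r == s)%:R.
  by rewrite -(coord_free r s fb) -tnth_nth tnth_mktuple.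
pose f : 'Hom(M, N) := linfun F.
have fX t : f (xact t v) = xact t w.
  rewrite (linfunE lF); have [tl | lt] := ltnP t l; last first.
    by rewrite !(xact_eq0_ge lt) // /F big1 // => s _; rewrite linear0 scale0r.
  rewrite /F (bigD1 (Ordinal tl)) //= (coordX _ (Ordinal tl)) eqxx scale1r big1 ?addr0 // => s ns.
  by rewrite (coordX _ (Ordinal tl)) eq_sym (negPf ns) scale0r.
exists f; last by rewrite -[v]xact0 fX xact0.
apply: hom_gens => [a | ] u; have [c ->] := sp u.
  rewrite eact_sum !linear_sum eact_sum; apply: eq_bigr => t _.
  rewrite /= eactZ (eact_xact _ _ iv) [f (_ *: xact t v)]linearZ /= fX eactZ (eact_xact _ _ iw).
  by case: ifP => _; rewrite linearZ /= ?fX ?linear0.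
rewrite xact_sum !linear_sum xact_sum; apply: eq_bigr => t _.
by rewrite xactZ xact_xact !linearZ /= !fX xactZ xact_xact.
Qed.
End UniGen.

Lemma uni_mod i j l M : i = j %[mod n] -> uniserial i l M -> uniserial j l M.
Proof.
move=> ij [l0 [v [iv z nz sp]]]; split=> //; exists v; split=> //.
by rewrite -(eact_mod _ ij).
Qed.

Lemma uni_iso i l M N : uniserial i l M -> uniserial i l N -> mod_iso M N.
Proof.
move=> [l0 [v gv]] [_ [w gw]].
have [iv z _ _] := gv; have [iw zw _ _] := gw.
have [f hf fv] := uni_hom l0 gv iw zw; have [g hg gw'] := uni_hom l0 gw iv z.
exists f => //; exists g => u.
  have := uni_homE gv (hom_comp hg hf) (@hom_id _ _ M); rewrite !comp_lfunE fv gw' id_lfunE.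
  by move/(_ erefl u); rewrite comp_lfunE id_lfunE.
have := uni_homE gw (hom_comp hf hg) (@hom_id _ _ N); rewrite !comp_lfunE gw' fv id_lfunE.
by move/(_ erefl u); rewrite comp_lfunE id_lfunE.
Qed.

Lemma iso_uni i l M N : mod_iso M N -> uniserial i l M -> uniserial i l N.
Proof.
case=> f hf bf [l0 [v [iv z nz sp]]]; split=> //; exists (f v).
have [hg fK Kf] := hom_inv hf bf.
split; rewrite -?(hom_eact _ _ hf) -?(hom_xact _ _ hf) ?iv ?z ?linear0 //.
  by rewrite -(inj_eq (can_inj fK)) linear0 in nz *.
move=> u; have [c cE] := sp (f^-1%VF u); exists c; rewrite -[u]Kf cE linear_sum.
by apply: eq_bigr => t _; rewrite linearZ /= hom_xact.
Qed.

Lemma uni_projective i P : uniserial i n.+1 P -> projective P.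
Proof.
case=> l0 [v gv] M N g f hg hf full.
have [iv _ _ _] := gv.
have [y yE] := iffRL (limg_fullP _) full (f v).
have [|| h hh hv] := @uni_hom _ _ _ _ l0 gv M (eact i y).
- by rewrite eact_eact eqxx.
- by rewrite xact_nilp.
exists h => //; apply/lfunP=> u; apply: (uni_homE gv) => //; first exact: hom_comp.
by rewrite comp_lfunE hv hom_eact // yE -hom_eact // iv.
Qed.

(** * Minimal presentations of uniserial modules and the lifting criterion *)

Definition in_rad M (K : {vspace M}) := forall u, u \in K -> exists y, u = xact 1 y.

(** Nakayama's lemma: modulo U every u is some x y, hence by iteration some x^(n+1) y, which is
    0. *)
Lemma superfluous_rad M (K : {vspace M}) : in_rad K -> superfluous K.
Proof.
move=> rad U stU full; apply/eqP; rewrite eqEsubv subvf /=; apply/subvP=> u _.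
suff [y] : exists y, u - xact n.+1 y \in U by rewrite xact_nilp // subr0.
have step w : exists y, w - xact 1 y \in U.
  have : w \in (U + K)%VS by rewrite full memvf.
  case/memv_addP=> a aU [c cK ->]; have [y ->] := rad c cK.
  by exists y; rewrite addrK.
elim: n.+1 => [|t [y yU]]; first by exists u; rewrite xact0 subrr mem0v.
have [y' y'U] := step y; exists y'; rewrite -addn1 -xact_xact -[u](addrNK (xact t y)) -addrA.
by rewrite memvD // -[_ - _](linearB (act (x ^+ t))) stU.
Qed.

Lemma zero_module : exists Z : fdmod B, forall v : Z, v = 0.
Proof.
have st : stable (fullv : {vspace regmod B}) by move=> b v _; apply: memvf.
exists (quotmod st) => v; rewrite -(qproj_repr v).
by apply/eqP; rewrite qproj_eq0 memvf.
Qed.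

(* Surjectivity of x^l : e_i N -> e_(i+l) N, i.e. of Hom(d1, N) for the minimal
   presentation of the uniserial module of type (i, l); void for projectives. *)
Definition lifts i l N :=
  (l <= n)%N -> forall w : N, eact (i + l) w = w -> exists2 y : N, eact i y = y & xact l y = w.

Definition rad_pres M (p : min_proj_pres M) :=
  in_rad (lker (pres_d0 p)) /\ in_rad (lker (pres_d1 p)).

(** This amounts to x^n e i being nonzero, which the relations of [cyclic_gens] leave open;
    [trivext_projs] provides it. *)
Hypothesis projs : forall i, exists P : fdmod B, uniserial i n.+1 P.

Lemma uni_pres i l M : uniserial i l M ->
  exists2 p : min_proj_pres M, rad_pres p
    & forall N, extends (pres_d1 p) N <-> lifts i l N.
Proof.
move=> uM; have [l0 [v gv]] := uM; have ll := uni_len l0 gv.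
have [ln | lgt] := leqP l n; last first.
  have el : l = n.+1 by lia.
  have [Z Z0] := zero_module.
  have hz : is_hom (0 : 'Hom(Z, M)) by move=> b u; rewrite !zero_lfunE linear0.
  have pZ : projective Z.
    move=> P N g f hg hf full; exists 0; first by move=> b u; rewrite !zero_lfunE linear0.
    by apply/lfunP=> z; rewrite (Z0 z) !linear0.
  have pM : projective M by apply: (@uni_projective i); rewrite -el.
  have s0 : limg (\1%VF : 'End(M)) = fullv by apply/limg_fullP => u; exists u; rewrite id_lfunE.
  have k0 : lker (\1%VF : 'End(M)) = 0%VS.
    by apply/eqP; rewrite -subv0; apply/subvP=> u; rewrite memv_ker id_lfunE memv0.
  have ex : limg (0 : 'Hom(Z, M)) = lker (\1%VF : 'End(M)).
    rewrite k0; apply/eqP; rewrite -subv0; apply/subvP=> _ /memv_imgP[u _ ->].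
    by rewrite zero_lfunE mem0v.
  have r0 : in_rad (lker (\1%VF : 'End(M))).
    by move=> u; rewrite k0 memv0 => /eqP->; exists 0; rewrite /xact linear0.
  have r1 : in_rad (lker (0 : 'Hom(Z, M))).
    by move=> u _; exists 0; rewrite (Z0 u) /xact linear0.
  exists (MinProjPres hz (@hom_id _ _ M) pZ pM s0 ex (superfluous_rad r0) (superfluous_rad r1)).
    by split.
  move=> N; split=> [_ | _ g hg]; first by rewrite /lifts el ltnn.
  exists 0 => [b u | z]; first by rewrite !zero_lfunE linear0.
  by rewrite (Z0 z) !linear0.
have [P0 u0] := projs i; have [P1 u1] := projs (i + l).
have [_ [v0 gv0]] := u0; have [_ [v1 gv1]] := u1.
have [iv z nz sp] := gv; have [iv0 z0 nz0 sp0] := gv0; have [iv1 z1 nz1 sp1] := gv1.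
have zn N (u : N) : xact n.+1 u = 0 by apply: xact_nilp.
have [d0 hd0 d0v] := uni_hom (ltn0Sn n) gv0 iv (zn _ v).
have iw0 : eact (i + l) (xact l v0) = xact l v0 by rewrite -xact_eact iv0.
have [d1 hd1 d1v] := uni_hom (ltn0Sn n) gv1 iw0 (zn _ _).
have d1X t : d1 (xact t v1) = xact (t + l) v0 by rewrite (hom_xact _ _ hd1) d1v xact_xact.
have d0X t : d0 (xact t v0) = xact t v by rewrite (hom_xact _ _ hd0) d0v.
have s0 : limg d0 = fullv.
  apply/limg_fullP => u; have [c ->] := sp u.
  exists (\sum_(t < l) c t *: xact t v0); rewrite linear_sum.
  by apply: eq_bigr => t _; rewrite linearZ /= d0X.
have ex : limg d1 = lker d0.
  apply/eqP; rewrite eqEsubv; apply/andP; split; apply/subvP=> u.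
    case/memv_imgP=> y _ ->; rewrite memv_ker; have [c ->] := sp1 y.
    rewrite !linear_sum big1 // => t _.
    by rewrite !linearZ /= d1X d0X (xact_eq0_ge _ z) ?scaler0 ?leq_addl.
  rewrite memv_ker; have [c ->] := sp0 u; rewrite linear_sum => /eqP s.
  have c0 t : (t < l)%N -> c t = 0.
    move=> tl; apply: (uni_indep l0 gv (L := n.+1)) => //; last by lia.
    by rewrite -[RHS]s; apply: eq_bigr => r _; rewrite linearZ /= d0X.
  apply: memv_suml => t _; have [tl | lt] := ltnP t l; first by rewrite c0 // scale0r mem0v.
  by rewrite memvZ // -(subnK lt) -d1X memv_img ?memvf.
have r0 : in_rad (lker d0).
  move=> u; rewrite -ex => /memv_imgP[y _ ->]; have [c ->] := sp1 y.
  exists (\sum_(t < n.+1) c t *: xact (t + l.-1) v0); rewrite linear_sum xact_sum.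
  apply: eq_bigr => t _; rewrite linearZ /= d1X xactZ xact_xact; congr (_ *: xact _ _); lia.
have r1 : in_rad (lker d1).
  move=> u; rewrite memv_ker; have [c ->] := sp1 u; rewrite linear_sum => /eqP s.
  (* Since l <= n, the vector d1 v1 = x^l v0 is nonzero, so an element of ker d1 has no component
     along the top vector v1. *)
  have c0 : c 0%N = 0.
    have e1 : xact (n - l) (xact l v0) != 0 by rewrite xact_xact subnK.
    have e2 : xact (n - l).+1 (xact l v0) = 0 by rewrite xact_xact xact_nilp //; lia.
    apply: (xact_indep (L := n.+1) e1 e2) => //; rewrite -[RHS]s.
    by apply: eq_bigr => t _; rewrite linearZ /= d1X xact_xact.
  exists (\sum_(t < n) c t.+1 *: xact t v1).
  rewrite big_ord_recl c0 scale0r add0r xact_sum; apply: eq_bigr => t _.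
  by rewrite xactZ xact_xact.
have p1 := uni_projective u1; have p0 := uni_projective u0.
exists (MinProjPres hd1 hd0 p1 p0 s0 ex (superfluous_rad r0) (superfluous_rad r1)).
  by split.
move=> N; split=> [ext _ w iw | lft g hg] /=.
  have [g hg gv'] := uni_hom (ltn0Sn n) gv1 iw (zn _ w).
  have [h hh hE] := ext g hg; exists (h v0); first by rewrite -(hom_eact _ _ hh) iv0.
  by rewrite -(hom_xact _ _ hh) -d1v hE.
have [|y iy ly] := lft ln (g v1); first by rewrite -(hom_eact _ _ hg) iv1.
have [h hh hv] := uni_hom (ltn0Sn n) gv0 iy (zn _ y).
exists h => // u; rewrite -comp_lfunE; apply: (uni_homE gv1) => //; first exact: hom_comp.
by rewrite comp_lfunE d1v (hom_xact _ _ hh) hv.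
Qed.

Lemma xact_dsum M N t (u : dsum M N) : xact t u = (xact t u.1, xact t u.2).
Proof. by []. Qed.
Lemma eact_dsum M N a (u : dsum M N) : eact a u = (eact a u.1, eact a u.2).
Proof. by []. Qed.

Lemma lker_dmap M N P Q (f : 'Hom(M, P)) (g : 'Hom(N, Q)) u :
  (u \in lker (dmap f g)) = (u.1 \in lker f) && (u.2 \in lker g).
Proof.
rewrite !memv_ker dmapE; apply/eqP/andP => [[-> ->] | [/eqP-> /eqP->]] //.
Qed.

Lemma in_rad_dmap M N P Q (f : 'Hom(M, P)) (g : 'Hom(N, Q)) :
  in_rad (lker f) -> in_rad (lker g) -> in_rad (lker (dmap f g)).
Proof.
move=> rf rg u; rewrite lker_dmap => /andP[/rf[y1 e1] /rg[y2 e2]].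
by exists (y1, y2); rewrite xact_dsum -e1 -e2 -surjective_pairing.
Qed.

Lemma dsum_pres M N (p : min_proj_pres M) (q : min_proj_pres N) :
    rad_pres p -> rad_pres q ->
  exists2 r : min_proj_pres (dsum M N), rad_pres r
    & forall Q, extends (pres_d1 r) Q <->
                extends (pres_d1 p) Q /\ extends (pres_d1 q) Q.
Proof.
case=> rp0 rp1 [rq0 rq1].
have h1 := dmap_hom (pres_d1_hom p) (pres_d1_hom q).
have h0 := dmap_hom (pres_d0_hom p) (pres_d0_hom q).
have P1 := dsum_projective (pres_P1_projective p) (pres_P1_projective q).
have P0 := dsum_projective (pres_P0_projective p) (pres_P0_projective q).
have s0 : limg (dmap (pres_d0 p) (pres_d0 q)) = fullv.
  apply/limg_fullP => -[y z].
  have [y' yE] := iffRL (limg_fullP _) (pres_d0_surj p) y.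
  have [z' zE] := iffRL (limg_fullP _) (pres_d0_surj q) z.
  by exists (y', z'); rewrite dmapE /= yE zE.
have ex : limg (dmap (pres_d1 p) (pres_d1 q)) = lker (dmap (pres_d0 p) (pres_d0 q)).
  apply/vspaceP=> u; rewrite lker_dmap -!pres_d1_exact.
  apply/memv_imgP/andP => [[w _ ->] | [/memv_imgP[y _ ey] /memv_imgP[z _ ez]]].
    by rewrite dmapE !memv_img ?memvf.
  by exists (y, z); rewrite ?memvf // dmapE -ey -ez -surjective_pairing.
have r0 := in_rad_dmap rp0 rq0; have r1 := in_rad_dmap rp1 rq1.
exists (MinProjPres h1 h0 P1 P0 s0 ex (superfluous_rad r0) (superfluous_rad r1)); first by split.
move=> Q; split=> [ext | [ep eq] g hg] /=.
  split=> g hg.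
    have [h hh hE] := ext _ (hom_comp hg (@dfst_hom _ _ _ _)).
    exists (h \o dinl _ _)%VF; first exact: hom_comp (@dinl_hom _ _ _ _).
    move=> u; rewrite comp_lfunE dinlE.
    by have := hE (u, 0); rewrite dmapE /= linear0 comp_lfunE dfstE.
  have [h hh hE] := ext _ (hom_comp hg (@dsnd_hom _ _ _ _)).
  exists (h \o dinr _ _)%VF; first exact: hom_comp (@dinr_hom _ _ _ _).
  move=> u; rewrite comp_lfunE dinrE.
  by have := hE (0, u); rewrite dmapE /= linear0 comp_lfunE dsndE.
have [h hh hE] := ep _ (hom_comp hg (@dinl_hom _ _ _ _)).
have [h' hh' hE'] := eq _ (hom_comp hg (@dinr_hom _ _ _ _)).
exists (dcopair h h'); first exact: dcopair_hom.
by move=> u; rewrite dcopairE dmapE hE hE' !comp_lfunE -linearD -dsum_decomp.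
Qed.

Lemma lifts_dsum i l M N : lifts i l (dsum M N) <-> lifts i l M /\ lifts i l N.
Proof.
split=> [lft | [lM lN] ln [u w]].
  split=> ln w iw.
    have [|[y z]] := lft ln (w, 0); first by rewrite eact_dsum iw /= /eact linear0.
    by rewrite xact_dsum eact_dsum /= => -[iy _] [ly _]; exists y.
  have [|[y z]] := lft ln (0, w); first by rewrite eact_dsum iw /= /eact linear0.
  by rewrite xact_dsum eact_dsum /= => -[_ iz] [_ lz]; exists z.
rewrite eact_dsum /= => -[iu iw].
have [y iy ly] := lM ln u iu; have [z iz lz] := lN ln w iw.
by exists (y, z); rewrite ?eact_dsum ?xact_dsum /=; congr pair.
Qed.

(** The vectors x^t v with j + t = i + l mod n form a basis of e_(i+l) N, and such a vector lies in
    x^l N exactly when t >= l. An obstruction is thus an index t below both l and l'. *)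
Lemma uni_lifts i l j l' N : uniserial j l' N -> lifts i l N <->
  ((l <= n)%N -> forall t, (t < l)%N -> (t < l')%N -> j + t <> i + l %[mod n]).
Proof.
case=> l'0 [v gv]; have [jv z nz sp] := gv; split=> [lft ln t tl tl' jt | no ln w].
  have [|y _] := lft ln (xact t v); first by rewrite (eact_xact _ _ jv) jt eqxx.
  (* After this power of x the vector x^t v becomes the nonzero x^(l'-1) v, whereas every term of
     x^l y is killed because t < l. *)
  have [c ->] := sp y; rewrite xact_sum => /(congr1 (xact (l'.-1 - t))).
  rewrite xact_xact subnK; last by lia.
  rewrite xact_sum big1 => [/esym/eqP | s _]; first by rewrite (negPf nz).
  rewrite !xactZ !xact_xact. by rewrite (xact_eq0_ge _ z) ?scaler0 //; lia.
move=> iw; have [c cE] := sp w.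
(* For the indices of this sum [no] excludes t < l, so that t - l is a genuine difference. *)
pose y := \sum_(t < l' | j + t == i + l %[mod n]) c t *: xact (t - l) v.
have ly : xact l y = w.
  rewrite -[RHS]iw cE eact_sum xact_sum big_mkcond; apply: eq_bigr => t _.
  rewrite eactZ (eact_xact _ _ jv) eq_sym; case: eqP => [jt | _]; last by rewrite scaler0.
  rewrite xactZ xact_xact subnKC // leqNgt; apply/negP => tl.
  exact: (no ln t tl (ltn_ord t) (esym jt)).
exists (eact i y); first by rewrite eact_eact eqxx.
by rewrite xact_eact ly iw.
Qed.

(* The condition of [lifts i l] on the uniserial module of type (j, l'). *)
Definition no_overlap i l j l' :=
  (l <= n)%N -> forall t, (t < l)%N -> (t < l')%N -> j + t <> i + l %[mod n].

Lemma tau_rigid_uni i l M : uniserial i l M -> tau_rigid M <-> no_overlap i l i l.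
Proof.
move=> uM; have [p rp pE] := uni_pres uM.
rewrite (tau_rigid_extends p) pE; exact: uni_lifts.
Qed.

Lemma tau_rigid_uni2 i l j l' M N : uniserial i l M -> uniserial j l' N ->
  tau_rigid (dsum M N) <->
  (no_overlap i l i l /\ no_overlap i l j l') /\ (no_overlap j l' i l /\ no_overlap j l' j l').
Proof.
move=> uM uN; have [p rp pE] := uni_pres uM; have [q rq qE] := uni_pres uN.
have [r _ rE] := dsum_pres rp rq.
rewrite (tau_rigid_extends r) rE pE qE !lifts_dsum.
by rewrite !(uni_lifts _ _ uM) !(uni_lifts _ _ uN).
Qed.

(** * Indecomposable modules are the uniserial ones *)

(** A homomorphism that does not kill the socle vector x^(l-1) v is injective. In U (+) V this
    vector has a nonzero component, so the corresponding summand already has dimension at least l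
    and the other one is 0. *)
Lemma uni_indecomposable i l M : uniserial i l M -> indecomposable M.
Proof.
case=> l0 [v gv]; have dM := uni_dim l0 gv; split; first by rewrite dM; lia.
move=> U V iso; have dUV := mod_iso_dim iso; rewrite dim_dsum dM in dUV.
have [f hf bf] := iso; have [_ z nz _] := gv.
have big Q (g : 'Hom(M, Q)) : is_hom g -> g (xact l.-1 v) != 0 -> (l <= \dim {:Q})%N.
  move=> hg gnz; rewrite -dM; have k0 : lker g == 0%VS.
    rewrite -subv0; apply/subvP=> u; rewrite memv_ker memv0 => /eqP gu.
    have [_ _ _ sp] := gv; have [c uE] := sp u; rewrite uE big1 // => t _.
    have e1 : xact l.-1 (g v) != 0 by rewrite -(hom_xact _ _ hg).
    have e2 : xact l.-1.+1 (g v) = 0 by rewrite -(hom_xact _ _ hg) prednK // z linear0.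
    rewrite (xact_indep (L := l) (c := c) e1 e2) ?scale0r //; last by have := ltn_ord t; lia.
    rewrite -[RHS]gu uE linear_sum; apply: eq_bigr => s _.
    by rewrite linearZ /= (hom_xact _ _ hg).
  by rewrite -(limg_ker_dim g fullv) (eqP k0) capv0 dimv0 add0n dimvS ?subvf.
have fnz : f (xact l.-1 v) != 0.
  by apply: contra nz => /eqP f0; rewrite -(inj_eq (bij_inj bf)) f0 linear0.
have [e1 | n1] := eqVneq (f (xact l.-1 v)).1 0.
  left; have := big V (dsnd U V \o f)%VF (hom_comp (@dsnd_hom _ _ _ _) hf).
  rewrite comp_lfunE dsndE => /(_ _) le; suff : (l <= \dim {:V})%N by lia.
  apply: le; apply: contra fnz => /eqP e2.
  by rewrite [f _]surjective_pairing e1 e2.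
right; have := big U (dfst U V \o f)%VF (hom_comp (@dfst_hom _ _ _ _) hf).
by rewrite comp_lfunE dfstE => /(_ n1); lia.
Qed.

Lemma dim0_eq0 (V : vectType k) (u : V) : \dim {:V} = 0%N -> u = 0.
Proof.
by move=> /eqP; rewrite dimv_eq0 => /eqP V0; apply/eqP; rewrite -memv0 -V0 memvf.
Qed.

Lemma dim_quot (V : vectType k) (U : {vspace V}) :
  (\dim U + \dim {:quotv U})%N = \dim {:V}.
Proof. by rewrite -(limg_ker_dim (qproj U) fullv) capfv lker_qproj qproj_surj. Qed.

(** Converts an internal decomposition into the external one of [indecomposable], with the quotients
    M / C and M / W as summands: the map of M to their sum is injective as C and W meet in 0, and
    bijective by dimension. *)
Lemma indecomposable_split M (C W : {vspace M}) : stable C -> stable W ->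
    (C :&: W = 0)%VS -> (\dim {:M} <= \dim C + \dim W)%N -> indecomposable M ->
  (forall u, u \in C) \/ (forall u, u \in W).
Proof.
move=> sC sW cap le [_ ind].
pose g : 'Hom(M, dsum (quotmod sC) (quotmod sW)) :=
  (dinl (quotmod sC) (quotmod sW) \o qproj C)%VF
  + (dinr (quotmod sC) (quotmod sW) \o qproj W)%VF.
have hg : is_hom g.
  apply: hom_add; apply: hom_comp; try exact: qproj_hom.
    exact: dinl_hom.
  exact: dinr_hom.
have gE u : g u = (qproj C u, qproj W u).
  rewrite add_lfunE !comp_lfunE dinlE dinrE.
  by congr pair; rewrite /= ?addr0 ?add0r.
have iso : mod_iso M (dsum (quotmod sC) (quotmod sW)).
  exists g => //; apply: bij_inj_dim.
    apply/lker0P; rewrite -subv0 -cap; apply/subvP=> u; rewrite memv_ker gE.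
    by move=> /eqP[c0 w0]; rewrite memv_cap -!qproj_eq0 c0 w0 !eqxx.
  have dC : (\dim C + \dim {:quotmod sC})%N = \dim {:M} := dim_quot C.
  have dW : (\dim W + \dim {:quotmod sW})%N = \dim {:M} := dim_quot W.
  by rewrite dim_dsum; lia.
case: (ind _ _ iso) => d0; [left | right] => u.
  by rewrite -qproj_eq0; apply/eqP; apply: (dim0_eq0 _ d0).
by rewrite -qproj_eq0; apply/eqP; apply: (dim0_eq0 _ d0).
Qed.

(* Let x^l M = 0 and x^(l-1) v <> 0 with v = e_i v, and let phi be a functional which
   factors through e_(i+l-1) and maps x^(l-1) v to 1.  Then
     rho u = \sum_s phi (x^(l-1-s) u) x^s v
   is an endomorphism of M with values in the submodule W generated by v.  It is
   injective on W, so that M is the direct sum of ker rho and W. *)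
Lemma indecomposable_uni M : indecomposable M ->
  exists i l, (1 <= i <= n)%N /\ uniserial i l M.
Proof.
move=> indM; have [dM _] := indM.
have [u0 u0nz] : exists u : M, u != 0.
  have [] := boolP (vpick {:M} == 0); last by move=> ?; exists (vpick {:M}).
  by rewrite vpick0 -dimv_eq0 => /eqP.
have exl : exists l, [forall t : 'I_(\dim {:M}), xact l ((vbasis {:M})`_t) == 0].
  by exists n.+1; apply/forallP=> t; rewrite xact_nilp.
have kill l : [forall t : 'I_(\dim {:M}), xact l ((vbasis {:M})`_t) == 0] -> forall u : M, xact l u = 0.
  move=> /forallP l0 u; rewrite [u](coord_vbasis (memvf u)) xact_sum big1 // => t _.
  by rewrite xactZ (eqP (l0 t)) scaler0.
case: (ex_minnP exl) => l /kill Xl lmin.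
have l0 : (0 < l)%N.
  by rewrite lt0n; apply: contraNneq u0nz => e0; rewrite -[u0]xact0 -e0 Xl.
have [v0 v0nz] : exists v0 : M, xact l.-1 v0 != 0.
  have : ~~ [forall t : 'I_(\dim {:M}), xact l.-1 ((vbasis {:M})`_t) == 0].
    by apply/negP => /lmin; lia.
  by rewrite negb_forall => /existsP[t nz]; exists (vbasis {:M})`_t.
have [i /andP[i1 i2] nz] : exists2 i, (1 <= i < n.+1)%N & xact l.-1 (eact i v0) != 0.
  have [/hasP[i] | /hasPn none] := boolP (has (fun i => xact l.-1 (eact i v0) != 0) (index_iota 1 n.+1)).
    by rewrite mem_index_iota => ? ?; exists i.
  case/eqP: v0nz; rewrite [v0]eact_decomp xact_sum big_seq big1 // => i /none.
  by rewrite negbK => /eqP.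
exists i, l; split; first by rewrite i1.
set v := eact i v0 in nz; have iv : eact i v = v by rewrite eact_eact eqxx.
have [phi0 phi01] := functional_neq0 nz.
pose phi (u : M) : k^o := phi0 (eact (i + l.-1) u).
have phiL : linear phi by move=> c y z; rewrite /phi /eact !linearP.
have phiZ d u : phi (d *: u) = d * phi u by rewrite /phi eactZ linearZ.
have phi1 : phi (xact l.-1 v) = 1 by rewrite /phi (eact_xact _ _ iv) eqxx.
have phiE a u : phi (eact a u) = if a == i + l.-1 %[mod n] then phi u else 0.
  by rewrite /phi eact_eact eq_sym; case: ifP => // _; rewrite linear0.
pose rho0 u := \sum_(s < l) phi (xact (l.-1 - s) u) *: xact s v.
have rhoL : linear rho0.
  move=> c y z; rewrite /rho0 scaler_sumr -big_split /=; apply: eq_bigr => s _.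
  by rewrite /xact linearP phiL scalerDl -scalerA.
pose rho : 'End(M) := linfun rho0; have rhoE u : rho u = rho0 u by rewrite linfunE.
have phi00 : phi 0 = 0 by rewrite /phi /eact !linear0.
have hrho : is_hom rho.
  apply: hom_gens => [a u | u]; rewrite !rhoE /rho0 ?eact_sum ?xact_sum.
    apply: eq_bigr => s _; rewrite xact_eact phiE eactZ (eact_xact _ _ iv).
    have -> : (a + (l.-1 - s) == i + l.-1 %[mod n]) = (a == i + s %[mod n]).
      by rewrite -(eqn_modDr (l.-1 - s) a) -addnA subnKC //; have := ltn_ord s; lia.
    by case: ifP; rewrite ?scale0r ?scaler0.
  (* The sums for rho (x u) and x rho u differ by a shift of s. The two boundary terms vanish, one
     by x^l u = 0 and the other by x^l v = 0. *)
  case: (l) l0 Xl => // l' _ Xl; rewrite big_ord_recl big_ord_recr /=.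
  rewrite xact_xact subn0 addn1 Xl phi00 scale0r add0r xactZ xact_xact add1n Xl scaler0 addr0.
  apply: eq_bigr => s _; rewrite xactZ !xact_xact /bump /= !add1n addn1; congr (phi (xact _ _) *: _).
  by have := ltn_ord s; lia.
pose W : {vspace M} := (\sum_(s < l) <[xact s v]>)%VS.
have XW t : xact t v \in W.
  have [tl | lt] := ltnP t l; last by rewrite (xact_eq0_ge lt) ?mem0v.
  exact: (subvP (sumv_sup (Ordinal tl) isT (subvv _))) (memv_line _).
have WP u : u \in W -> exists c : nat -> k, u = \sum_(s < l) c s *: xact s v.
  case/memv_sumP=> w wW ->; pose c s := if insub s is Some r then
    coord [tuple xact (r : 'I_l) v] ord0 (w r) else 0.
  exists c; apply: eq_bigr => s _; rewrite /c valK.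
  have /vlineP[d dE] := wW s isT.
  have Xs : xact s v != 0.
    by apply: contra nz => /eqP z; apply/eqP; apply: xact_eq0_ge z; have := ltn_ord s; lia.
  by rewrite dE linearZ /= (coord_free ord0 ord0 (X := [tuple xact s v])) ?seq1_free // mulr1.
have sW : stable W.
  by apply: stable_gens => [a u | u] /WP[c ->]; rewrite ?eact_sum ?xact_sum;
    apply: memv_suml => s _; rewrite ?eactZ ?xactZ ?xact_xact ?(eact_xact _ _ iv) memvZ //; case: ifP; rewrite ?mem0v.
have := indecomposable_split (lker_stable hrho) sW _ _ indM; case.
- apply/eqP; rewrite -subv0; apply/subvP=> u; rewrite memv_cap memv_ker memv0.
  case/andP=> /eqP r0 /WP[c uE]; rewrite rhoE in r0.
  have zl : xact l.-1.+1 v = 0 by rewrite prednK // Xl.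
  (* As rho u = 0, independence of the x^s v kills every phi (x^r u). In terms of the coefficients c
     of u these values form a unitriangular system, because phi (x^(l-1) v) = 1, hence c = 0. *)
  have phi0' r : (r < l)%N -> phi (xact r u) = 0.
    move=> rl; pose c' s := phi (xact (l.-1 - s) u).
    have := xact_indep (c := c') (t := l.-1 - r) nz zl r0; rewrite /c' subKn; last by lia.
    by apply; lia.
  have c0 t : (t < l)%N -> c t = 0.
    elim/ltn_ind: t => t IH tl; rewrite -[RHS](phi0' (l.-1 - t)%N); last by lia.
    rewrite uE xact_sum (bigD1 (Ordinal tl)) //= xactZ xact_xact subnK; last by lia.
    rewrite big1 ?addr0.
      by rewrite phiZ phi1 mulr1.
    move=> s ns; have [st | ts] := ltnP s t; first by rewrite IH ?scale0r ?[LHS]linear0 //; lia.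
    rewrite xactZ xact_xact (xact_eq0_ge (s := l)) ?scaler0 //.
    by have : s != t :> nat by []; have := ltn_ord s; lia.
  by rewrite uE big1 // => t _; rewrite c0 // scale0r.
- rewrite -(limg_ker_dim rho fullv) capfv leq_add2l dimvS //.
  apply/subvP=> _ /memv_imgP[u _ ->]; rewrite rhoE; apply: memv_suml => s _.
  exact: memvZ.
- move=> inC; have := inC v; rewrite memv_ker rhoE => /eqP r0.
  have zl : xact l.-1.+1 v = 0 by rewrite prednK // Xl.
  have := xact_indep (c := fun s => phi (xact (l.-1 - s) v)) (t := 0) nz zl r0 isT l0.
  by rewrite subn0 phi1 => /eqP; rewrite oner_eq0.
by move=> inW; split=> //; exists v; split=> // u; apply: WP.
Qed.

(** * Ranks of paths as isomorphism invariants *)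

Definition wrank M h t := \dim (limg (actf M (x ^+ t * e h))).

Lemma wrankE M h t (u : M) : actf M (x ^+ t * e h) u = xact t (eact h u).
Proof. by rewrite actfE actM. Qed.

Lemma wrank_iso M N h t : mod_iso M N -> wrank M h t = wrank N h t.
Proof.
suff le P Q : mod_iso P Q -> (wrank P h t <= wrank Q h t)%N.
  by move=> iso; apply/eqP; rewrite eqn_leq !le //; apply: mod_iso_sym.
case=> f hf bf; have k0 : lker f == 0%VS by apply/lker0P/bij_inj.
rewrite /wrank -(@limg_dim_eq _ _ _ f (limg (actf P (x ^+ t * e h)))).
  apply: dimvS; apply/subvP=> _ /memv_imgP[_ /memv_imgP[u _ ->] ->].
  by rewrite actfE hf -actfE memv_img ?memvf.
by rewrite (eqP k0) capv0.
Qed.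

Lemma wrank_dsum M N h t : wrank (dsum M N) h t = (wrank M h t + wrank N h t)%N.
Proof.
rewrite /wrank; set b := x ^+ t * e h.
have kl : lker (dinl M N) == 0%VS by apply/lker0P=> u w; rewrite !dinlE => -[].
have kr : lker (dinr M N) == 0%VS by apply/lker0P=> u w; rewrite !dinrE => -[].
rewrite -(@limg_dim_eq _ _ _ (dinl M N) (limg (actf M b))) ?(eqP kl) ?capv0 //.
rewrite -(@limg_dim_eq _ _ _ (dinr M N) (limg (actf N b))) ?(eqP kr) ?capv0 //.
rewrite -dimv_disjoint_sum.
  congr (\dim _); apply/vspaceP=> u; apply/memv_imgP/memv_addP.
    case=> -[y z] _ ->; rewrite actfE act_dsum.
    exists (dinl M N (act b y)); first by rewrite memv_img // -actfE memv_img ?memvf.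
    exists (dinr M N (act b z)); first by rewrite memv_img // -actfE memv_img ?memvf.
    exact: dsum_decomp.
  case=> _ /memv_imgP[_ /memv_imgP[y _ ->] ->] [_ /memv_imgP[_ /memv_imgP[z _ ->] ->] ->].
  exists (y, z); rewrite ?memvf // [RHS]actfE act_dsum !actfE.
  by rewrite [RHS]dsum_decomp.
apply/eqP; rewrite -subv0; apply/subvP=> u; rewrite memv_cap memv0.
case/andP=> /memv_imgP[y _ ->] /memv_imgP[z _]; rewrite dinlE dinrE.
by case=> -> _; apply/eqP.
Qed.

Lemma vline_coord (V : vectType k) (u v : V) :
  v != 0 -> u \in <[v]>%VS -> coord [tuple v] ord0 u *: v = u.
Proof.
move=> nz /vlineP[d ->]; rewrite linearZ /=.
by rewrite (coord_free ord0 ord0 (X := [tuple v])) ?seq1_free // mulr1.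
Qed.

(** The image is spanned by the x^(s+t) v for which x^s v sits at vertex h and survives x^t; these
    are independent, so the rank counts them. *)
Lemma wrank_uni i l M h t : uniserial i l M ->
  wrank M h t = (\sum_(s < l) ((i + s == h %[mod n]) && (s + t < l)))%N.
Proof.
case=> l0 [v gv]; have [iv z nz sp] := gv.
have XEX s : xact t (eact h (xact s v)) = if i + s == h %[mod n] then xact (s + t) v else 0.
  by rewrite (eact_xact _ _ iv) eq_sym; case: ifP => _; [rewrite xact_xact addnC | rewrite /xact linear0].
pose p (s : 'I_l) := (i + s == h %[mod n]) && (s + t < l)%N.
have -> : wrank M h t = \dim (\sum_(s < l | p s) <[xact (s + t) v]>)%VS.
  congr (\dim _); apply/eqP; rewrite eqEsubv; apply/andP; split; apply/subvP=> u.
    case/memv_imgP=> y _ ->; have [c ->] := sp y; rewrite wrankE eact_sum xact_sum.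
    apply: memv_suml => s _; rewrite eactZ xactZ XEX; apply: memvZ.
    case: ifP => [ish | _]; last exact: mem0v.
    have [lt | ge] := ltnP (s + t) l; last by rewrite (xact_eq0_ge ge) ?mem0v.
    by apply: (subvP (sumv_sup s _ (subvv _))) (memv_line _); rewrite /p ish.
  case/memv_sumP=> w wW ->; apply: memv_suml => s ps.
  have /vlineP[d ->] := wW s ps; apply/memvZ/memv_imgP; exists (xact s v); first exact: memvf.
  by rewrite wrankE XEX; case/andP: ps => ->.
have dir : directv (\sum_(s < l | p s) <[xact (s + t) v]>)%VS.
  apply/directv_sum_independent => w wW w0 s ps.
  have nz' r : (r + t < l)%N -> xact (r + t) v != 0.
    by move=> lt; apply: contra nz => /eqP z'; apply/eqP; apply: xact_eq0_ge z'; lia.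
  pose c (r : nat) := if insub r is Some q then
    if p q then coord [tuple xact (q + t) v] ord0 (w q) else 0 else 0.
  have wE q : p q -> w q = c q *: xact (q + t) v.
    by move=> pq; rewrite /c valK pq vline_coord ?wW ?nz' //; case/andP: pq.
  have lt : (s + t < l)%N by case/andP: ps.
  have e1 : xact (l.-1 - t) (xact t v) != 0 by rewrite xact_xact subnK //; lia.
  have e2 : xact (l.-1 - t).+1 (xact t v) = 0 by rewrite xact_xact (xact_eq0_ge _ z) //; lia.
  have s0 : \sum_(r < l) c r *: xact r (xact t v) = 0.
    rewrite -[RHS]w0 [RHS]big_mkcond; apply: eq_bigr => r _; rewrite xact_xact.
    case: ifP => [pr | npr]; first by rewrite wE.
    by rewrite /c valK npr scale0r.
  by rewrite wE // (xact_indep e1 e2 s0) ?scale0r //; lia.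
have /directvP -> := dir; rewrite [LHS]big_mkcond; apply: eq_bigr => s _.
rewrite -/(p s); case ps: (p s) => //.
rewrite /=; have [/eqP|] := boolP (xact (s + t) v == 0); last by rewrite dim_vline => ->.
case/andP: ps => _ lt z'; case/eqP: nz; apply: xact_eq0_ge z'; lia.
Qed.

(* The recursion drops the basis vectors x^s v with s > 0, so that the numbers
   [wrank M h t] determine the tops and lengths of the uniserial summands of M. *)
Lemma wrank_uniS i l M h t : uniserial i l M ->
  wrank M h.+1 t = (((i == h.+1 %[mod n]) && (t < l)) + wrank M h t.+1)%N.
Proof.
move=> uM; rewrite !(wrank_uni _ _ uM); case: uM => l0 _.
case: l l0 => // l _; rewrite big_ord_recl addn0 add0n big_ord_recr /=.
rewrite [in RHS](_ : (l + t.+1 < l.+1)%N = false) ?andbF ?addn0; last by lia.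
congr (_ + _)%N; apply: eq_bigr => s _; rewrite /bump /= add1n addnS addSn addnS.
by rewrite -(addn1 (i + s)) -(addn1 h) eqn_modDr.
Qed.

(** By [wrank_uniS] the difference of the ranks at (h + 1, t) and (h, t + 1) counts the summands
    with top h + 1 and length above t ([key]). Differences in t count those of an exact type
    ([cnt]), so both sides have the same multiset of types. *)
Lemma uni_iso_sum i1 l1 i2 l2 j1 r1 j2 r2 M1 M2 N1 N2 :
    uniserial i1 l1 M1 -> uniserial i2 l2 M2 -> uniserial j1 r1 N1 -> uniserial j2 r2 N2 ->
    (1 <= i1 <= n)%N -> (1 <= i2 <= n)%N -> (1 <= j1 <= n)%N -> (1 <= j2 <= n)%N ->
    mod_iso (dsum M1 M2) (dsum N1 N2) ->
  (i1, l1) = (j1, r1) /\ (i2, l2) = (j2, r2) \/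
  (i1, l1) = (j2, r2) /\ (i2, l2) = (j1, r1).
Proof.
move=> u1 u2 w1 w2 i1n i2n j1n j2n iso.
have mn a b : (1 <= a <= n)%N -> (1 <= b <= n)%N -> (a == b %[mod n]) = (a == b).
  move=> an bn; apply/eqP/eqP => [|-> //].
  have [->|na] := eqVneq a n; have [->|nb] := eqVneq b n => //;
    rewrite ?modnn ?modn_small //; lia.
have key h t : (1 <= h <= n)%N ->
    ((i1 == h) && (t < l1) + ((i2 == h) && (t < l2)) =
     (j1 == h) && (t < r1) + ((j2 == h) && (t < r2)))%N.
  case: h => // h hn; have := wrank_iso h.+1 t iso; have := wrank_iso h t.+1 iso.
  rewrite !wrank_dsum (wrank_uniS _ _ u1) (wrank_uniS _ _ u2) (wrank_uniS _ _ w1).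
  rewrite (wrank_uniS _ _ w2) !mn //; lia.
have split (i l h t : nat) : (0 < t)%N -> ((i == h) && (t.-1 < l) =
    ((i == h) && (t < l)) + ((i, l) == (h, t)) :> nat)%N.
  by rewrite xpair_eqE; case: (i == h) => //=; lia.
have cnt (u : nat * nat) : (1 <= u.1 <= n)%N -> (0 < u.2)%N ->
    (((i1, l1) == u) + ((i2, l2) == u) = ((j1, r1) == u) + ((j2, r2) == u))%N.
  case: u => h t hn t0; have := key h t hn; have := key h t.-1 hn.
  rewrite !split // => kt1 kt; move: kt1; rewrite addnACA [RHS]addnACA kt; exact: addnI.
have [l10 _] := u1; have [l20 _] := u2; have [r10 _] := w1; have [r20 _] := w2.
have := cnt (i1, l1) i1n l10; rewrite eqxx.
have [e1 _ | _] := eqVneq (j1, r1) (i1, l1).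
  have := cnt (i2, l2) i2n l20; rewrite e1 eqxx => eq2; left; split=> //.
  by have : (j2, r2) == (i2, l2) by [lia]; move/eqP.
have [e1 _ | _] := eqVneq (j2, r2) (i1, l1); last by lia.
have := cnt (i2, l2) i2n l20; rewrite e1 eqxx => eq2; right; split=> //.
by have : (j1, r1) == (i2, l2) by [lia]; move/eqP.
Qed.

Lemma uni_iso_eq i l j r M N : uniserial i l M -> uniserial j r N ->
  (1 <= i <= n)%N -> (1 <= j <= n)%N -> mod_iso M N -> (i, l) = (j, r).
Proof.
move=> uM uN iN jN iso.
(* Applied to the doubles of M and N, either matching gives the claim. *)
by have := uni_iso_sum uM uM uN uN iN iN jN jN (dsum_iso iso iso); case=> -[].
Qed.

End Uniserial.

(** Concerns the underlying vector space alone, which the T(A)-modules [lowmod] share with the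
    direct sum over A. *)
Lemma dsum_span (k : fieldType) (B : falgType k) (Y Z : fdmod B) (p : Y) (q : Z)
    (r s : nat) (c : nat -> k) (d : nat -> k) (y : nat -> Y) (z : nat -> Z) :
    p = \sum_(t < r) c t *: y t -> q = \sum_(t < s) d t *: z t ->
  (p, q) = \sum_(t < r) c t *: ((y t, 0) : dsum Y Z)
         + \sum_(t < s) d t *: ((0, z t) : dsum Y Z).
Proof.
move=> -> ->; rewrite [LHS](dsum_decomp (M := Y) (N := Z)) !linear_sum.
by congr (_ + _); apply: eq_bigr => t _; rewrite linearZ /= ?dinlE ?dinrE.
Qed.

(** * The modules X, R, L and Omega *)

Section FamilyModules.
Variables (k : fieldType) (m : nat).
Local Notation n := m.+1.
Local Notation A := (pathalg k m).
Local Notation T := (trivext A).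
Local Notation DA := 'Hom(A, k^o).
Local Notation npath := (npath k m).
Local Notation ndual := (ndual k m).

Lemma trivext_gens : cyclic_gens n (@idem k m) (gen k m).
Proof.
split.
- exact: idemM.
- by move=> a b; apply: idem_eq.
- exact: gen_pow_idem.
- exact: sum_idem.
- exact: gen_nilp.
exact: trivext_ind.
Qed.

Definition Tuniserial := @uniserial k T (@idem k m) (gen k m).

Lemma xact_gen (M : fdmod T) a t (v : M) :
  act (idem k m a) v = v -> xact (gen k m) t v = act (gen k m ^+ t * idem k m a) v.
Proof. by move=> av; rewrite actM av. Qed.

Section Basis.
Variables a b : nat.
Local Notation I := (intmod k m a b).

Definition dvec r : I := [ffun j : invertex m a b => (val j == r :> nat)%:R].

Lemma dvec_out r : (b <= r)%N -> dvec r = 0.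
Proof.
move=> br; apply/ffunP=> j; rewrite !ffunE; have /andP[_ jb] := valP j.
by rewrite (_ : (val j == r :> nat) = false) //; lia.
Qed.

Lemma dvec_path s r : (a <= s.+1 <= b)%N -> (s <= r)%N -> (s < n)%N ->
  act (npath s r) (dvec s) = dvec r.
Proof.
move=> sab sr sn; apply/ffunP=> j; rewrite !ffunE.
have sub : (a <= (Ordinal sn).+1 <= b)%N by [].
rewrite (bigD1 (exist _ (Ordinal sn) sub : invertex m a b)) //= big1 ?addr0.
  by rewrite ffunE /= eqxx mulr1 -ncoef_ord ncoef_npath //= eqxx.
move=> i ni; rewrite ffunE (_ : (val i == s :> nat) = false) ?mulr0 //.
by apply: contraNF ni => /eqP e; apply/eqP/val_inj/val_inj.
Qed.

Lemma dvec_neq0 r : (a <= r.+1 <= b)%N -> (r < n)%N -> dvec r != 0.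
Proof.
move=> rab rn; apply/eqP => /ffunP/(_ (exist _ (Ordinal rn) rab)).
by rewrite !ffunE /= eqxx => /eqP; rewrite oner_eq0.
Qed.

Lemma dvec_sum (v : I) : (1 <= a)%N -> (a <= b <= n)%N ->
  exists c : nat -> k, v = \sum_(t < b - a + 1) c t *: dvec (a.-1 + t).
Proof.
move=> a1 /andP[ab bn].
pose c t := if insub (inord (a.-1 + t) : 'I_m.+1) is Some j then v j else 0.
exists c; apply/ffunP=> j; rewrite sum_ffunE; have /andP[aj jb] := valP j.
have lt : (val j - a.-1 < b - a + 1)%N by lia.
have jE : (a.-1 + (val j - a.-1) = val j)%N by rewrite subnKC //; lia.
rewrite (bigD1 (Ordinal lt)) //= big1 ?addr0.
  rewrite !ffunE [xact in c xact]/= /c jE inord_val valK eqxx.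
  by rewrite -[_ *: _]/(_ * _) mulr1.
move=> t nt; rewrite !ffunE (_ : (val j == a.-1 + t :> nat)%N = false) ?scaler0 //.
by apply: contraNF nt => /eqP e; apply/eqP/val_inj; rewrite /= -[sval j]/(val j) e addKn.
Qed.
End Basis.

Lemma act_Zmod (Y : fdmod A) (t : T) (v : Zmod Y) : act t v = act t.1 (v : Y).
Proof. by rewrite /= zero_lfunE addr0. Qed.

(** Covers X and R together. On Z the ideal D(A) acts as 0, so x moves along the interval. It ends
    because the next basis vector is missing if b < n, and because the next power of x falls into
    D(A) if b = n. *)
Lemma Zmod_uni a b : (1 <= a)%N -> (a <= b <= n)%N ->
  Tuniserial a (b - a + 1) (Zmod (intmod k m a b)).
Proof.
move=> a1 abn; have /andP[ab bn] := abn; split; first by lia.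
pose v : Zmod (intmod k m a b) := dvec a b a.-1; exists v.
have va : act (idem k m a) v = v.
  by rewrite act_Zmod [_.1]/= vtx_small ?dvec_path //; lia.
have Xv t : (a + t <= n)%N -> xact (gen k m) t v = dvec a b (a.-1 + t).
  move=> le; rewrite (xact_gen _ va) gen_pow_path // act_Zmod.
  by rewrite [_.1]/= /v dvec_path //; lia.
split=> //.
- have [lt | ge] := ltnP b n; first by rewrite Xv ?dvec_out //; lia.
  have -> : (b - a + 1 = n - a + 1)%N by lia.
  by rewrite (xact_gen _ va) gen_pow_dual ?act_Zmod ?act0l //; lia.
- by rewrite Xv ?dvec_neq0 //; lia.
move=> u; have [c cE] := dvec_sum u a1 abn; exists c; rewrite [LHS]cE.
by apply: eq_bigr => t _; rewrite Xv //; have := ltn_ord t; lia.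
Qed.

Lemma dract_ndual i j s : (i <= j <= m)%N -> dract (ndual s j) (npath i j) = ndual s i.
Proof.
by move=> ij; apply/lfunP=> z; rewrite dractE !ndualE ncoef_npath_mul // eqxx mul1r.
Qed.

Lemma dract_vertex (g : DA) s : (s <= m)%N ->
  dract g (npath s s) = \sum_(t < s.+1) g (npath t s) *: ndual t s.
Proof.
move=> sm; apply/lfunP=> z; rewrite dractE sum_lfunE.
have -> : npath s s * z = \sum_(t < s.+1) ncoef z t s *: npath t s.
  apply: ncoefP => i j; rewrite ncoef_npath_mul ?leqnn //.
  rewrite -[RHS]ndualE linear_sum.
  have [les | si] := leqP i s; last first.
    rewrite [ncoef z _ _]ncoef_gt // mulr0 big1 // => t _.
    rewrite linearZ /= ndualE ncoef_npath; last by rewrite -ltnS.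
    by rewrite (_ : (i == t :> nat) = false) ?scaler0 //; have := ltn_ord t; lia.
  rewrite (bigD1 (Ordinal (les : i < s.+1)%N)) //= big1 ?addr0.
    rewrite linearZ /= ndualE ncoef_npath // eqxx /= -[_ *: _]/(_ * _) mulrC.
    by rewrite eq_sym.
  move=> t nt; rewrite linearZ /= ndualE ncoef_npath; last by rewrite -ltnS.
  rewrite (_ : (i == t :> nat) = false) ?scaler0 //.
  by apply: contraNF nt => /eqP e; apply/eqP/val_inj.
rewrite linear_sum; apply: eq_bigr => t _.
by rewrite linearZ scale_lfunE ndualE; exact: mulrC.
Qed.

Section NuProj.
Variable a : nat.
Hypothesis an : (1 <= a <= n)%N.
Local Notation P := (projmod k m a).
Let v0 : P := dvec a n a.-1.

(* These vectors span nu(P_a) = I_a; t is the vertex, counted from 0. *)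
Definition nuvec t : nu P := nuten (ndual t a.-1) v0.

Lemma nuten_path f r : (a.-1 <= r <= m)%N ->
  nuten f (dvec a n r : P) = nuten (dract f (npath a.-1 r)) v0.
Proof. by move=> ar; rewrite nuten_balanced dvec_path //; lia. Qed.

(** Balancing moves every pure tensor onto the generator [v0]. As [v0] is fixed by the idempotent at
    a, the functional may be restricted to paths ending at a, where [dract_vertex] expands it. *)
Lemma nuvec_span (q : nu P) : exists c : nat -> k, q = \sum_(t < a) c t *: nuvec t.
Proof.
pose U : {vspace nu P} := (\sum_(t < a) <[nuvec t]>)%VS.
have U0 f : nuten f v0 \in U.
  have -> : nuten f v0 = nuten (dract f (npath a.-1 a.-1)) v0.
    by rewrite -nuten_path //; lia.
  rewrite dract_vertex; last by lia.
  rewrite -[nuten _ v0](linfunE (nuten_linearl v0)) linear_sum memv_suml // => t _.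
  rewrite linearZ /= (linfunE (nuten_linearl v0)) memvZ //.
  have ta : (t < a)%N by have := ltn_ord t; lia.
  exact: (subvP (sumv_sup (Ordinal ta) isT (subvv _))) (memv_line _).
have allU f (p : P) : nuten f p \in U.
  have a1 : (1 <= a)%N by lia.
  have ann : (a <= n <= n)%N by lia.
  have [c ->] := dvec_sum p a1 ann.
  rewrite -[nuten f _](linfunE (nuten_linearr f)) linear_sum memv_suml // => t _.
  rewrite linearZ /= (linfunE (@nuten_linearr _ _ P f)) memvZ //.
  by rewrite nuten_path ?U0 //; have := ltn_ord t; lia.
have qU : q \in U.
  rewrite -qproj_eq0; apply/eqP.
  have -> : qproj U = 0.
    by apply: nu_ext => f p; rewrite zero_lfunE; apply/eqP; rewrite qproj_eq0.
  by rewrite zero_lfunE.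
case/memv_sumP: qU => w wU ->.
pose c t := if insub t is Some r then coord [tuple nuvec (r : 'I_a)] ord0 (w r) else 0.
pose c' t := if nuvec t == 0 then 0 else c t.
exists c'; apply: eq_bigr => t _; rewrite /c' /c valK.
have wt := wU t isT; have [e0 | nz] := eqVneq (nuvec t) 0; last by rewrite vline_coord.
by have /vlineP[d ->] := wt; rewrite e0 !scaler0.
Qed.

Lemma nuvec_out t : (a <= t)%N -> nuvec t = 0.
Proof.
move=> at_; rewrite /nuvec ndual_gt; last by lia.
by rewrite -[nuten _ _](linfunE (nuten_linearl v0)) linear0.
Qed.

(** Evaluation f (x) p -> f(p) is a functional on nu(P_a), where P_a is read as the left ideal with
    basis the paths starting at a. It takes the value 1 on this tensor. *)
Lemma nuvec_neq0 : nuvec a.-1 != 0.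
Proof.
pose phi (f : DA) (p : P) : k^o := \sum_j p j * f (npath a.-1 (val j)).
have l1 p : linear (phi^~ p).
  move=> c f g; rewrite /phi scaler_sumr -big_split /=; apply: eq_bigr => j _.
  by rewrite add_lfunE scale_lfunE mulrDr; congr (_ + _); exact: mulrCA.
have l2 f : linear (phi f).
  move=> c p q; rewrite /phi scaler_sumr -big_split /=; apply: eq_bigr => j _.
  by rewrite !ffunE mulrDl -[_ *: (_ * _)]/(_ * (_ * _)) mulrA.
have bal f x p : phi (dract f x) p = phi f (act x p).
  rewrite /phi; under [RHS]eq_bigr do rewrite ffunE big_distrl /=.
  rewrite exchange_big /=; apply: eq_bigr => i _; rewrite dractE.
  have -> : x * npath a.-1 (val i) =
      \sum_(j : invertex m a n) coef x (val i) (val j) *: npath a.-1 (val j).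
    have /andP[ai _] := valP i; have lei : (a.-1 <= val i <= m)%N.
      by have := ltn_ord (val i); lia.
    apply: ncoefP => s j; rewrite ncoef_mul_npath // -[RHS]ndualE linear_sum.
    have [aj | ja] := leqP a j.+1; last first.
      rewrite ncoef_gt ?mulr0 ?big1 //; last by lia.
      move=> j' _; have jj' : (j == val j' :> nat) = false by have /andP[] := valP j'; lia.
      have aj' : (a.-1 <= val j')%N by have /andP[] := valP j'; lia.
      by rewrite linearZ /= ndualE ncoef_npath // jj' andbF scaler0.
    have sub : (a <= j.+1 <= n)%N by rewrite aj ltn_ord.
    rewrite (bigD1 (exist _ j sub : invertex m a n)) //= big1 ?addr0.
      rewrite linearZ /= ndualE ncoef_npath /=; last by lia.
      by rewrite eqxx andbT -ncoef_ord -[_ *: _]/(_ * _) mulrC.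
    move=> j' nj; have aj' : (a.-1 <= val j')%N by have /andP[] := valP j'; lia.
    have jj' : (j == val j' :> nat) = false.
      by apply: contraNF nj => /eqP e; apply/eqP/val_inj/val_inj.
    by rewrite linearZ /= ndualE ncoef_npath // jj' andbF scaler0.
  rewrite linear_sum big_distrr /=; apply: eq_bigr => j _.
  by rewrite linearZ /= -[_ *: _]/(_ * _) mulrCA mulrA.
have [g gE] := nu_univ l1 l2 bal.
apply/eqP => e0; have := gE (ndual a.-1 a.-1) v0; rewrite -/(nuvec _) e0 linear0 /phi.
have ltm : (a.-1 < n)%N by lia.
have sub : (a <= (Ordinal ltm).+1 <= n)%N by rewrite /=; lia.
rewrite (bigD1 (exist _ (Ordinal ltm) sub : invertex m a n)) //= big1 ?addr0.
  rewrite ffunE /= eqxx mul1r ndualE (ncoef_npath k (Ordinal ltm) (Ordinal ltm)) //= eqxx.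
  by move/esym/eqP; rewrite oner_eq0.
move=> j nj; rewrite ffunE (_ : (val j == a.-1 :> nat) = false) ?mul0r //.
by apply: contraNF nj => /eqP e; apply/eqP/val_inj/val_inj.
Qed.
End NuProj.

Lemma act_lowmod (Y Z : fdmod A) (beta : 'Hom(nu Y, Z)) (hb : is_hom beta) (t : T) (y : Y) (z : Z) :
  act t ((y, z) : lowmod hb) = (act t.1 y, act t.1 z + beta (nuten t.2 y)).
Proof.
rewrite /= /low_map !comp_lfunE (nuf_nuten (@dfst_hom _ _ _ _)) dfstE dinrE.
by congr pair; rewrite /= addr0.
Qed.

(* L(P_a) is the case c = a and Omega Z([a, b]) the case c = b + 1. *)
Lemma low_uni c a (beta : 'Hom(nu (projmod k m c), nu (projmod k m a))) (hb : is_hom beta) :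
    (1 <= a <= c)%N -> (c <= n)%N ->
    (forall f, beta (nuten f (dvec c n c.-1)) = nuten f (dvec a n c.-1)) ->
  Tuniserial c (n - c + 1 + a) (lowmod hb).
Proof.
move=> /andP[a1 ac] cn bE; split; first by lia.
pose v : lowmod hb := (dvec c n c.-1, 0); exists v.
have nu0 (Y : fdmod A) (y : Y) : nuten (0 : DA) y = 0 :> nu Y.
  by rewrite -[nuten _ _](linfunE (nuten_linearl y)) linear0.
have va : act (idem k m c) v = v.
  rewrite act_lowmod [_.1]/= [_.2]/= nu0 !linear0 addr0 vtx_small; last by lia.
  by rewrite dvec_path //; lia.
have X1 t : (c + t <= n)%N -> xact (gen k m) t v = (dvec c n (c.-1 + t), 0).
  move=> le; rewrite (xact_gen _ va) gen_pow_path //; last by lia.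
  by rewrite act_lowmod [_.1]/= [_.2]/= nu0 !linear0 addr0 dvec_path //; lia.
(* After the crossing into D(A) only beta contributes. By [bE] its value is a tensor with the basis
   vector of P_a at vertex c, which balancing brings back to the generator of P_a. *)
have X2 s : xact (gen k m) (n - c + s.+1) v = (0, nuvec a s).
  rewrite (xact_gen _ va) gen_pow_dual; last by lia.
  rewrite act_lowmod [_.1]/= [_.2]/= !act0l add0r bE nuten_path; try lia.
  by rewrite dract_ndual //; lia.
split=> //.
- have -> : (n - c + 1 + a = n - c + a.+1)%N by lia.
  by rewrite X2 nuvec_out //; lia.
- have -> : ((n - c + 1 + a).-1 = n - c + (a.-1).+1)%N by lia.
  rewrite X2; apply/eqP => -[]; apply/eqP; apply: nuvec_neq0; lia.
move=> [p q]; have [||c1 c1E] := @dvec_sum c n p; try lia.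
have [|c2 c2E] := @nuvec_span a _ q; first by lia.
(* The first n - c + 1 powers of x run through P_c, the remaining a through nu(P_a). *)
exists (fun t => if (t < n - c + 1)%N then c1 t else c2 (t - (n - c + 1))%N).
pose M := lowmod hb.
transitivity (\sum_(t < n - c + 1) c1 t *: ((dvec c n (c.-1 + t), 0) : M) +
              \sum_(t < a) c2 t *: ((0, nuvec a t) : M)).
  exact: (@dsum_span k A (projmod k m c) (nu (projmod k m a)) p q _ _ c1 c2
    (fun t => dvec c n (c.-1 + t)) (nuvec a) c1E c2E).
rewrite [RHS]big_split_ord; congr (_ + _); apply: eq_bigr => t _.
  congr (_ *: _); first by rewrite /= ltn_ord.
  by rewrite X1 //=; have := ltn_ord t; lia.
congr (_ *: _); first by rewrite /= ltnNge leq_addr /= addKn.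
suff -> : nat_of_ord (rshift (n - c + 1) t) = (n - c + t.+1)%N by symmetry; apply: X2.
by rewrite /= -addnA add1n.
Qed.

Lemma modX_uni a b : rangeX m a b -> Tuniserial a (b - a + 1) (modX k m a b).
Proof. by case/and3P=> a1 ab bn; apply: Zmod_uni => //; lia. Qed.

Lemma modR_uni r : rangeR m r -> Tuniserial r (n - r + 1) (modR k m r).
Proof. by case/andP=> r2 rn; apply: Zmod_uni; lia. Qed.

Lemma modL_uni s : rangeL m s -> Tuniserial s n.+1 (modL k m s).
Proof.
case/andP=> s1 sn; rewrite (_ : n.+1 = n - s + 1 + s)%N; last by lia.
by apply: low_uni => [||f]; [lia | lia | rewrite id_lfunE].
Qed.

Lemma modO_uni a b : rangeO m a b -> Tuniserial b.+1 (n - b + a) (modO k m a b).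
Proof.
case/and3P=> a1 ab bn; rewrite (_ : n - b + a = n - b.+1 + 1 + a)%N; last by lia.
apply: low_uni => [||f]; [lia | lia |].
rewrite (nuf_nuten (@projincl_hom _ _ _ _)); congr (nuten f _).
apply/ffunP=> j; rewrite projinclE ffunE leqW 1?ltnW //; case: insubP => [i _ ij | nj] /=.
  by rewrite ffunE ij.
by rewrite (_ : (val j == b :> nat) = false) //; have := ltn_ord (val j); lia.
Qed.

Lemma trivext_projs i : exists P : fdmod T, Tuniserial i n.+1 P.
Proof.
pose s := if (i %% n == 0)%N then n else (i %% n)%N.
exists (modL k m s); apply: (uni_mod trivext_gens (i := s)).
  by rewrite /s; case: eqP => [-> | _]; rewrite ?modnn ?modn_mod.
apply: modL_uni; rewrite /rangeL /s; have := ltn_mod i n.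
by case: eqP; lia.
Qed.

End FamilyModules.

(** * Pairs of indecomposables *)

(* For vertices in [1, n] and t < l <= n the congruence j + t = i + l %[mod n] means
   that j + t - (i + l) is 0, n or - n. *)
Definition separated (n i l j l' : nat) : bool :=
  (l <= n)%N ==> [&& ~~ (j <= i + l < j + minn l l')%N,
    ~~ (j <= i + l + n < j + minn l l')%N & ~~ (j + n <= i + l < j + n + minn l l')%N].

Lemma no_overlapP n i l j l' : (1 <= i <= n)%N -> (1 <= j <= n)%N ->
  no_overlap n i l j l' <-> separated n i l j l'.
Proof.
move=> hi hj; rewrite /no_overlap /separated; split=> [no | /implyP sep ln t tl tl' e].
  apply/implyP => ln; have {}no := no ln; apply/and3P; split; apply/negP => /andP[le lt].
  - by apply: (no (i + l - j)%N); [lia | lia | rewrite subnKC].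
  - by apply: (no (i + l + n - j)%N); [lia | lia | rewrite subnKC // modnDr].
  by apply: (no (i + l - (j + n))%N); [lia | lia | rewrite -[in RHS](subnKC le) -modnDr addnAC].
have tm : (t < minn l l')%N by rewrite ltn_min tl.
have /and3P[/negP s1 /negP s2 /negP s3] := sep ln; clear sep.
have small c : (c * n < 2 * n)%N -> (c < 2)%N by rewrite ltn_mul2r => /andP[].
have [le | /ltnW le] := leqP (i + l) (j + t).
  have /dvdnP[c cE] : (n %| j + t - (i + l))%N by rewrite -eqn_mod_dvd //; apply/eqP.
  have : (c < 2)%N by apply: small; rewrite -cE; clear - hi hj tl ln; lia.
  case: c cE => [|[|//]]; rewrite ?mul0n ?mul1n => cE _.
    by apply: s1; clear - le cE tm; lia.
  by apply: s2; clear - le cE tm; lia.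
have /dvdnP[c cE] : (n %| i + l - (j + t))%N by rewrite -eqn_mod_dvd //; apply/eqP.
have : (c < 2)%N by apply: small; rewrite -cE; clear - hi hj tl ln; lia.
case: c cE => [|[|//]]; rewrite ?mul0n ?mul1n => cE _.
  by apply: s1; clear - le cE tm; lia.
by apply: s3; clear - le cE tm; lia.
Qed.

Definition both n i l j l' := separated n i l j l' && separated n j l' i l.

(** * Arithmetic of the ten types *)

Section Separation.
Variable m : nat.
Local Notation n := m.+1.
Local Open Scope nat_scope.

Lemma sep_XX a b c d : rangeX m a b -> rangeX m c d ->
  before a b c d ->
  both n a (b - a + 1) c (d - c + 1) = psubint c d a b || (b+2 <= c).
Proof.
move=> /and3P[? ? ?] /and3P[? ? ?]; rewrite /before /both /separated /psubint xpair_eqE => ?.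
(* Here and below, i + l is computed before the case analysis: it is b + 1 for X, n + 1 for R and n
   + c + 1 for the Omega of [c, d]. *)
have -> : a + (b-a+1) = b.+1 by lia.
have -> : c + (d-c+1) = d.+1 by lia.
lia.
Qed.

Lemma sep_XR a b r : rangeX m a b -> rangeR m r ->
  both n a (b - a + 1) r (n - r + 1) = (2 <= a) && ((b + 2 <= r) || (r <= a)).
Proof.
move=> /and3P[? ? ?] /andP[? ?]; rewrite /both /separated.
have -> : a + (b-a+1) = b.+1 by lia.
have -> : r + (n-r+1) = n.+1 by lia.
lia.
Qed.
Lemma sep_XL a b r : rangeX m a b -> rangeL m r ->
  both n a (b - a + 1) r n.+1 = (r <= a) || (b + 2 <= r).
Proof.
move=> /and3P[? ? ?] /andP[? ?]; rewrite /both /separated ltnn.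
have -> : a + (b-a+1) = b.+1 by lia.
lia.
Qed.
Lemma sep_XO a b c d : rangeX m a b -> rangeO m c d ->
  both n a (b - a + 1) d.+1 (n - d + c) = [|| b <= c, d + 1 <= a | (c + 2 <= a) && (b <= d - 1)].
Proof.
move=> /and3P[? ? ?] /and3P[? ? ?]; rewrite /both /separated.
have -> : a + (b-a+1) = b.+1 by lia.
have -> : d.+1 + (n-d+c) = n+c+1 by lia.
lia.
Qed.
Lemma sep_RR r s : rangeR m r -> rangeR m s ->
  both n r (n - r + 1) s (n - s + 1).
Proof.
move=> /andP[? ?] /andP[? ?]; rewrite /both /separated.
have -> : s + (n-s+1) = n.+1 by lia.
have -> : r + (n-r+1) = n.+1 by lia.
lia.
Qed.
Lemma sep_RL r s : rangeR m r -> rangeL m s ->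
  both n r (n - r + 1) s n.+1 = (2 <= s <= r).
Proof.
move=> /andP[? ?] /andP[? ?]; rewrite /both /separated ltnn.
have -> : r + (n-r+1) = n.+1 by lia.
lia.
Qed.
Lemma sep_RO r c d : rangeR m r -> rangeO m c d ->
  both n r (n - r + 1) d.+1 (n - d + c) = (d + 1 <= r).
Proof.
move=> /andP[? ?] /and3P[? ? ?]; rewrite /both /separated.
have -> : r + (n-r+1) = n.+1 by lia.
have -> : d.+1 + (n-d+c) = n+c+1 by lia.
lia.
Qed.
Lemma sep_LO s c d : rangeL m s -> rangeO m c d ->
  both n s n.+1 d.+1 (n - d + c) = (c + 2 <= s <= d + 1).
Proof.
move=> /andP[? ?] /and3P[? ? ?]; rewrite /both /separated ltnn.
have -> : d.+1 + (n-d+c) = n+c+1 by lia.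
lia.
Qed.
Lemma sep_OO a b c d : rangeO m a b -> rangeO m c d ->
  before a b c d ->
  both n b.+1 (n - b + a) d.+1 (n - d + c) = psubint c d a b.
Proof.
move=> /and3P[? ? ?] /and3P[? ? ?]; rewrite /before /both /separated /psubint xpair_eqE => ?.
have -> : d.+1 + (n-d+c) = n+c+1 by lia.
have -> : b.+1 + (n-b+a) = n+a+1 by lia.
lia.
Qed.

Lemma sep_LL r s : both n r n.+1 s n.+1.
Proof. by rewrite /both /separated ltnn. Qed.
End Separation.

(** * Codes of the indecomposable rigid modules and of their pairs *)

Section Codes.
Variables (k : fieldType) (m : nat).
Local Notation n := m.+1.
Local Notation T := (trivext (pathalg k m)).
Local Notation Tuniserial := (@Tuniserial k m).
Local Notation gens := (trivext_gens k m).
Local Notation projs := (@trivext_projs k m).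
Implicit Types M N : fdmod T.

Lemma rigid1P i l M : (1 <= i <= n)%N -> Tuniserial i l M -> tau_rigid M <-> separated n i l i l.
Proof. by move=> hi uM; rewrite (tau_rigid_uni gens projs uM) no_overlapP. Qed.

Lemma rigid2P i l j l' M N : (1 <= i <= n)%N -> (1 <= j <= n)%N ->
    Tuniserial i l M -> Tuniserial j l' N ->
  tau_rigid (dsum M N) <->
  [&& separated n i l i l, separated n i l j l', separated n j l' i l & separated n j l' j l'].
Proof.
move=> hi hj uM uN; rewrite (tau_rigid_uni2 gens projs uM uN) !no_overlapP //.
by split=> [[[-> ->] [-> ->]] | /and4P[-> -> -> ->]].
Qed.

(* An indecomposable is coded by its family (0 to 3 for X, R, L, Omega) and its
   indices, the second one being 0 for R and L. *)
Definition code := (nat * (nat * nat))%type.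
Implicit Types c d : code.

Definition cmod c : fdmod T :=
  match c with
  | (0, (a, b)) => modX k m a b
  | (1, (r, _)) => modR k m r
  | (2, (s, _)) => modL k m s
  | (_, (a, b)) => modO k m a b
  end%N.

Definition cvalid c : bool :=
  match c with
  | (0, (a, b)) => rangeX m a b
  | (1, (r, z)) => rangeR m r && (z == 0)
  | (2, (s, z)) => rangeL m s && (z == 0)
  | (3, (a, b)) => rangeO m a b
  | _ => false
  end%N.

Definition ctop c : nat :=
  match c with
  | (0, (a, _)) => a
  | (1, (r, _)) => r
  | (2, (s, _)) => s
  | (_, (_, b)) => b.+1
  end%N.

Definition clen c : nat :=
  match c with
  | (0, (a, b)) => b - a + 1
  | (1, (r, _)) => n - r + 1
  | (2, (s, _)) => n.+1
  | (_, (a, b)) => n - b + a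
  end%N.

Lemma cmod_uni c : cvalid c -> Tuniserial (ctop c) (clen c) (cmod c).
Proof.
case: c => -[|[|[|[|?]]]] [a b] //=.
- exact: modX_uni.
- by case/andP => + _; exact: modR_uni.
- by case/andP => + _; exact: modL_uni.
exact: modO_uni.
Qed.

Lemma ctop_bound c : cvalid c -> (1 <= ctop c <= n)%N.
Proof.
by case: c => -[|[|[|[|?]]]] [a b] //=; rewrite /rangeX /rangeR /rangeL /rangeO; lia.
Qed.

Lemma ctop_clen_inj c d : cvalid c -> cvalid d ->
  (ctop c, clen c) = (ctop d, clen d) -> c = d.
Proof.
case: c => -[|[|[|[|?]]]] [a b] //=; case: d => -[|[|[|[|?]]]] [a' b'] //=;
  rewrite /rangeX /rangeR /rangeL /rangeO => v v' eq2;
  have := congr1 fst eq2; have := congr1 snd eq2; rewrite /= => e2 e1;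
  try (exfalso; lia); suff [-> ->] : a = a' /\ b = b' by []; lia.
Qed.

(** For l <= n the position of i + l - 1, the vertex of the socle before reduction modulo n,
    decides: below n it gives X, at n it gives R, beyond n it gives Omega. That l is not n yields r
    >= 2 for R and a < b for Omega. *)
Lemma code_exists i l : (1 <= i <= n)%N -> (0 < l <= n.+1)%N -> l <> n ->
  exists2 c, cvalid c & (ctop c, clen c) = (i, l).
Proof.
move=> hi hl ln; have [->|ln1] := eqVneq l n.+1.
  by exists (2, (i, 0))%N; rewrite //= /rangeL; lia.
have [lt | ge] := ltnP (i + l - 1)%N n.
  exists (0, (i, i + l - 1))%N; rewrite /= /rangeX; first by lia.
  by congr pair; lia.
have [e | ne] := eqVneq (i + l - 1)%N n.
  exists (1, (i, 0))%N; rewrite /= /rangeR; first by lia.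
  by congr pair; lia.
exists (3, (l + i - 1 - n, i - 1))%N; rewrite /= /rangeO; first by lia.
by congr pair; lia.
Qed.

Lemma cmod_iso c d : cvalid c -> cvalid d -> mod_iso (cmod c) (cmod d) -> c = d.
Proof.
move=> vc vd iso; apply: ctop_clen_inj => //.
exact: (uni_iso_eq gens (cmod_uni vc) (cmod_uni vd) (ctop_bound vc) (ctop_bound vd) iso).
Qed.

Lemma cmod_iso2 c d c' d' : cvalid c -> cvalid d -> cvalid c' -> cvalid d' ->
  mod_iso (dsum (cmod c) (cmod d)) (dsum (cmod c') (cmod d')) ->
  (c = c' /\ d = d') \/ (c = d' /\ d = c').
Proof.
move=> vc vd vc' vd' iso.
case: (uni_iso_sum gens (cmod_uni vc) (cmod_uni vd) (cmod_uni vc') (cmod_uni vd')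
  (ctop_bound vc) (ctop_bound vd) (ctop_bound vc') (ctop_bound vd') iso) => -[e1 e2].
  by left; split; apply: ctop_clen_inj.
by right; split; apply: ctop_clen_inj.
Qed.

Lemma cmod_indecomposable c : cvalid c -> indecomposable (cmod c).
Proof. by move=> vc; apply: (uni_indecomposable (cmod_uni vc)). Qed.

Lemma cmod_rigid c : cvalid c -> tau_rigid (cmod c).
Proof.
move=> vc; apply/(rigid1P (ctop_bound vc) (cmod_uni vc)); rewrite /separated.
by case: c vc => -[|[|[|[|?]]]] [a b] //=; rewrite /rangeX /rangeR /rangeL /rangeO; lia.
Qed.

Lemma rigid_pairP c d : cvalid c -> cvalid d ->
  tau_rigid (dsum (cmod c) (cmod d)) <-> both n (ctop c) (clen c) (ctop d) (clen d).
Proof.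
move=> vc vd; have hc := ctop_bound vc; have hd := ctop_bound vd.
have uc := cmod_uni vc; have ud := cmod_uni vd.
rewrite (rigid2P hc hd uc ud) /both.
have := iffLR (rigid1P hc uc) (cmod_rigid vc); have := iffLR (rigid1P hd ud) (cmod_rigid vd).
by move=> -> ->; rewrite andbT.
Qed.

Lemma iso_cmod_indecomposable M c : cvalid c -> mod_iso M (cmod c) -> indecomposable M.
Proof.
move=> vc iso.
exact: (uni_indecomposable (iso_uni (mod_iso_sym iso) (cmod_uni vc))).
Qed.

Lemma indecomposable_rigid_code M : indecomposable M -> tau_rigid M ->
  exists2 c, cvalid c & mod_iso M (cmod c).
Proof.
move=> /(indecomposable_uni gens)[i [l [hi uM]]] /(rigid1P hi uM) sep.
have [l0 [v gv]] := uM; have ll := uni_len gens l0 gv.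
have ll' : (0 < l <= n.+1)%N by rewrite l0.
have ln : l <> n by move=> ln; move: sep; rewrite /separated ln; lia.
have [c vc [e1 e2]] := code_exists hi ll' ln.
exists c => //; apply: (uni_iso gens uM); rewrite -e1 -e2; exact: cmod_uni.
Qed.

Lemma cmod_rank_two c d : cvalid c -> cvalid d -> c <> d ->
  basic_rank_two (dsum (cmod c) (cmod d)).
Proof.
move=> vc vd ne; exists (cmod c), (cmod d); split; try exact: cmod_indecomposable.
  by move/cmod_iso => /(_ vc vd).
exact: mod_iso_refl.
Qed.

(** For c = d the comparison of types in [uni_iso_sum] would make the two summands of the given
    decomposition isomorphic. *)
Lemma rank_two_neq c d : cvalid c -> cvalid d ->
  basic_rank_two (dsum (cmod c) (cmod d)) -> c <> d.
Proof.
move=> vc vd [U [V [iU iV nUV iso]]] e; rewrite -{d}e in vd iso.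
have [i [l [hi uU]]] := indecomposable_uni gens iU.
have [j [r [hj uV]]] := indecomposable_uni gens iV.
have uc := cmod_uni vc; have hc := ctop_bound vc.
case: (uni_iso_sum gens uc uc uU uV hc hc hi hj iso) => -[e1 e2]; apply: nUV;
  move: e1 e2 uU uV => [<- <-] [<- <-] uU uV; exact: (uni_iso gens uU uV).
Qed.

(** A strict total order that selects one code per unordered pair. It extends the order convention
    of types 1 and 10 and puts mixed pairs in the order X, R, L, Omega of the other types. *)
Definition clt c d := (c.1 < d.1)%N ||
  ((c.1 == d.1) && before c.2.1 c.2.2 d.2.1 d.2.2).

Lemma clt_total c d : c <> d -> clt c d \/ clt d c.
Proof.
case: c d => i [a b] [j [c d]] ne; rewrite /clt /before /=; apply/orP.
have : ~~ [&& i == j, a == c & b == d].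
  by apply/negP => /and3P[/eqP e1 /eqP e2 /eqP e3]; apply: ne; rewrite e1 e2 e3.
lia.
Qed.

Lemma clt_asym c d : clt c d -> clt d c -> False.
Proof. by case: c d => i [a b] [j [c d]]; rewrite /clt /before /=; lia. Qed.

Lemma clt_neq c d : clt c d -> c <> d.
Proof. by move=> lt e; move: (lt); rewrite e => lt'; apply: (clt_asym lt'). Qed.

Definition cpair (p : code * code) : fdmod T := dsum (cmod p.1) (cmod p.2).
Definition pvalid (p : code * code) := [&& cvalid p.1, cvalid p.2 & clt p.1 p.2].

Lemma cpair_inj p q : pvalid p -> pvalid q -> mod_iso (cpair p) (cpair q) -> p = q.
Proof.
case: p q => [c d] [c' d'] /and3P[/= vc vd lt] /and3P[/= vc' vd' lt'] iso.
case: (cmod_iso2 vc vd vc' vd' iso) => [[-> ->] // | [e1 e2]].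
by case: (clt_asym lt); rewrite e1 e2.
Qed.

Lemma rank_two_rigid_code M : basic_rank_two M -> tau_rigid M ->
  exists2 p, pvalid p & mod_iso M (cpair p).
Proof.
move=> [U [V [iU iV nUV iso]]] rM.
have [i [l [hi uU]]] := indecomposable_uni gens iU.
have [j [r [hj uV]]] := indecomposable_uni gens iV.
have /(rigid2P hi hj uU uV)/and4P[sU _ _ sV] := tau_rigid_iso iso rM.
have [c vc isoU] := indecomposable_rigid_code iU (iffRL (rigid1P hi uU) sU).
have [d vd isoV] := indecomposable_rigid_code iV (iffRL (rigid1P hj uV) sV).
have ne : c <> d.
  by move=> e; apply: nUV; apply: mod_iso_trans isoU _; rewrite e; apply: mod_iso_sym.
have isoM := mod_iso_trans iso (dsum_iso isoU isoV).
case: (clt_total ne) => lt; first by exists (c, d); rewrite // /pvalid vc vd.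
exists (d, c); first by rewrite /pvalid /= vc vd.
exact: mod_iso_trans isoM (dsumC _ _).
Qed.

(** By [cpair_inj] distinct valid pairs give non-isomorphic modules, so a duplicate-free list
    covering C is a system of representatives. *)
Lemma num_iso_codes (C : fdmod T -> Prop) (s : seq (code * code)) :
    uniq s -> (forall p, p \in s -> pvalid p) ->
    (forall p, p \in s -> C (cpair p)) ->
    (forall M, C M -> exists2 p, p \in s & mod_iso M (cpair p)) ->
  num_iso_classes C (size s)%:R.
Proof.
move=> us vs Cs cov; exists (size s); split=> //.
pose p0 : code * code := ((0, (0, 0)), (0, (0, 0)))%N.
exists (fun i : 'I_(size s) => cpair (nth p0 s i)); split=> [i | i j iso | M /cov[p ps iso]].
- by apply/Cs/mem_nth.
- apply/val_inj/eqP; rewrite /= -(nth_uniq p0 (ltn_ord i) (ltn_ord j) us); apply/eqP.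
  by apply: cpair_inj iso; apply/vs/mem_nth.
have lt : (index p s < size s)%N by rewrite index_mem.
by exists (Ordinal lt); rewrite /= nth_index.
Qed.

End Codes.

(** * Counting *)

Definition dpairs (S T : Type) (s : seq S) (t : S -> seq T) : seq (S * T) :=
  [seq (x, y) | x <- s, y <- t x].

Lemma dpairs_uniq (S T : eqType) (s : seq S) (t : S -> seq T) :
  uniq s -> (forall x, x \in s -> uniq (t x)) -> uniq (dpairs s t).
Proof.
move=> us ut; apply: allpairs_uniq_dep => // -[x y] [x' y'] _ _ /= [-> ->] //.
Qed.

Lemma mem_dpairs (S T : eqType) (s : seq S) (t : S -> seq T) x y :
  ((x, y) \in dpairs s t) = (x \in s) && (y \in t x).
Proof.
apply/allpairsPdep/andP => [[x' [y' [xs yt [-> ->]]]] // | [xs yt]].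
by exists x, y.
Qed.

Lemma size_dpairs (S T : Type) (s : seq S) (t : S -> seq T) :
  size (dpairs s t) = (\sum_(x <- s) size (t x))%N.
Proof. by rewrite size_allpairs_dep sumnE big_map. Qed.

(** Intervals within lo, ..., hi - 1; [st] is 0 where a = b is allowed, as for X, and 1 where it is
    not, as for Omega. *)
Definition tri st lo hi : seq (nat * nat) :=
  dpairs (index_iota lo hi) (fun a => index_iota (a + st) hi).

Lemma tri_uniq st lo hi : uniq (tri st lo hi).
Proof. by apply: dpairs_uniq => [|a _]; apply: iota_uniq. Qed.

Lemma mem_tri st lo hi a b : ((a, b) \in tri st lo hi) = [&& lo <= a, a + st <= b & b < hi]%N.
Proof. by rewrite mem_dpairs !mem_index_iota; lia. Qed.

Lemma natr_sub (a b : nat) : (b <= a)%N -> (a - b)%:R = a%:R - b%:R :> rat.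
Proof. exact: natrB. Qed.

(* Double telescoping: G is an antidifference of F in the second variable, and H one
   of the inner sum. *)
Lemma sum_tri st lo hi (f : nat -> nat -> nat) (F G : rat -> rat -> rat) (H : rat -> rat) :
    (st <= 1)%N -> (lo <= hi.+1)%N ->
    (forall a b, (lo <= a)%N -> (a + st <= b < hi)%N -> (f a b)%:R = F a%:R b%:R) ->
    (forall x y, F x y = G x (y + 1) - G x y) ->
    (forall x, G x hi%:R - G x (x + st%:R) = H (x + 1) - H x) ->
    (lo = hi.+1 -> H hi%:R = H lo%:R) ->
  (\sum_(p <- tri st lo hi) f p.1 p.2)%N%:R = H hi%:R - H lo%:R.
Proof.
move=> st1 lohi fE GE HE He; rewrite /tri /dpairs big_allpairs_dep natr_sum.
(* At lo = hi + 1 the list is empty but telescoping does not apply; [He] makes the closed formula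
   vanish there. This happens for triangles starting at b + 2 when b is maximal. *)
have [lt | le] := leqP lo hi; last first.
  rewrite He ?subrr; last by lia.
  by rewrite big_geq // ltnW.
rewrite -(telescope_sumr (fun a => H a%:R)) // !big_seq; apply: eq_bigr => a.
rewrite mem_index_iota => /andP[la ah]; rewrite natr_sum -natr1 -HE.
rewrite -natrD -(telescope_sumr (fun b => G a%:R b%:R)) //; last by lia.
rewrite !big_seq; apply: eq_bigr => b; rewrite mem_index_iota => /andP[ab bh].
by rewrite fE // ?ab // GE -natr1.
Qed.

Lemma size_tri lo hi : (lo <= hi.+1)%N ->
  (size (tri 0 lo hi))%:R = (hi%:R - lo%:R) * (hi%:R - lo%:R + 1) / 2 :> rat.
Proof.
move=> le; pose H (x : rat) : rat := - (hi%:R - x) * (hi%:R - x + 1) / 2.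
rewrite (_ : size _ = \sum_(p <- tri 0 lo hi) 1)%N; last by rewrite sum1_size.
rewrite (sum_tri (f := fun _ _ => 1%N) (F := fun _ _ => 1) (G := fun _ y => y) (H := H)) //.
- by rewrite /H; field.
- by move=> x y; ring.
- by move=> x; rewrite /H; field.
by move=> ->; rewrite /H -natr1; field.
Qed.

Lemma size_stri lo hi : (lo <= hi)%N ->
  (size (tri 1 lo hi))%:R = (hi%:R - lo%:R) * (hi%:R - lo%:R - 1) / 2 :> rat.
Proof.
move=> le; pose H (x : rat) : rat := - (hi%:R - x) * (hi%:R - x - 1) / 2.
rewrite (_ : size _ = \sum_(p <- tri 1 lo hi) 1)%N; last by rewrite sum1_size.
rewrite (sum_tri (f := fun _ _ => 1%N) (F := fun _ _ => 1) (G := fun _ y => y) (H := H)) //.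
- by rewrite /H; field.
- exact: leqW.
- by move=> x y; ring.
- by move=> x; rewrite /H; field.
by move=> e; rewrite e ltnn in le.
Qed.

Section Lists.
Variable n : nat.
Hypothesis n1 : (1 <= n)%N.
Let q : rat := n%:R.

(** For fixed [a, b] the three disjoint pieces are the shorter intervals starting at a, the
    subintervals starting after a, and the intervals starting at b + 2 or later. *)
Definition list1 : seq ((nat * nat) * (nat * nat)) := dpairs (tri 0 1 n) (fun p =>
  [seq (p.1, d) | d <- index_iota p.1 p.2] ++ tri 0 p.1.+1 p.2.+1 ++ tri 0 (p.2 + 2) n).
Definition list2 : seq ((nat * nat) * nat) := dpairs (tri 0 2 n) (fun p =>
  index_iota 2 p.1.+1 ++ index_iota (p.2 + 2) n.+1).
Definition list3 : seq ((nat * nat) * nat) := dpairs (tri 0 1 n) (fun p =>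
  index_iota 1 p.1.+1 ++ index_iota (p.2 + 2) n.+1).
(** The outer interval is that of Omega: for fixed [c, d] the three alternatives for [a, b] are then
    disjoint triangles. *)
Definition list4 : seq ((nat * nat) * (nat * nat)) := dpairs (tri 1 1 n) (fun p =>
  tri 0 1 p.1.+1 ++ tri 0 p.2.+1 n ++ tri 0 (p.1 + 2) p.2).
Definition list7 : seq ((nat * nat) * nat) := dpairs (tri 1 1 n) (fun p =>
  index_iota p.2.+1 n.+1).
Definition list9 : seq ((nat * nat) * nat) := dpairs (tri 1 1 n) (fun p =>
  index_iota (p.1 + 2) (p.2 + 2)).
Definition list10 : seq ((nat * nat) * (nat * nat)) := dpairs (tri 1 1 n) (fun p =>
  [seq (p.1, d) | d <- index_iota p.1.+1 p.2] ++ tri 1 p.1.+1 p.2.+1).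

Lemma size_list1 : (size list1)%:R = q * (q - 1) * (q - 2) * (q + 1) / 12.
Proof.
(* The summands of [F] are the sizes of the three pieces of [list1]. [G] and [H] are the polynomial
   antidifferences, in b and then in a, normalised to vanish at 0. The other sizes follow the same
   pattern. *)
pose G (a b : rat) : rat := (3 * a ^+ 2 * b - 3 * a * b ^+ 2 - 6 * a * b + 2 * b ^+ 3 - 3 * b ^+ 2 * q + 6 * b ^+ 2 + 3 * b * q ^+ 2 - 6 * b * q - 2 * b) / 6.
pose H (a : rat) : rat := (- a ^+ 4 + 4 * a ^+ 3 * q + 2 * a ^+ 3 - 6 * a ^+ 2 * q ^+ 2 - 6 * a ^+ 2 * q + a ^+ 2 + 4 * a * q ^+ 3 + 6 * a * q ^+ 2 - 2 * a * q - 2 * a) / 12.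
pose F (a b : rat) : rat := (b - a) + (b - a) * (b - a + 1) / 2 + (q - b - 2) * (q - b - 1) / 2.
rewrite size_dpairs (sum_tri (f := fun a b => size ([seq (a, d) | d <- index_iota a b] ++
  tri 0 a.+1 b.+1 ++ tri 0 (b + 2) n)) (F := F) (G := G) (H := H)) //.
- by rewrite /H -/q; field.
- move=> a b la /andP[ab bn]; rewrite addn0 in ab.
  rewrite !size_cat size_map size_iota !natrD !size_tri; try lia.
  by rewrite natr_sub // -!natr1 natrD /F -/q; field.
- by move=> x y; rewrite /F /G; field.
- by move=> x; rewrite /G /H -/q; field.
by case=> e0; move: n1; rewrite -e0.
Qed.

Lemma size_list2 : (size list2)%:R = (q - 1) * (q - 2) * (2 * q - 3) / 6.
Proof.
pose G (a b : rat) : rat := (2 * a * b - b ^+ 2 + 2 * b * q - 3 * b) / 2.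
pose H (a : rat) : rat := (- a ^+ 3 + 6 * a ^+ 2 + 3 * a * q ^+ 2 - 9 * a * q - 5 * a) / 6.
pose F (a b : rat) : rat := (a - 1) + (q - 1 - b).
rewrite size_dpairs (sum_tri (f := fun a b => size (index_iota 2 a.+1 ++ index_iota (b + 2) n.+1))
  (F := F) (G := G) (H := H)) //.
- by rewrite /H -/q; field.
- move=> a b la /andP[ab bn]; rewrite addn0 in ab.
  rewrite size_cat !size_iota natrD !natr_sub; try lia.
  by rewrite -!natr1 natrD /F -/q; ring.
- by move=> x y; rewrite /F /G; field.
- by move=> x; rewrite /G /H -/q; field.
(* The range of a starts at 2, so the degenerate case does occur, for n = 1; then [H] has the same
   value at 1 and 2. *)
by case=> e0; rewrite /H /q -e0; field.
Qed.

Lemma size_list3 : (size list3)%:R = q * (q - 1) * (2 * q - 1) / 6.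
Proof.
pose G (a b : rat) : rat := (2 * a * b - b ^+ 2 + 2 * b * q - b) / 2.
pose H (a : rat) : rat := (- a ^+ 3 + 3 * a ^+ 2 + 3 * a * q ^+ 2 - 3 * a * q - 2 * a) / 6.
pose F (a b : rat) : rat := a + (q - 1 - b).
rewrite size_dpairs (sum_tri (f := fun a b => size (index_iota 1 a.+1 ++ index_iota (b + 2) n.+1))
  (F := F) (G := G) (H := H)) //.
- by rewrite /H -/q; field.
- move=> a b la /andP[ab bn]; rewrite addn0 in ab.
  rewrite size_cat !size_iota natrD !natr_sub; try lia.
  by rewrite -!natr1 natrD /F -/q; ring.
- by move=> x y; rewrite /F /G; field.
- by move=> x; rewrite /G /H -/q; field.
by case=> e0; move: n1; rewrite -e0.
Qed.

Lemma size_list4 : (size list4)%:R = (q - 1) * (q - 2) * (q ^+ 2 - 3 * q + 4) / 8.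
Proof.
pose G (a b : rat) : rat := (6 * a ^+ 2 * b - 3 * a * b ^+ 2 + 15 * a * b + 2 * b ^+ 3 - 3 * b ^+ 2 * q - 6 * b ^+ 2 + 3 * b * q ^+ 2 + 10 * b) / 6.
pose H (a : rat) : rat := (- 5 * a ^+ 4 + 12 * a ^+ 3 * q - 10 * a ^+ 3 - 12 * a ^+ 2 * q ^+ 2 + 24 * a ^+ 2 * q - 7 * a ^+ 2 + 8 * a * q ^+ 3 - 24 * a * q ^+ 2 + 16 * a * q - 2 * a) / 24.
pose F (a b : rat) : rat := a * (a + 1) / 2 + (q - b - 1) * (q - b) / 2 + (b - a - 2) * (b - a - 1) / 2.
rewrite size_dpairs (sum_tri (f := fun a b => size (tri 0 1 a.+1 ++ tri 0 b.+1 n ++ tri 0 (a + 2) b))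
  (F := F) (G := G) (H := H)) //.
- by rewrite /H -/q; field.
- move=> a b la /andP[ab bn]; rewrite addn1 in ab.
  rewrite !size_cat !natrD !size_tri; try lia.
  by rewrite -!natr1 natrD /F -/q; field.
- by move=> x y; rewrite /F /G; field.
- by move=> x; rewrite /G /H -/q; field.
by case=> e0; move: n1; rewrite -e0.
Qed.

Lemma size_list7 : (size list7)%:R = q * (q - 1) * (q - 2) / 6.
Proof.
pose G (a b : rat) : rat := (- b ^+ 2 + 2 * b * q + b) / 2.
pose H (a : rat) : rat := (a ^+ 3 - 3 * a ^+ 2 * q + 3 * a * q ^+ 2 - a) / 6.
pose F (a b : rat) : rat := q - b.
rewrite size_dpairs (sum_tri (f := fun a b => size (index_iota b.+1 n.+1))
  (F := F) (G := G) (H := H)) //.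
- by rewrite /H -/q; field.
- move=> a b la /andP[ab bn].
  by rewrite size_iota subSS natr_sub //; lia.
- by move=> x y; rewrite /F /G; field.
- by move=> x; rewrite /G /H -/q; field.
by case=> e0; move: n1; rewrite -e0.
Qed.

Lemma size_list9 : (size list9)%:R = q * (q - 1) * (q - 2) / 6.
Proof.
pose G (a b : rat) : rat := (- 2 * a * b + b ^+ 2 - b) / 2.
pose H (a : rat) : rat := (a ^+ 3 - 3 * a ^+ 2 * q + 3 * a * q ^+ 2 - a) / 6.
pose F (a b : rat) : rat := b - a.
rewrite size_dpairs (sum_tri (f := fun a b => size (index_iota (a + 2) (b + 2)))
  (F := F) (G := G) (H := H)) //.
- by rewrite /H -/q; field.
- move=> a b la /andP[ab bn].
  by rewrite size_iota subnDr natr_sub //; lia.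
- by move=> x y; rewrite /F /G; field.
- by move=> x; rewrite /G /H -/q; field.
by case=> e0; move: n1; rewrite -e0.
Qed.

Lemma size_list10 : (size list10)%:R = (q - 1) * (q - 2) * (q - 3) * (q + 4) / 24.
Proof.
pose G (a b : rat) : rat := (3 * a ^+ 2 * b - 3 * a * b ^+ 2 + b ^+ 3 - 7 * b) / 6.
pose H (a : rat) : rat := (- a ^+ 4 + 4 * a ^+ 3 * q + 2 * a ^+ 3 - 6 * a ^+ 2 * q ^+ 2 - 6 * a ^+ 2 * q + 13 * a ^+ 2 + 4 * a * q ^+ 3 + 6 * a * q ^+ 2 - 26 * a * q + 10 * a) / 24.
pose F (a b : rat) : rat := (b - a - 1) + (b - a) * (b - a - 1) / 2.
rewrite size_dpairs (sum_tri (f := fun a b => size ([seq (a, d) | d <- index_iota a.+1 b] ++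
  tri 1 a.+1 b.+1)) (F := F) (G := G) (H := H)) //.
- by rewrite /H -/q; field.
- move=> a b la /andP[ab bn]; rewrite addn1 in ab.
  rewrite !size_cat size_map size_iota natrD size_stri; last by lia.
  by rewrite natr_sub // -!natr1 /F; field.
- by move=> x y; rewrite /F /G; field.
- by move=> x; rewrite /G /H -/q; field.
by case=> e0; move: n1; rewrite -e0.
Qed.
End Lists.

Lemma bin2_rat (n : nat) : 'C(n, 2)%:R = n%:R * (n%:R - 1) / 2 :> rat.
Proof.
elim: n => [|n IH]; first by rewrite bin0n !mul0r.
by rewrite binS bin1 natrD IH -natr1; field.
Qed.

Section PairLists.
Variable m : nat.
Local Notation n := m.+1.

Lemma mem_row (a b : nat) (s : seq nat) (c : nat) :
  ((c, b) \in [seq (a, d) | d <- s]) = (c == a) && (b \in s).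
Proof.
by apply/mapP/andP => [[d ds [-> ->]] | [/eqP-> bs]]; [| exists b].
Qed.

Lemma mem_list1 a b c d : (((a, b), (c, d)) \in list1 n) =
  [&& rangeX m a b, rangeX m c d, before a b c d & psubint c d a b || (b + 2 <= c)%N].
Proof.
rewrite mem_dpairs !mem_cat mem_row !mem_tri !mem_index_iota.
by rewrite /rangeX /before /psubint xpair_eqE /=; lia.
Qed.

Lemma mem_list2 a b r : (((a, b), r) \in list2 n) =
  [&& rangeX m a b, rangeR m r & (2 <= a) && ((b + 2 <= r) || (r <= a))]%N.
Proof.
rewrite mem_dpairs !mem_cat !mem_tri !mem_index_iota.
by rewrite /rangeX /rangeR /=; lia.
Qed.

Lemma mem_list3 a b s : (((a, b), s) \in list3 n) =
  [&& rangeX m a b, rangeL m s & ((s <= a) || (b + 2 <= s))]%N.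
Proof.
rewrite mem_dpairs !mem_cat !mem_tri !mem_index_iota.
by rewrite /rangeX /rangeL /=; lia.
Qed.

Lemma mem_list4 a b c d : (((c, d), (a, b)) \in list4 n) =
  [&& rangeX m a b, rangeO m c d &
      [|| b <= c, d + 1 <= a | (c + 2 <= a) && (b <= d - 1)]]%N.
Proof.
rewrite mem_dpairs !mem_cat !mem_tri.
by rewrite /rangeX /rangeO /=; lia.
Qed.

Lemma mem_list7 c d r : (((c, d), r) \in list7 n) =
  [&& rangeR m r, rangeO m c d & (d + 1 <= r)%N].
Proof.
by rewrite mem_dpairs !mem_tri !mem_index_iota /rangeR /rangeO /=; lia.
Qed.

Lemma mem_list9 c d s : (((c, d), s) \in list9 n) =
  [&& rangeL m s, rangeO m c d & (c + 2 <= s <= d + 1)%N].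
Proof.
by rewrite mem_dpairs !mem_tri !mem_index_iota /rangeL /rangeO /=; lia.
Qed.

Lemma mem_list10 a b c d : (((a, b), (c, d)) \in list10 n) =
  [&& rangeO m a b, rangeO m c d, before a b c d & psubint c d a b].
Proof.
rewrite mem_dpairs !mem_cat mem_row !mem_tri !mem_index_iota.
by rewrite /rangeO /before /psubint xpair_eqE /=; lia.
Qed.

Definition kind (p : code * code) := (p.1.1, p.2.1).

Definition both_codes (p : code * code) :=
  both n (ctop p.1) (clen m p.1) (ctop p.2) (clen m p.2).

(* t is the number of the type in the theorem. *)
Definition codes t : seq (code * code) :=
  match t with
  | 1 => [seq ((0, x.1), (0, x.2)) | x <- list1 n]
  | 2 => [seq ((0, x.1), (1, (x.2, 0))) | x <- list2 n]
  | 3 => [seq ((0, x.1), (2, (x.2, 0))) | x <- list3 n]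
  | 4 => [seq ((0, x.2), (3, x.1)) | x <- list4 n]
  | 5 => [seq ((1, (x.1, 0)), (1, (x.2, 0))) | x <- tri 1 2 n.+1]
  | 6 => [seq ((1, (x.2, 0)), (2, (x.1, 0))) | x <- tri 0 2 n.+1]
  | 7 => [seq ((1, (x.2, 0)), (3, x.1)) | x <- list7 n]
  | 8 => [seq ((2, (x.1, 0)), (2, (x.2, 0))) | x <- tri 1 1 n.+1]
  | 9 => [seq ((2, (x.2, 0)), (3, x.1)) | x <- list9 n]
  | _ => [seq ((3, x.1), (3, x.2)) | x <- list10 n]
  end%N.

Definition kinds t : nat * nat :=
  match t with
  | 1 => (0, 0) | 2 => (0, 1) | 3 => (0, 2) | 4 => (0, 3) | 5 => (1, 1)
  | 6 => (1, 2) | 7 => (1, 3) | 8 => (2, 2) | 9 => (2, 3) | _ => (3, 3)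
  end%N.

Definition code_spec t p := [&& kind p == kinds t, pvalid m p & both_codes p].

(** The list is given by explicit inequalities, which [sep_XX] identifies with [both]. The next nine
    lemmas proceed alike, each with the [sep] lemma of its families. *)
Lemma mem_codes1 p : (p \in codes 1) = code_spec 1 p.
Proof.
case: p => [[i [a b]] [j [c d]]]; apply/mapP/and3P.
  case=> [[[a' b'] [c' d']]]; rewrite mem_list1 => /and4P[h1 h2 h3 h4] [-> -> -> -> -> ->].
  by split; rewrite // /pvalid /both_codes /clt /= ?h1 ?h2 ?sep_XX.
case=> /eqP[-> ->] /and3P[/= v1 v2 lt]; rewrite /both_codes /= sep_XX // => h.
by exists ((a, b), (c, d)); rewrite ?mem_list1 ?v1 ?v2 ?h ?andbT.
Qed.

Lemma mem_codes2 p : (p \in codes 2) = code_spec 2 p.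
Proof.
case: p => [[i [a b]] [j [c d]]]; apply/mapP/and3P.
  case=> [[[a' b'] r]]; rewrite mem_list2 => /and3P[h1 h2 h3] [-> -> -> -> -> ->].
  by split; rewrite // /pvalid /both_codes /clt /= ?h1 ?h2 ?sep_XR.
case=> /eqP[-> ->] /and3P[/= v1 /andP[v2 /eqP->] lt]; rewrite /both_codes /= sep_XR // => h.
by exists ((a, b), c); rewrite ?mem_list2 ?v1 ?v2 ?h.
Qed.

Lemma mem_codes3 p : (p \in codes 3) = code_spec 3 p.
Proof.
case: p => [[i [a b]] [j [c d]]]; apply/mapP/and3P.
  case=> [[[a' b'] r]]; rewrite mem_list3 => /and3P[h1 h2 h3] [-> -> -> -> -> ->].
  by split; rewrite // /pvalid /both_codes /clt /= ?h1 ?h2 ?sep_XL.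
case=> /eqP[-> ->] /and3P[/= v1 /andP[v2 /eqP->] lt]; rewrite /both_codes /= sep_XL // => h.
by exists ((a, b), c); rewrite ?mem_list3 ?v1 ?v2 ?h.
Qed.

Lemma mem_codes4 p : (p \in codes 4) = code_spec 4 p.
Proof.
case: p => [[i [a b]] [j [c d]]]; apply/mapP/and3P.
  case=> [[[c' d'] [a' b']]]; rewrite mem_list4 => /and3P[h1 h2 h3] [-> -> -> -> -> ->].
  by split; rewrite // /pvalid /both_codes /clt /= ?h1 ?h2 ?sep_XO.
case=> /eqP[-> ->] /and3P[/= v1 v2 lt]; rewrite /both_codes /= sep_XO // => h.
by exists ((c, d), (a, b)); rewrite ?mem_list4 ?v1 ?v2 ?h.
Qed.

Lemma mem_codes5 p : (p \in codes 5) = code_spec 5 p.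
Proof.
case: p => [[i [a b]] [j [c d]]]; apply/mapP/and3P.
  case=> [[r s]]; rewrite mem_tri => h [-> -> -> -> -> ->].
  have [h1 h2] : rangeR m r /\ rangeR m s by rewrite /rangeR; lia.
  by split; rewrite // /pvalid /both_codes /clt /before /= ?h1 ?h2 ?sep_RR //; lia.
case=> /eqP[-> ->] /and3P[/= /andP[v1 /eqP->] /andP[v2 /eqP->]].
rewrite /clt /before /= => lt _; exists (a, c) => //.
by rewrite mem_tri; move: v1 v2 lt; rewrite /rangeR; lia.
Qed.

Lemma mem_codes6 p : (p \in codes 6) = code_spec 6 p.
Proof.
case: p => [[i [a b]] [j [c d]]]; apply/mapP/and3P.
  case=> [[s r]]; rewrite mem_tri => h [-> -> -> -> -> ->].
  have [h1 h2] : rangeR m r /\ rangeL m s by rewrite /rangeR /rangeL; lia.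
  by split; rewrite // /pvalid /both_codes /clt /before /= ?h1 ?h2 ?sep_RL //; lia.
case=> /eqP[-> ->] /and3P[/= /andP[v1 /eqP->] /andP[v2 /eqP->]] _.
rewrite /both_codes /= sep_RL // => h; exists (c, a) => //.
by rewrite mem_tri; move: v1 v2 h; rewrite /rangeR /rangeL; lia.
Qed.

Lemma mem_codes7 p : (p \in codes 7) = code_spec 7 p.
Proof.
case: p => [[i [a b]] [j [c d]]]; apply/mapP/and3P.
  case=> [[[c' d'] r]]; rewrite mem_list7 => /and3P[h1 h2 h3] [-> -> -> -> -> ->].
  by split; rewrite // /pvalid /both_codes /clt /= ?h1 ?h2 ?sep_RO.
case=> /eqP[-> ->] /and3P[/= /andP[v1 /eqP->] v2 lt]; rewrite /both_codes /= sep_RO // => h.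
by exists ((c, d), a); rewrite ?mem_list7 ?v1 ?v2 ?h.
Qed.

Lemma mem_codes8 p : (p \in codes 8) = code_spec 8 p.
Proof.
case: p => [[i [a b]] [j [c d]]]; apply/mapP/and3P.
  case=> [[r s]]; rewrite mem_tri => h [-> -> -> -> -> ->].
  have [h1 h2] : rangeL m r /\ rangeL m s by rewrite /rangeL; lia.
  by split; rewrite // /pvalid /both_codes /clt /before /= ?h1 ?h2 ?sep_LL //; lia.
case=> /eqP[-> ->] /and3P[/= /andP[v1 /eqP->] /andP[v2 /eqP->]].
rewrite /clt /before /= => lt _; exists (a, c) => //.
by rewrite mem_tri; move: v1 v2 lt; rewrite /rangeL; lia.
Qed.

Lemma mem_codes9 p : (p \in codes 9) = code_spec 9 p.
Proof.
case: p => [[i [a b]] [j [c d]]]; apply/mapP/and3P.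
  case=> [[[c' d'] r]]; rewrite mem_list9 => /and3P[h1 h2 h3] [-> -> -> -> -> ->].
  by split; rewrite // /pvalid /both_codes /clt /= ?h1 ?h2 ?sep_LO.
case=> /eqP[-> ->] /and3P[/= /andP[v1 /eqP->] v2 lt]; rewrite /both_codes /= sep_LO // => h.
by exists ((c, d), a); rewrite ?mem_list9 ?v1 ?v2 ?h.
Qed.

Lemma mem_codes10 p : (p \in codes 10) = code_spec 10 p.
Proof.
case: p => [[i [a b]] [j [c d]]]; apply/mapP/and3P.
  case=> [[[a' b'] [c' d']]]; rewrite mem_list10 => /and4P[h1 h2 h3 h4] [-> -> -> -> -> ->].
  by split; rewrite // /pvalid /both_codes /clt /= ?h1 ?h2 ?sep_OO.
case=> /eqP[-> ->] /and3P[/= v1 v2 lt]; rewrite /both_codes /= sep_OO // => h.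
by exists ((a, b), (c, d)); rewrite ?mem_list10 ?v1 ?v2 ?h ?andbT.
Qed.

Lemma mem_codes t p : (1 <= t <= 10)%N -> (p \in codes t) = code_spec t p.
Proof.
case: t => [|[|[|[|[|[|[|[|[|[|[|t]]]]]]]]]]] // _.
- exact: mem_codes1.
- exact: mem_codes2.
- exact: mem_codes3.
- exact: mem_codes4.
- exact: mem_codes5.
- exact: mem_codes6.
- exact: mem_codes7.
- exact: mem_codes8.
- exact: mem_codes9.
exact: mem_codes10.
Qed.

Lemma cat_disjoint_uniq (I : eqType) (s1 s2 : seq I) : uniq s1 -> uniq s2 ->
  (forall x, x \in s1 -> x \notin s2) -> uniq (s1 ++ s2).
Proof.
move=> u1 u2 d; rewrite cat_uniq u1 u2 andbT; apply/hasPn => x x2.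
by apply/negP => /d; rewrite x2.
Qed.

Lemma row_uniq (a : nat) (s : seq nat) : uniq s -> uniq [seq (a, d) | d <- s].
Proof. by move=> us; rewrite map_inj_uniq // => x y []. Qed.

Lemma codes_uniq t : uniq (codes t).
Proof.
have iu a b : uniq (index_iota a b) by apply: iota_uniq.
have u1 : uniq (list1 n).
  apply: dpairs_uniq => [|[a b] _]; first exact: tri_uniq.
  apply: cat_disjoint_uniq => [||[x y]]; first exact/row_uniq/iu.
    apply: cat_disjoint_uniq => [||[x y]]; try exact: tri_uniq.
    by rewrite !mem_tri /=; lia.
  by rewrite mem_cat mem_row !mem_tri mem_index_iota /=; lia.
have u2 : uniq (list2 n).
  apply: dpairs_uniq => [|[a b]]; first exact: tri_uniq.
  rewrite mem_tri => h; apply: cat_disjoint_uniq; rewrite ?iu // => x.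
  by rewrite !mem_index_iota /=; lia.
have u3 : uniq (list3 n).
  apply: dpairs_uniq => [|[a b]]; first exact: tri_uniq.
  rewrite mem_tri => h; apply: cat_disjoint_uniq; rewrite ?iu // => x.
  by rewrite !mem_index_iota /=; lia.
have u4 : uniq (list4 n).
  apply: dpairs_uniq => [|[a b]]; first exact: tri_uniq.
  rewrite mem_tri => h; apply: cat_disjoint_uniq => [||[x y]]; first exact: tri_uniq.
    apply: cat_disjoint_uniq => [||[x y]]; try exact: tri_uniq.
    by rewrite !mem_tri /=; lia.
  by rewrite mem_cat !mem_tri /=; lia.
have u7 : uniq (list7 n) by apply: dpairs_uniq => [|[a b] _]; [exact: tri_uniq | exact: iu].
have u9 : uniq (list9 n) by apply: dpairs_uniq => [|[a b] _]; [exact: tri_uniq | exact: iu].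
have u10 : uniq (list10 n).
  apply: dpairs_uniq => [|[a b] _]; first exact: tri_uniq.
  apply: cat_disjoint_uniq => [||[x y]]; [exact/row_uniq/iu | exact: tri_uniq |].
  by rewrite mem_row mem_tri mem_index_iota /=; lia.
case: t => [|[|[|[|[|[|[|[|[|[|t]]]]]]]]]] /=; rewrite map_inj_uniq ?tri_uniq //;
  by move=> [x1 x2] [y1 y2] [-> ->].
Qed.

Definition all_codes := flatten [seq codes t | t <- iota 1 10].

Lemma kinds_inj t t' : (1 <= t <= 10)%N -> (1 <= t' <= 10)%N -> kinds t = kinds t' -> t = t'.
Proof.
by case: t => [|[|[|[|[|[|[|[|[|[|[|t]]]]]]]]]]] // _;
  case: t' => [|[|[|[|[|[|[|[|[|[|[|t']]]]]]]]]]].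
Qed.

(** Lists of different types are disjoint because the pair of families determines the type. *)
Lemma all_codes_uniq : uniq all_codes.
Proof.
have : all (fun t => 1 <= t <= 10)%N (iota 1 10) by [].
have := iota_uniq 1 10; rewrite /all_codes.
elim: (iota 1 10) => //= t s IH /andP[ts us] /andP[t10 s10].
apply: cat_disjoint_uniq => [||p]; [exact: codes_uniq | exact: IH |].
rewrite mem_codes // => /and3P[/eqP kp _ _]; apply/negP => /flatten_mapP[t' t's].
have t'10 := allP s10 t' t's.
rewrite mem_codes // => /and3P[/eqP kp' _ _].
by move: ts; rewrite (kinds_inj t10 t'10 _) ?t's // -kp.
Qed.

Lemma kindsP p : pvalid m p -> exists2 t, (1 <= t <= 10)%N & kind p = kinds t.
Proof.
case: p => [[i [a b]] [j [c d]]] /and3P[/=].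
rewrite /clt; case: i => [|[|[|[|i]]]] //; case: j => [|[|[|[|j]]]] //= _ _ _;
  [ exists 1%N | exists 2%N | exists 3%N | exists 4%N | exists 5%N
  | exists 6%N | exists 7%N | exists 8%N | exists 9%N | exists 10%N ]; by [].
Qed.

Lemma mem_all_codes p : (p \in all_codes) = pvalid m p && both_codes p.
Proof.
apply/flatten_mapP/andP => [[t t10] | [vp bp]].
  by rewrite mem_iota in t10; rewrite mem_codes // => /and3P[].
have [t t10 kt] := kindsP vp; exists t; first by rewrite mem_iota; lia.
by rewrite mem_codes // /code_spec kt eqxx vp.
Qed.

Lemma size_all_codes : (size all_codes)%:R = n%:R ^+ 2 * (n%:R ^+ 2 - 1) / 4 :> rat.
Proof.
rewrite /all_codes /= !size_cat !size_map !natrD.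
rewrite size_list1 // size_list2 // size_list3 // size_list4 // size_list7 // size_list9 //.
rewrite size_list10 // !size_stri // ?size_tri //.
by rewrite -[n.+1%:R]natr1 -[(size [::])%:R]/(0%:R : rat); field.
Qed.

End PairLists.

(** * Classification and numbers of isomorphism classes *)

Section RankTwo.
Variables (k : fieldType) (m : nat).
Local Notation n := m.+1.
Local Notation T := (trivext (pathalg k m)).
Local Notation cmod := (cmod k m).
Local Notation cpair := (cpair k m).
Implicit Types M : fdmod T.

Lemma rigid_cpair p : pvalid m p -> tau_rigid (cpair p) <-> both_codes m p.
Proof. by case/and3P=> vc vd _; apply: rigid_pairP. Qed.

(** Isolates what has to be checked for each type: how its members translate into codes and back.
    The numerical condition then comes from [rigid_cpair]. *)
Lemma num_iso_kind t (C : fdmod T -> Prop) : (1 <= t <= 10)%N ->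
    (forall M, C M -> tau_rigid M) ->
    (forall p, kind p = kinds t -> pvalid m p -> tau_rigid (cpair p) -> C (cpair p)) ->
    (forall M, C M -> exists p, [/\ kind p = kinds t, pvalid m p & mod_iso M (cpair p)]) ->
  num_iso_classes C (size (codes m t))%:R.
Proof.
move=> t10 Cr Cp cov; apply: (num_iso_codes (k := k) (m := m)).
- exact: codes_uniq.
- by move=> p; rewrite mem_codes // => /and3P[].
- move=> p; rewrite mem_codes // => /and3P[/eqP kp vp bp].
  by apply: Cp => //; apply/rigid_cpair.
move=> M CM; have [p [kp vp iso]] := cov M CM; exists p => //.
rewrite mem_codes // /code_spec kp eqxx vp.
by apply/(rigid_cpair vp); apply: tau_rigid_iso iso (Cr M CM).
Qed.

Lemma type_of_code M p : pvalid m p -> mod_iso M (cpair p) ->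
  type1 M \/ type2 M \/ type3 M \/ type4 M \/ type5 M \/
  type6 M \/ type7 M \/ type8 M \/ type9 M \/ type10 M.
Proof.
case: p => [[i [a b]] [j [c d]]] /and3P[/=]; rewrite /clt.
case: i => [|[|[|[|i]]]] //; case: j => [|[|[|[|j]]]] //= v1 v2 lt iso.
- by left; exists a, b, c, d.
- by case/andP: v2 => v2 _; do 1?right; left; exists a, b, c.
- by case/andP: v2 => v2 _; do 2!right; left; exists a, b, c.
- by do 3!right; left; exists a, b, c, d.
- by case/andP: v1 => v1 _; case/andP: v2 => v2 _; do 4!right; left; exists a, c.
- by case/andP: v1 => v1 _; case/andP: v2 => v2 _; do 5!right; left; exists a, c.
- by case/andP: v1 => v1 _; do 6!right; left; exists a, c, d.
- by case/andP: v1 => v1 _; case/andP: v2 => v2 _; do 7!right; left; exists a, c.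
- by case/andP: v1 => v1 _; do 8!right; left; exists a, c, d.
by do 9!right; exists a, b, c, d.
Qed.

Lemma code_of_pair t c d : kind (c, d) = kinds t -> cvalid m c -> cvalid m d ->
  clt c d -> forall M, mod_iso M (dsum (cmod c) (cmod d)) ->
  exists p, [/\ kind p = kinds t, pvalid m p & mod_iso M (cpair p)].
Proof. by move=> kcd vc vd lt M iso; exists (c, d); split=> //; apply/and3P. Qed.

Local Notation count t C := (num_iso_classes C (size (codes m t))%:R).

Lemma count_type1 : count 1 (fun M => tau_rigid M /\ @type1 k m M).
Proof.
apply: num_iso_kind => // [M [] // | [[i [a b]] [j [c d]]] [-> ->] /and3P[/= v1 v2 lt] r | M [_]].
  by split=> //; exists a, b, c, d; split=> //; apply: mod_iso_refl.
case=> a [b [c [d [h1 h2 lt iso]]]].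
exact: (code_of_pair (c := (0, (a, b))%N) (d := (0, (c, d))%N)).
Qed.

Lemma count_type2 : count 2 (fun M => tau_rigid M /\ @type2 k m M).
Proof.
apply: num_iso_kind => // [M [] // | [[i [a b]] [j [c d]]] [-> ->] /and3P[/= v1 /andP[v2 _] lt] r | M [_]].
  by split=> //; exists a, b, c; split=> //; apply: mod_iso_refl.
case=> a [b [r [h1 h2 iso]]].
by apply: (code_of_pair (c := (0, (a, b))%N) (d := (1, (r, 0))%N)); rewrite //= h2.
Qed.

Lemma count_type3 : count 3 (fun M => tau_rigid M /\ @type3 k m M).
Proof.
apply: num_iso_kind => // [M [] // | [[i [a b]] [j [c d]]] [-> ->] /and3P[/= v1 /andP[v2 _] lt] r | M [_]].
  by split=> //; exists a, b, c; split=> //; apply: mod_iso_refl.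
case=> a [b [s [h1 h2 iso]]].
by apply: (code_of_pair (c := (0, (a, b))%N) (d := (2, (s, 0))%N)); rewrite //= h2.
Qed.

Lemma count_type4 : count 4 (fun M => tau_rigid M /\ @type4 k m M).
Proof.
apply: num_iso_kind => // [M [] // | [[i [a b]] [j [c d]]] [-> ->] /and3P[/= v1 v2 lt] r | M [_]].
  by split=> //; exists a, b, c, d; split=> //; apply: mod_iso_refl.
case=> a [b [c [d [h1 h2 iso]]]].
exact: (code_of_pair (c := (0, (a, b))%N) (d := (3, (c, d))%N)).
Qed.

Lemma basic_rank_two_iso M N : mod_iso M N -> basic_rank_two M -> basic_rank_two N.
Proof.
move=> iso [U [V [iU iV nUV isoM]]]; exists U, V; split=> //.
exact: mod_iso_trans (mod_iso_sym iso) isoM.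
Qed.

(** For types 5 and 8, whose indices come in no order: being basic makes the two codes distinct, and
    they can then be sorted by [clt]. *)
Lemma code_of_unordered_pair t c d M : kind (c, d) = kinds t -> kind (d, c) = kinds t ->
    cvalid m c -> cvalid m d -> basic_rank_two M -> mod_iso M (dsum (cmod c) (cmod d)) ->
  exists p, [/\ kind p = kinds t, pvalid m p & mod_iso M (cpair p)].
Proof.
move=> kcd kdc vc vd /basic_rank_two_iso bM iso.
have ne := rank_two_neq vc vd (bM _ iso).
case: (clt_total ne) => lt; first exact: (code_of_pair (c := c) (d := d)).
exact: (code_of_pair (c := d) (d := c)) (mod_iso_trans iso (dsumC _ _)).
Qed.

Lemma count_type5 :
  count 5 (fun M => [/\ basic_rank_two M, tau_rigid M & @type5 k m M]).
Proof.
apply: num_iso_kind => // [M [] // | [[i [a b]] [j [c d]]] [-> ->] vp r | M [bM _]].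
  have /and3P[/= v1 v2 lt] := vp; split=> //; first exact: cmod_rank_two (clt_neq lt).
  case/andP: v1 => v1 _; case/andP: v2 => v2 _.
  by exists a, c; split=> //; apply: mod_iso_refl.
case=> r [s [h1 h2 iso]].
by apply: (code_of_unordered_pair (c := (1, (r, 0))%N) (d := (1, (s, 0))%N) _ _ _ _ bM);
  rewrite //= ?h1 ?h2.
Qed.

Lemma count_type6 : count 6 (fun M => tau_rigid M /\ @type6 k m M).
Proof.
apply: num_iso_kind => // [M [] // | [[i [a b]] [j [c d]]] [-> ->] /and3P[/= /andP[v1 _] /andP[v2 _] lt] r | M [_]].
  by split=> //; exists a, c; split=> //; apply: mod_iso_refl.
case=> r [s [h1 h2 iso]].
by apply: (code_of_pair (c := (1, (r, 0))%N) (d := (2, (s, 0))%N)); rewrite //= ?h1 ?h2.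
Qed.

Lemma count_type7 : count 7 (fun M => tau_rigid M /\ @type7 k m M).
Proof.
apply: num_iso_kind => // [M [] // | [[i [a b]] [j [c d]]] [-> ->] /and3P[/= /andP[v1 _] v2 lt] r | M [_]].
  by split=> //; exists a, c, d; split=> //; apply: mod_iso_refl.
case=> r [c [d [h1 h2 iso]]].
by apply: (code_of_pair (c := (1, (r, 0))%N) (d := (3, (c, d))%N)); rewrite //= ?h1.
Qed.

Lemma count_type8 :
  count 8 (fun M => [/\ basic_rank_two M, tau_rigid M & @type8 k m M]).
Proof.
apply: num_iso_kind => // [M [] // | [[i [a b]] [j [c d]]] [-> ->] vp r | M [bM _]].
  have /and3P[/= v1 v2 lt] := vp; split=> //; first exact: cmod_rank_two (clt_neq lt).
  case/andP: v1 => v1 _; case/andP: v2 => v2 _.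
  by exists a, c; split=> //; apply: mod_iso_refl.
case=> r [s [h1 h2 iso]].
by apply: (code_of_unordered_pair (c := (2, (r, 0))%N) (d := (2, (s, 0))%N) _ _ _ _ bM);
  rewrite //= ?h1 ?h2.
Qed.

Lemma count_type9 : count 9 (fun M => tau_rigid M /\ @type9 k m M).
Proof.
apply: num_iso_kind => // [M [] // | [[i [a b]] [j [c d]]] [-> ->] /and3P[/= /andP[v1 _] v2 lt] r | M [_]].
  by split=> //; exists a, c, d; split=> //; apply: mod_iso_refl.
case=> s [c [d [h1 h2 iso]]].
by apply: (code_of_pair (c := (2, (s, 0))%N) (d := (3, (c, d))%N)); rewrite //= ?h1.
Qed.

Lemma count_type10 : count 10 (fun M => tau_rigid M /\ @type10 k m M).
Proof.
apply: num_iso_kind => // [M [] // | [[i [a b]] [j [c d]]] [-> ->] /and3P[/= v1 v2 lt] r | M [_]].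
  by split=> //; exists a, b, c, d; split=> //; apply: mod_iso_refl.
case=> a [b [c [d [h1 h2 lt iso]]]].
exact: (code_of_pair (c := (3, (a, b))%N) (d := (3, (c, d))%N)).
Qed.

Lemma count_all :
  num_iso_classes (fun M => basic_rank_two M /\ tau_rigid M) (size (all_codes m))%:R.
Proof.
apply: (num_iso_codes (k := k) (m := m)); first exact: all_codes_uniq.
- by move=> p; rewrite mem_all_codes => /andP[].
- move=> p; rewrite mem_all_codes => /andP[vp bp]; split; last exact/rigid_cpair.
  by have /and3P[vc vd lt] := vp; apply: cmod_rank_two (clt_neq lt).
move=> M [bM rM]; have [p vp iso] := rank_two_rigid_code bM rM; exists p => //.
by rewrite mem_all_codes vp; apply/(rigid_cpair vp); apply: tau_rigid_iso iso rM.
Qed.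

Lemma indecomposable_rigidP M : (indecomposable M /\ tau_rigid M) <->
  [\/ exists a b, rangeX m a b /\ mod_iso M (modX k m a b),
      exists r, rangeR m r /\ mod_iso M (modR k m r),
      exists s, rangeL m s /\ mod_iso M (modL k m s)
    | exists a b, rangeO m a b /\ mod_iso M (modO k m a b)].
Proof.
have back c : cvalid m c -> mod_iso M (cmod c) -> indecomposable M /\ tau_rigid M.
  move=> vc iso; split; first exact: iso_cmod_indecomposable vc iso.
  exact: tau_rigid_iso (mod_iso_sym iso) (cmod_rigid k vc).
split=> [[iM rM] | ].
  have [[i [a b]]] := indecomposable_rigid_code iM rM.
  case: i => [|[|[|[|i]]]] //= vc iso.
  - by constructor 1; exists a, b.
  - by case/andP: vc => vc _; constructor 2; exists a.
  - by case/andP: vc => vc _; constructor 3; exists a.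
  by constructor 4; exists a, b.
case=> [[a [b [h iso]]] | [r [h iso]] | [s [h iso]] | [a [b [h iso]]]].
- exact: (back (0, (a, b))%N).
- by apply: (back (1, (r, 0))%N); rewrite //= h.
- by apply: (back (2, (s, 0))%N); rewrite //= h.
exact: (back (3, (a, b))%N).
Qed.

(** For two modules R or two modules L compatibility is automatic, so the only condition left is the
    one that makes the sum basic. *)
Lemma rank_two_distinct c d : cvalid m c -> cvalid m d ->
    both n (ctop c) (clen m c) (ctop d) (clen m d) ->
  basic_rank_two (dsum (cmod c) (cmod d)) /\ tau_rigid (dsum (cmod c) (cmod d)) <-> c <> d.
Proof.
move=> vc vd bcd; split=> [[bM _] | ne]; first exact: rank_two_neq vc vd bM.
by split; [apply: cmod_rank_two | apply/rigid_pairP].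
Qed.

End RankTwo.

Theorem mainTheorem2 (k : fieldType) (m : nat) :
  let n := m.+1 in
  let q : rat := n%:R in
  let X := modX k m in
  let R := modR k m in
  let L := modL k m in
  let Om := modO k m in
  [/\ forall M : fdmod (trivext (pathalg k m)),
        (indecomposable M /\ tau_rigid M) <->
        [\/ exists a b, rangeX m a b /\ mod_iso M (X a b),
            exists r, rangeR m r /\ mod_iso M (R r),
            exists s, rangeL m s /\ mod_iso M (L s)
          | exists a b, rangeO m a b /\ mod_iso M (Om a b)],
      forall M : fdmod (trivext (pathalg k m)),
        basic_rank_two M -> tau_rigid M ->
        type1 M \/ type2 M \/ type3 M \/ type4 M \/ type5 M \/
        type6 M \/ type7 M \/ type8 M \/ type9 M \/ type10 M,
      [/\ (forall a b c d, rangeX m a b -> rangeX m c d -> before a b c d ->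
             (tau_rigid (dsum (X a b) (X c d)) <->
              psubint c d a b \/ (b + 2 <= c)%N)),
          (forall a b r, rangeX m a b -> rangeR m r ->
             (tau_rigid (dsum (X a b) (R r)) <->
              (2 <= a)%N /\ ((b + 2 <= r)%N \/ (r <= a)%N))),
          (forall a b s, rangeX m a b -> rangeL m s ->
             (tau_rigid (dsum (X a b) (L s)) <->
              (s <= a)%N \/ (b + 2 <= s)%N)),
          (forall a b c d, rangeX m a b -> rangeO m c d ->
             (tau_rigid (dsum (X a b) (Om c d)) <->
              [\/ (b <= c)%N, (d + 1 <= a)%N
                | [/\ (c + 2 <= a)%N, (a <= b)%N & (b <= d - 1)%N]]))
        & [/\ (forall r s, rangeR m r -> rangeR m s ->
                 (basic_rank_two (dsum (R r) (R s)) /\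
                  tau_rigid (dsum (R r) (R s)) <-> r <> s)),
              (forall r s, rangeR m r -> rangeL m s ->
                 (tau_rigid (dsum (R r) (L s)) <->
                  [/\ (2 <= s)%N, (s <= r)%N & (r <= n)%N])),
              (forall r c d, rangeR m r -> rangeO m c d ->
                 (tau_rigid (dsum (R r) (Om c d)) <-> (d + 1 <= r)%N)),
              (forall r s, rangeL m r -> rangeL m s ->
                 (basic_rank_two (dsum (L r) (L s)) /\
                  tau_rigid (dsum (L r) (L s)) <-> r <> s))
            & (forall s c d, rangeL m s -> rangeO m c d ->
                 (tau_rigid (dsum (L s) (Om c d)) <->
                  (c + 2 <= s)%N /\ (s <= d + 1)%N)) /\
              (forall a b c d, rangeO m a b -> rangeO m c d ->
                 before a b c d ->
                 (tau_rigid (dsum (Om a b) (Om c d)) <->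
                  psubint c d a b))]],
      [/\ num_iso_classes (fun M => tau_rigid M /\ @type1 k m M)
            (q * (q - 1) * (q - 2) * (q + 1) / 12),
          num_iso_classes (fun M => tau_rigid M /\ @type2 k m M)
            ((q - 1) * (q - 2) * (2 * q - 3) / 6),
          num_iso_classes (fun M => tau_rigid M /\ @type3 k m M)
            (q * (q - 1) * (2 * q - 1) / 6),
          num_iso_classes (fun M => tau_rigid M /\ @type4 k m M)
            ((q - 1) * (q - 2) * (q ^+ 2 - 3 * q + 4) / 8)
        & [/\ num_iso_classes
                (fun M => [/\ basic_rank_two M, tau_rigid M & @type5 k m M])
                'C(n - 1, 2)%:R,
              num_iso_classes (fun M => tau_rigid M /\ @type6 k m M)
                (q * (q - 1) / 2),
              num_iso_classes (fun M => tau_rigid M /\ @type7 k m M)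
                (q * (q - 1) * (q - 2) / 6),
              num_iso_classes
                (fun M => [/\ basic_rank_two M, tau_rigid M & @type8 k m M])
                'C(n, 2)%:R
            & num_iso_classes (fun M => tau_rigid M /\ @type9 k m M)
                (q * (q - 1) * (q - 2) / 6) /\
              num_iso_classes (fun M => tau_rigid M /\ @type10 k m M)
                ((q - 1) * (q - 2) * (q - 3) * (q + 4) / 24)]]
    & num_iso_classes
        (fun M : fdmod (trivext (pathalg k m)) =>
           basic_rank_two M /\ tau_rigid M)
        ('C(n, 2) * 'C(n + 1, 2))%:R /\
      ('C(n, 2) * 'C(n + 1, 2))%:R = q ^+ 2 * (q ^+ 2 - 1) / 4 ].
Proof.
move=> n q X R L Om; split.
- exact: indecomposable_rigidP.
- move=> M bM rM; have [p vp iso] := rank_two_rigid_code bM rM.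
  exact: type_of_code vp iso.
- split=> [a b c d h1 h2 lt | a b r h1 h2 | a b s h1 h2 | a b c d h1 h2 |].
  + have := @rigid_pairP k m (0, (a, b)) (0, (c, d)) h1 h2; rewrite /= sep_XX // => ->.
    by split=> /orP.
  + have := @rigid_pairP k m (0, (a, b)) (1, (r, 0)) h1; rewrite /= h2 => /(_ isT) ->.
    by rewrite sep_XR //; split=> [/andP[? /orP] | [-> /orP]].
  + have := @rigid_pairP k m (0, (a, b)) (2, (s, 0)) h1; rewrite /= h2 => /(_ isT) ->.
    by rewrite sep_XL //; split=> /orP.
  + have := @rigid_pairP k m (0, (a, b)) (3, (c, d)) h1 h2; rewrite /= sep_XO // => ->.
    have ab : (a <= b)%N by case/and3P: h1.
    split=> [/or3P[|| /andP[ca bd]] | [|| [ca _ bd]]]; try by [constructor 1 | constructor 2 | constructor 3].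
    * by move->.
    * by move->; rewrite orbT.
    by rewrite ca bd !orbT.
  split=> [r s h1 h2 | r s h1 h2 | r c d h1 h2 | r s h1 h2 |].
  + have := @rank_two_distinct k m (1, (r, 0)) (1, (s, 0)); rewrite /= h1 h2.
    move=> /(_ isT isT (sep_RR h1 h2)) ->.
    by split=> ne rs; apply: ne; [rewrite rs | case: rs].
  + have := @rigid_pairP k m (1, (r, 0)) (2, (s, 0)); rewrite /= h1 h2 => /(_ isT isT) ->.
    rewrite sep_RL //; have rn : (r <= n)%N by case/andP: h1.
    by split=> [/andP[] | [-> ->]].
  + have := @rigid_pairP k m (1, (r, 0)) (3, (c, d)); rewrite /= h1 => /(_ isT h2) ->.
    by rewrite sep_RO.
  + have := @rank_two_distinct k m (2, (r, 0)) (2, (s, 0)); rewrite /= h1 h2.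
    move=> /(_ isT isT (sep_LL _ _ _)) ->.
    by split=> ne rs; apply: ne; [rewrite rs | case: rs].
  split=> [s c d h1 h2 | a b c d h1 h2 lt].
  + have := @rigid_pairP k m (2, (s, 0)) (3, (c, d)); rewrite /= h1 => /(_ isT h2) ->.
    by rewrite sep_LO //; split=> /andP.
  have := @rigid_pairP k m (3, (a, b)) (3, (c, d)) h1 h2.
  by rewrite /= sep_OO // => ->.
- split; [| | | | split; [| | | | split]].
  + by rewrite -size_list1 // -(size_map (fun x => ((0, x.1), (0, x.2)))%N); apply: count_type1.
  + by rewrite -size_list2 // -(size_map (fun x => ((0, x.1), (1, (x.2, 0))))%N); apply: count_type2.
  + by rewrite -size_list3 // -(size_map (fun x => ((0, x.1), (2, (x.2, 0))))%N); apply: count_type3.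
  + by rewrite -size_list4 // -(size_map (fun x => ((0, x.2), (3, x.1)))%N); apply: count_type4.
  + have -> : 'C(n - 1, 2)%:R = (size (codes m 5))%:R :> rat.
      by rewrite size_map size_stri // subn1 bin2_rat /n -!natr1 /=; field.
    exact: count_type5.
  + have -> : q * (q - 1) / 2 = (size (codes m 6))%:R.
      by rewrite size_map size_tri // -[n.+1%:R]natr1 -/q; field.
    exact: count_type6.
  + by rewrite -size_list7 // -(size_map (fun x => ((1, (x.2, 0)), (3, x.1)))%N); apply: count_type7.
  + have -> : 'C(n, 2)%:R = (size (codes m 8))%:R :> rat.
      by rewrite size_map size_stri // bin2_rat -[n.+1%:R]natr1; field.
    exact: count_type8.
  + by rewrite -size_list9 // -(size_map (fun x => ((2, (x.2, 0)), (3, x.1)))%N); apply: count_type9.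
  by rewrite -size_list10 // -(size_map (fun x => ((3, x.1), (3, x.2)))%N); apply: count_type10.
have binE : ('C(n, 2) * 'C(n + 1, 2))%:R = q ^+ 2 * (q ^+ 2 - 1) / 4.
  by rewrite natrM !bin2_rat natrD -/q; field.
by split=> //; rewrite binE -size_all_codes; apply: count_all.
Qed.
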